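(* Let $d\ge 1$ be an integer, let $\alpha\in\mathbb{R}$ with $d+1<\alpha<d+2$, and let $1\le p,q\le\infty$. Then the following conditions are equivalent: (1) $K_\alpha:L^p\to L^q$ is bounded; (2) $K_\alpha^+:L^p\to L^q$ is bounded; (3) $K_\alpha:L^p\to L^q$ is compact; (4) $p,q$ satisfy one of the following: (a) $\frac{1}{d+2-\alpha}<p<\infty$ and $\frac1q>\frac1p+\alpha-(d+1)$; (b) $p=\infty$ and $q<\frac{1}{\alpha-(d+1)}$.
   Context: $\mathbb{B}^d$ is the open unit ball of $\mathbb{C}^d$ with Lebesgue measure $dv$ normalized so that $v(\mathbb{B}^d)=1$; $\langle z,w\rangle=\sum_j z_j\overline{w_j}$; $L^p=L^p(\mathbb{B}^d,dv)$. For $\alpha\in\mathbb{R}$ and $f\in L^1(\mathbb{B}^d,dv)$, $$K_\alpha f(z)=\int_{\mathbb{B}^d}\frac{f(w)}{(1-\langle z,w\rangle)^\alpha}\,dv(w),\qquad K_\alpha^+f(z)=\int_{\mathbb{B}^d}\frac{f(w)}{|1-\langle z,w\rangle|^\alpha}\,dv(w),\qquad z\in\mathbb{B}^d$$ (principal branch of the power). The convention $1/\infty=0$ is used. *)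

(* Defs.v *)
From HB Require Import structures.
From mathcomp Require Import all_boot all_order all_algebra.
From mathcomp Require Import complex.
From mathcomp Require Import all_classical all_reals all_analysis.
From mathcomp Require Import measurable_realfun ess_sup_inf.
From mathcomp Require Import ring lra.

Set Implicit Arguments.
Unset Strict Implicit.
Unset Printing Implicit Defensive.

Import Order.TTheory GRing.Theory Num.Theory.
Import numFieldNormedType.Exports.
Import ComplexField.Normc.

Local Open Scope classical_set_scope.
Local Open Scope ring_scope.

(* Borel sigma-algebra of R[i], transported from R * R. *)
Section complex_measurable.
Variable R : realType.

HB.instance Definition _ := isPointed.Build R[i] 0.

Definition complex_pair (z : R[i]) : measurableTypeR R * measurableTypeR R :=
  (complex.Re z, complex.Im z).

Definition pair_complex (xy : measurableTypeR R * measurableTypeR R) : R[i] :=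
  (xy.1 +i* xy.2)%C.

Lemma pair_complexK : cancel pair_complex complex_pair.
Proof. by case. Qed.

HB.instance Definition _ :=
  Measurable.copy R[i] (g_sigma_algebra_preimageType complex_pair).

Lemma measurable_complex_pair : measurable_fun [set: R[i]] complex_pair.
Proof. by move=> _ Y mY; exists Y. Qed.

Lemma measurable_pair_complex : measurable_fun setT pair_complex.
Proof.
move=> _ _ [Y mY <-]; rewrite !setTI -comp_preimage.
by rewrite (_ : _ \o _ = id)//; apply/funext => -[].
Qed.

Lemma measurable_complexP d (T : measurableType d) (f : T -> R[i]) :
  measurable_fun setT f <->
  measurable_fun setT (fun x => complex.Re (f x)) /\
  measurable_fun setT (fun x => complex.Im (f x)).
Proof.
split=> [mf|[mRe mIm]].
  have m : measurable_fun setT (complex_pair \o f).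
    exact: (measurableT_comp measurable_complex_pair).
  by have [] := (measurable_fun_pairP _).1 m.
rewrite (_ : f = pair_complex \o (fun x => (complex.Re (f x), complex.Im (f x)))).
  apply: (measurableT_comp measurable_pair_complex).
  exact: (@measurable_fun_pair _ _ _ T (measurableTypeR R) (measurableTypeR R)).
by apply/funext => x /=; rewrite /pair_complex /=; case: (f x).
Qed.

Lemma measurable_normc : measurable_fun setT (@normc R).
Proof.
have [mRe mIm] := (@measurable_complexP _ R[i] id).1 (@measurable_id _ _ _).
rewrite (_ : @normc R = Num.sqrt \o
   (fun z : R[i] => complex.Re z ^+ 2 + complex.Im z ^+ 2)); last first.
  by apply/funext => -[].
apply: (@measurableT_comp _ _ _ _ _ _ (@Num.sqrt R)).
  by apply: continuous_measurable_fun; exact: sqrt_continuous.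
apply: measurable_funD.
  apply: measurable_funX mRe.
apply: measurable_funX mIm.
Qed.

End complex_measurable.

(* Only products of subprobabilities are canonically sigma-finite in the
   library, so sigma-finiteness of general products is proved here. *)
Lemma product_sigma_finite d1 d2 (T1 : measurableType d1)
    (T2 : measurableType d2) (R : realType)
    (m1 : {sigma_finite_measure set T1 -> \bar R})
    (m2 : {sigma_finite_measure set T2 -> \bar R}) :
  sigma_finite setT (m1 \x m2)%E.
Proof.
have /sigma_finiteP[F [TF ndF Foo]] := sigma_finiteT m1.
have /sigma_finiteP[G [TG ndG Goo]] := sigma_finiteT m2.
exists (fun n => F n `*` G n).
  rewrite -setXTT TF TG predeqE => -[x y]; split.
    move=> [/= [n _ Fnx] [k _ Gky]]; exists (maxn n k) => //; split.
    - by move: x Fnx; exact/subsetPset/ndF/leq_maxl.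
    - by move: y Gky; exact/subsetPset/ndG/leq_maxr.
  by move=> [n _ []/= ? ?]; split; exists n.
move=> k; have [? ?] := Foo k; have [? ?] := Goo k.
split; first exact: measurableX.
by rewrite product_measure1E// lte_mul_pinfty// ge0_fin_numE.
Qed.

Section pushforward_iso.
Context d1 d2 (T1 : measurableType d1) (T2 : measurableType d2) (R : realType).
Variables (mu : {measure set T1 -> \bar R}).
Variables (f : T1 -> T2) (g : T2 -> T1).
Hypotheses (mf : measurable_fun setT f) (mg : measurable_fun setT g).
Hypothesis fK : cancel f g.

Lemma pushforward0 : pushforward mu f set0 = 0%E.
Proof. by rewrite /pushforward preimage_set0 measure0. Qed.

Lemma pushforward_ge0 A : (0 <= pushforward mu f A)%E.
Proof. exact: (measure_ge0 mu (f @^-1` A)). Qed.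

Lemma pushforward_sigma_additive : semi_sigma_additive (pushforward mu f).
Proof.
move=> F mF tF mUF; rewrite /pushforward preimage_bigcup.
apply: measure_semi_sigma_additive.
- by move=> n; rewrite -[X in measurable X]setTI; exact: mf.
- apply/trivIsetP => /= i j _ _ ij; rewrite -preimage_setI.
  by move/trivIsetP : tF => /(_ _ _ _ _ ij) ->//; rewrite preimage_set0.
- by rewrite -preimage_bigcup -[X in measurable X]setTI; exact: mf.
Qed.

Lemma pushforward_sigma_finite :
  sigma_finite setT mu -> sigma_finite setT (pushforward mu f).
Proof.
move=> [F UF mF].
exists (fun n => g @^-1` F n); first by rewrite -preimage_bigcup -UF preimage_setT.
move=> n; have [mFn Foo] := mF n; split.
  by rewrite -[X in measurable X]setTI; exact: mg.
rewrite /pushforward -comp_preimage (_ : g \o f = id)//.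
by apply/funext => x /=; exact: fK.
Qed.

End pushforward_iso.

Section complex_lebesgue.
Variable R : realType.

Definition complex_lebesgue : set R[i] -> \bar R :=
  pushforward (@lebesgue_measure R \x @lebesgue_measure R)%E (@pair_complex R).

Let complex_lebesgue0 : complex_lebesgue set0 = 0%E.
Proof. exact: pushforward0. Qed.

Let complex_lebesgue_ge0 A : (0 <= complex_lebesgue A)%E.
Proof. exact: pushforward_ge0. Qed.

Let complex_lebesgue_sigma_additive : semi_sigma_additive complex_lebesgue.
Proof. exact: pushforward_sigma_additive (@measurable_pair_complex R). Qed.

HB.instance Definition _ := isMeasure.Build _ _ _ complex_lebesgue
  complex_lebesgue0 complex_lebesgue_ge0 complex_lebesgue_sigma_additive.

Let complex_lebesgue_sigma_finite : sigma_finite setT complex_lebesgue.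
Proof.
apply: (pushforward_sigma_finite (@measurable_complex_pair R)).
  exact: pair_complexK.
exact: product_sigma_finite.
Qed.

HB.instance Definition _ := Measure_isSigmaFinite.Build _ _ _ complex_lebesgue
  complex_lebesgue_sigma_finite.

End complex_lebesgue.

Section cons_measure.
Context d (T : measurableType d) (R : realType) (n : nat).
Variable mu : {sigma_finite_measure set T -> \bar R}.
Variable nu : {sigma_finite_measure set (n.-tuple T) -> \bar R}.

Let cons (xt : T * n.-tuple T) : n.+1.-tuple T := [tuple of xt.1 :: xt.2].
Let uncons (t : n.+1.-tuple T) : T * n.-tuple T := (thead t, [tuple of behead t]).

Let mcons : measurable_fun setT cons.
Proof. exact: (measurable_cons measurable_fst measurable_snd). Qed.

Let muncons : measurable_fun setT uncons.
Proof.
by apply: measurable_fun_pair; [exact: measurable_tnth|exact: measurable_behead].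
Qed.

Let consK : cancel cons uncons.
Proof. by move=> [x t]; congr pair; apply/val_inj. Qed.

Definition cons_measure : set (n.+1.-tuple T) -> \bar R :=
  pushforward (mu \x nu)%E (fun xt => [tuple of xt.1 :: xt.2]).

Let cons_measure0 : cons_measure set0 = 0%E.
Proof. exact: pushforward0. Qed.

Let cons_measure_ge0 A : (0 <= cons_measure A)%E.
Proof. exact: pushforward_ge0. Qed.

Let cons_measure_sigma_additive : semi_sigma_additive cons_measure.
Proof. exact: pushforward_sigma_additive mcons. Qed.

HB.instance Definition _ := isMeasure.Build _ _ _ cons_measure
  cons_measure0 cons_measure_ge0 cons_measure_sigma_additive.

Let cons_measure_sigma_finite : sigma_finite setT cons_measure.
Proof.
exact: (pushforward_sigma_finite muncons consK (product_sigma_finite mu nu)).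
Qed.

HB.instance Definition _ := Measure_isSigmaFinite.Build _ _ _ cons_measure
  cons_measure_sigma_finite.

End cons_measure.

(* n-fold product of mu; see tuple_measure_box *)
Fixpoint tuple_measure d (T : measurableType d) (R : realType)
    (mu : {sigma_finite_measure set T -> \bar R}) (n : nat) :
    {sigma_finite_measure set (n.-tuple T) -> \bar R} :=
  match n with
  | 0 => @dirac _ (0.-tuple T) [tuple] R
  | m.+1 => cons_measure mu (tuple_measure mu m)
  end.

Lemma measurable_tuple_box d (T : measurableType d) (n : nat) (A : set T) :
  measurable A -> measurable [set t : n.-tuple T | forall i, A (tnth t i)].
Proof.
move=> mA; rewrite [X in measurable X](_ : _ =
    \bigcap_(i in [set: 'I_n]) ((fun t : n.-tuple T => tnth t i) @^-1` A)).
  apply: fin_bigcap_measurable => // i _; rewrite -[X in measurable X]setTI.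
  exact: measurable_tnth.
by apply/seteqP; split=> [t At i _|t At i]; exact: At.
Qed.

Lemma tuple_measure_box d (T : measurableType d) (R : realType)
    (mu : {sigma_finite_measure set T -> \bar R}) (n : nat) (A : set T) :
  measurable A ->
  tuple_measure mu n [set t | forall i, A (tnth t i)] = (mu A ^+ n)%E.
Proof.
move=> mA; elim: n => [|n IHn].
  by rewrite expe0 /= diracE mem_set// => -[].
rewrite expeS -IHn /= /cons_measure /pushforward.
rewrite (_ : _ @^-1` _ = A `*` [set t | forall i, A (tnth t i)]).
  by rewrite product_measure1E//; exact: measurable_tuple_box.
apply/seteqP; split=> -[x t] /=.
  move=> At; split=> [|i]; first exact: (At ord0).
  by have := At (lift ord0 i); rewrite tnthS.
by move=> [Ax At] i; case: (unliftP ord0 i) => [j ->|->//]; rewrite tnthS.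
Qed.

Section unit_ball.
Variables (R : realType) (d : nat).

Local Notation Cd := (d.-tuple R[i]).

Definition lebesgueC : {sigma_finite_measure set Cd -> \bar R} :=
  tuple_measure (@complex_lebesgue R) d.

Definition hdot (z w : Cd) : R[i] := \sum_(j < d) tnth z j * ((tnth w j)^*)%C.

Definition unit_ball : set Cd := [set z | \sum_(j < d) normc (tnth z j) ^+ 2 < 1].

Lemma measurable_unit_ball : measurable unit_ball.
Proof.
rewrite [X in measurable X](_ : _ = setT `&`
  (fun z : Cd => \sum_(j < d) normc (tnth z j) ^+ 2) @^-1` `]-oo, 1[); last first.
  by apply/seteqP; split => z /=; rewrite in_itv//= => -[].
have mn : measurable_fun setT
    (fun z : Cd => \sum_(j < d) normc (tnth z j) ^+ 2).
  apply: measurable_sum => j; apply: measurable_funX.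
  apply: (measurableT_comp (@measurable_normc R)); exact: measurable_tnth.
exact: mn.
Qed.

Lemma complex_lebesgue_square (r : R) : 0 <= r ->
  let A := [set z : R[i] | `|complex.Re z| <= r /\ `|complex.Im z| <= r] in
  measurable A /\ complex_lebesgue A = ((2 * r) ^+ 2)%:E.
Proof.
move=> r0 A; pose I : set (measurableTypeR R) := `[- r, r]%classic.
have mI : measurable I by exact: measurable_itv.
have AE : A = @complex_pair R @^-1` (I `*` I).
  by apply/seteqP; split=> z; rewrite /A /I /= !in_itv/= -!ler_norml.
have mA : measurable A.
  by rewrite AE -[X in measurable X]setTI; apply: measurable_complex_pair => //; exact: measurableX.
split=> //.
rewrite /complex_lebesgue /pushforward AE -comp_preimage.
rewrite (_ : _ \o _ = id) ?preimage_id; last first.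
  by apply/funext => x /=; exact: pair_complexK.
have lI : lebesgue_measure I = (2 * r)%:E.
  apply: (etrans (lebesgue_measure_itv `[- r, r])) => /=.
  rewrite lte_fin -EFinD opprK -mulr2n mulr_natl; case: ltP => // rr.
  by rewrite (_ : r = 0) ?mul0rn//; apply/eqP; rewrite eq_le r0 andbT; lra.
by rewrite product_measure1E//= lI -EFinM expr2.
Qed.

Lemma lebesgueC_unit_ball : (0 < lebesgueC unit_ball < +oo)%E.
Proof.
have mB := measurable_unit_ball.
pose A (r : R) := [set z : R[i] | `|complex.Re z| <= r /\ `|complex.Im z| <= r].
have lbox (r : R) : 0 <= r -> measurable [set z : Cd | forall i, A r (tnth z i)] /\
    lebesgueC [set z : Cd | forall i, A r (tnth z i)] = (((2 * r) ^+ 2) ^+ d)%:E.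
  move=> r0; have [mA lA] := complex_lebesgue_square r0; split.
    exact: measurable_tuple_box.
  by rewrite /lebesgueC tuple_measure_box// EFin_expe; congr (_ ^+ _)%E; exact: lA.
have ReIm (z : R[i]) : complex.Re z ^+ 2 + complex.Im z ^+ 2 = normc z ^+ 2.
  by case: z => x y /=; rewrite sqr_sqrtr// addr_ge0// sqr_ge0.
apply/andP; split.
  pose r : R := (2 * (d.+1)%:R)^-1.
  have r0 : 0 < r by rewrite invr_gt0 mulr_gt0.
  have [mr lr] := lbox _ (ltW r0).
  apply: (@lt_le_trans _ _ (lebesgueC [set z : Cd | forall i, A r (tnth z i)])).
    by rewrite lr lte_fin !exprn_gt0// mulr_gt0.
  apply: le_measure; rewrite ?inE// => z Az /=.
  have le i : normc (tnth z i) ^+ 2 <= (d.+1)%:R^-1 / 2.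
    have [hr hi] := Az i.
    rewrite -ReIm -(real_normK (num_real (complex.Re _))).
    rewrite -(real_normK (num_real (complex.Im _))).
    have e : d.+1%:R^-1 / 2 = r by rewrite /r invfM mulrC.
    have r2 : r <= 2^-1.
      by rewrite /r invfM ler_piMr ?invr_ge0// invf_le1 ?ler1n// ltr0n.
    rewrite e; have := normr_ge0 (complex.Re (tnth z i)).
    have := normr_ge0 (complex.Im (tnth z i)); nra.
  apply: (@le_lt_trans _ _ (\sum_(j < d) (d.+1)%:R^-1 / 2)).
    by apply: ler_sum => j _; exact: le.
  rewrite sumr_const card_ord -[X in X < _]mulr_natl mulrA.
  have : d%:R / d.+1%:R <= 1 :> R by rewrite ler_pdivrMr ?mul1r ?ler_nat// ltr0n.
  by move: (d%:R / d.+1%:R) => t; lra.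
have [m1 l1] := lbox 1 ler01.
apply: (@le_lt_trans _ _ (lebesgueC [set z : Cd | forall i, A 1 (tnth z i)])).
  apply: le_measure; rewrite ?inE// => z /= Bz i.
  have : normc (tnth z i) ^+ 2 < 1.
    apply: le_lt_trans Bz; rewrite (bigD1 i)//= lerDl.
    by apply: sumr_ge0 => j _; exact: sqr_ge0.
  rewrite -ReIm -(real_normK (num_real (complex.Re _))).
  rewrite -(real_normK (num_real (complex.Im _))).
  have := normr_ge0 (complex.Re (tnth z i)).
  by have := normr_ge0 (complex.Im (tnth z i)); split; nra.
by rewrite l1 ltry.
Qed.

End unit_ball.

Arguments unit_ball {R d}.

Section unit_ball_measure.
Variables (R : realType) (d : nat).

Local Notation Cd := (d.-tuple R[i]).

(* Normalized Lebesgue measure of the unit ball, as a probability on C^d that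
   vanishes outside the ball; the Dirac fallback of mnormalize is never used
   (ball_measureE). *)
Definition ball_measure : probability Cd R :=
  mnormalize (mrestr (lebesgueC R d) (@measurable_unit_ball R d)) (dirac point).

Lemma ball_measureE (A : set Cd) :
  ball_measure A =
  (lebesgueC R d (A `&` unit_ball) * (fine (lebesgueC R d unit_ball))^-1%:E)%E.
Proof.
have /andP[v0 voo] := lebesgueC_unit_ball R d.
pose m : \bar R := lebesgueC R d ([set: Cd] `&` unit_ball).
rewrite -[LHS]/((if (m == 0) || (m == +oo) then fun U => \d_point U
  else fun U => lebesgueC R d (U `&` unit_ball) * (fine m)^-1%:E) A)%E.
by rewrite /m setTI gt_eqF// lt_eqF.
Qed.

End unit_ball_measure.

Section complex_power.
Variable R : realType.

(* principal argument, in ]-pi, pi] for z != 0 *)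
Definition carg (z : R[i]) : R :=
  let t := acos (complex.Re z / normc z) in
  if 0 <= complex.Im z then t else - t.

(* principal branch of z |-> z ^ a, for z != 0 *)
Definition cpow (z : R[i]) (a : R) : R[i] :=
  ((normc z `^ a) * cos (a * carg z) +i* ((normc z `^ a) * sin (a * carg z)))%C.

End complex_power.

Section complex_Lp.
Context d (T : measurableType d) (R : realType).
Variable mu : {measure set T -> \bar R}.

Definition cintegral (D : set T) (f : T -> R[i]) : R[i] :=
  Complex (\int[mu]_(x in D) complex.Re (f x)) (\int[mu]_(x in D) complex.Im (f x)).

Definition cLnorm (p : \bar R) (f : T -> R[i]) : \bar R :=
  Lnorm mu p (fun x => (normc (f x))%:E).

Definition cLfun (p : \bar R) : set (T -> R[i]) :=
  [set f | measurable_fun setT f /\ (cLnorm p f < +oo)%E].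

Lemma normc_ge0 (z : R[i]) : 0 <= normc z.
Proof. by case: z => x y /=; rewrite sqrtr_ge0. Qed.

Lemma cLnorm_mono p (u v : T -> R) : (1 <= p)%E ->
  measurable_fun setT u -> measurable_fun setT v ->
  (forall x, 0 <= u x <= v x) ->
  ('N[mu]_p[EFin \o u] <= 'N[mu]_p[EFin \o v])%E.
Proof.
move=> p1 mu_ mv uv; have uv' x : `|u x| <= `|v x|.
  by have /andP[u0 uv0] := uv x; rewrite !ger0_norm// (le_trans u0).
rewrite unlock /Lnorm; case: p p1 => [r|_|//].
- rewrite lee_fin => r1; have r0 : 0 <= r by rewrite (le_trans _ r1).
  have mp (h : T -> R) : measurable_fun setT h ->
      measurable_fun setT (fun x => (`|(EFin \o h) x| `^ r)%E).
    move=> mh; apply: (measurableT_comp (measurable_poweR r)) => /=.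
    exact/measurable_EFinP/measurableT_comp.
  have i0 (h : T -> R) : (0 <= \int[mu]_x (`|(EFin \o h) x| `^ r))%E.
    by apply: integral_ge0 => x _; exact: poweR_ge0.
  apply: gt0_ler_poweR; rewrite ?invr_ge0 ?in_itv/= ?i0 ?leey//.
  apply: ge0_le_integral => //; [exact: mp|exact: mp|] => x _.
  by rewrite lee_fin ge0_ler_powR// nnegrE.
- case: ifPn => // _; apply: le_ess_sup; apply/nearW => x /=.
  by rewrite lee_fin.
Qed.

Lemma measurable_cadd (f g : T -> R[i]) : measurable_fun setT f -> measurable_fun setT g ->
  measurable_fun setT (f \+ g).
Proof.
move=> mf mg; have [fr fi] := (measurable_complexP f).1 mf.
have [gr gi] := (measurable_complexP g).1 mg.
apply/measurable_complexP; split.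
  rewrite (_ : (fun x => _) =
      (fun x => complex.Re (f x)) \+ (fun x => complex.Re (g x))).
    exact: measurable_funD.
  by apply/funext => x /=; case: (f x) (g x) => [? ?] [? ?].
rewrite (_ : (fun x => _) =
    (fun x => complex.Im (f x)) \+ (fun x => complex.Im (g x))).
  exact: measurable_funD.
by apply/funext => x /=; case: (f x) (g x) => [? ?] [? ?].
Qed.

Lemma measurable_csub (f g : T -> R[i]) : measurable_fun setT f -> measurable_fun setT g ->
  measurable_fun setT (f \- g).
Proof.
move=> mf mg; apply: measurable_cadd => //.
have [gr gi] := (measurable_complexP g).1 mg.
apply/measurable_complexP; split.
  rewrite (_ : (fun x => _) = \- (fun x => complex.Re (g x))).
    exact: measurable_funN.
  by apply/funext => x /=; case: (g x).
rewrite (_ : (fun x => _) = \- (fun x => complex.Im (g x))).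
  exact: measurable_funN.
by apply/funext => x /=; case: (g x).
Qed.

Lemma cLnormN p (f g : T -> R[i]) : cLnorm p (f \- g) = cLnorm p (g \- f).
Proof. by apply: eq_Lnorm => x /=; rewrite -normcN opprB. Qed.

Lemma cLnorm0 p : (1 <= p)%E -> cLnorm p (cst 0) = 0%E.
Proof.
move=> p1; rewrite -(@Lnorm0 _ _ _ mu p).
  by apply: eq_Lnorm => x; congr (_%:E); exact: normc0.
by rewrite gt_eqF// (lt_le_trans _ p1).
Qed.

Lemma cLnorm_triangle p (f g : T -> R[i]) : (1 <= p)%E ->
  measurable_fun setT f -> measurable_fun setT g ->
  (cLnorm p (f \+ g)%R <= cLnorm p f + cLnorm p g)%E.
Proof.
move=> p1 mf mg.
have mn (h : T -> R[i]) : measurable_fun setT h -> measurable_fun setT (fun x => normc (h x)).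
  by move=> mh; apply: (measurableT_comp (@measurable_normc R)); exact: mh.
have mfg := measurable_cadd mf mg.
apply: (@le_trans _ _ (Lnorm mu p (fun x => (normc (f x) + normc (g x))%:E))).
  apply: cLnorm_mono => //; first exact: mn.
    by apply: measurable_funD; exact: mn.
  by move=> x; rewrite normc_ge0 le_normcD.
exact: (eminkowski mu (mn _ mf) (mn _ mg) p1).
Qed.

End complex_Lp.

Section complex_Lp_space.
Context d (T : measurableType d) (R : realType).
Variables (mu : {measure set T -> \bar R}) (p : \bar R).

(* Functions are not identified almost everywhere: this is a pseudometric
   space whose Kolmogorov quotient is L^p(mu). *)
Record cLfunType (p1 : (1 <= p)%E) : Type :=
  CLfun { clfun :> T -> R[i]; clfunP : cLfun mu p clfun }.

Variable p1 : (1 <= p)%E.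
Local Notation LT := (cLfunType p1).

HB.instance Definition _ := gen_eqMixin LT.
HB.instance Definition _ := gen_choiceMixin LT.

Let cL_ball (f : LT) (e : R) (g : LT) : Prop := (cLnorm mu p (f \- g)%R < e%:E)%E.
Let cL_ent : set_system (LT * LT) := entourage_ cL_ball.
Let cL_nbhs (f : LT) : set_system LT := nbhs_ cL_ent f.

HB.instance Definition _ := hasNbhs.Build LT cL_nbhs.

Let cL_nbhsE : nbhs = nbhs_ cL_ent.
Proof. by []. Qed.

Let cL_ball_center f (e : R) : 0 < e -> cL_ball f e f.
Proof.
move=> e0; rewrite /cL_ball (_ : f \- f = cst 0) ?cLnorm0//.
by apply/funext => x /=; rewrite subrr.
Qed.

Let cL_ball_sym f g (e : R) : cL_ball f e g -> cL_ball g e f.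
Proof. by rewrite /cL_ball cLnormN. Qed.

Let cL_ball_triangle f g h (e1 e2 : R) :
  cL_ball f e1 g -> cL_ball g e2 h -> cL_ball f (e1 + e2) h.
Proof.
rewrite /cL_ball => fg gh.
have mB (u v : LT) : measurable_fun setT (u \- v).
  exact: measurable_csub (clfunP u).1 (clfunP v).1.
rewrite (_ : f \- h = (f \- g) \+ (g \- h)); last first.
  by apply/funext => x /=; rewrite addrA subrK.
apply: (le_lt_trans (cLnorm_triangle _ p1 (mB f g) (mB g h))).
by rewrite EFinD lteD.
Qed.

Let cL_entE : cL_ent = entourage_ cL_ball.
Proof. by []. Qed.

HB.instance Definition _ := @Nbhs_isPseudoMetric.Build R LT
  cL_ent cL_nbhsE cL_ball cL_ball_center cL_ball_sym cL_ball_triangle cL_entE.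

End complex_Lp_space.

Section operators.
Context d (T : measurableType d) (R : realType).
Variable mu : {measure set T -> \bar R}.

Definition bounded_op (p q : \bar R) (S : (T -> R[i]) -> (T -> R[i])) : Prop :=
  exists C : R, forall f, cLfun mu p f ->
    cLfun mu q (S f) /\ (cLnorm mu q (S f) <= C%:E * cLnorm mu p f)%E.

(* S maps norm-bounded subsets of L^p to relatively compact subsets of L^q *)
Definition compact_op (p q : \bar R) (q1 : (1 <= q)%E)
    (S : (T -> R[i]) -> (T -> R[i])) : Prop :=
  (forall f, cLfun mu p f -> cLfun mu q (S f)) /\
  forall A : set (T -> R[i]), A `<=` cLfun mu p ->
    (exists M : R, forall f, A f -> (cLnorm mu p f <= M%:E)%E) ->
    precompact [set g : cLfunType mu q1 | exists2 f, A f & g = S f :> (T -> R[i])].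

End operators.

Section bergman_type_operators.
Variables (R : realType) (d : nat) (alpha : R).

Local Notation Cd := (d.-tuple R[i]).
Local Notation v := (ball_measure R d).

(* Functions on the ball are represented by functions on C^d; the values
   outside the ball are irrelevant since v vanishes there. *)
Definition K_op (f : Cd -> R[i]) (z : Cd) : R[i] :=
  if z \in unit_ball then
    cintegral v unit_ball (fun w => f w / cpow (1 - hdot z w) alpha)
  else 0.

Definition Kplus_op (f : Cd -> R[i]) (z : Cd) : R[i] :=
  if z \in unit_ball then
    cintegral v unit_ball (fun w => f w / ((normc (1 - hdot z w) `^ alpha)%:C)%C)
  else 0.

End bergman_type_operators.

(* Main.v *)
(** Put t = alpha - (d + 1), a number of ]0, 1[; condition (4) says that q is
    finite and 1/q > 1/p + t.

    Sufficiency. Since |1 - <z,w>| >= (1 - |z|^2) / 2, for t' slightly larger than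
    t the kernel is at most a constant times (1 - |z|^2)^(-t') |1 - <z,w>|^(-(alpha - t')).
    The second factor is uniformly integrable in each variable, hence bounded on
    L^p by Schur's test, and the first one lies in L^r for r < 1/t', so Hoelder's
    inequality gives the bound with a positive power of 1 - |z|^2 to spare. This
    spare power makes the mass near the sphere uniformly small, and away from the
    sphere the kernel is Lipschitz: every ultrafilter of images of the unit ball
    converges in L^q.

    Necessity. A bounded operator remains bounded when p grows and q decreases, so
    it suffices to refute boundedness when 1/q = 1/p + t. Around a point a with
    1 - |a|^2 = rho, on a box of size rho^(1/2) in the complex tangential directions
    and rho in the complex normal one, 1 - <z,w> stays close to rho and both kernels
    have real part at least c rho^(-alpha). Disjoint boxes of all the scales
    rho = 4^-k are weighted by rho^(-1/p) and summed with random signs: if S is the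
    sum of v(box) / rho over the family, the test function f satisfies
    |f|_p^p = S (|f| <= 1 if p is infinite) while |K f|_q^q >= c S for some choice
    of signs. As S is unbounded and q < p, this is impossible. *)

Require Import Defs.
From HB Require Import structures.
From mathcomp Require Import all_boot all_order all_algebra.
From mathcomp Require Import complex.
From mathcomp Require Import all_classical all_reals all_analysis.
From mathcomp Require Import measurable_realfun ess_sup_inf.
From mathcomp Require Import ring lra.

Set Implicit Arguments.
Unset Strict Implicit.
Unset Printing Implicit Defensive.

Import Order.TTheory GRing.Theory Num.Theory.
Import numFieldNormedType.Exports.
Import ComplexField.Normc.

Local Open Scope classical_set_scope.
Local Open Scope ring_scope.

(** * Geometry of the ball *)

(** Both operators are instances of [kernel_op], and the proof uses only a few properties of the
    kernel on Re u > 0: the bound |u|^(-alpha), a lower bound of the real part in a narrow sector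
    and, for compactness, a local Lipschitz condition. The oscillating kernel thus costs no more
    than the positive one. The signs answer the main obstacle to necessity: for K_alpha the
    contributions of the other boxes at a given point may cancel the main one. Averaging over signs
    removes them. The exponents: a box of scale rho has volume about rho^(d + 1), so its indicator
    weighted by rho^(-s) has an image of size rho^(-s - alpha + d + 1) = rho^(-(s + t)) on the box
    itself. If (s + t) q = 1, the q-th power of this is 1/rho, which is also the p-th power of the
    weight when s p = 1. Since alpha < d + 2, t < 1 and the critical exponent 1/t for p infinite is
    at least 1. Along an ultrafilter bounded scalar functions converge with no extraction of
    subsequences; the price is that measurability of the limit and a substitute for Fatou's lemma,
    which are sequential, have to be recovered separately. *)

Section complex_modulus.
Variable R : realType.
Implicit Types u w : R[i].

Lemma sqr_normc_ReIm u : normc u ^+ 2 = complex.Re u ^+ 2 + complex.Im u ^+ 2.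
Proof. by case: u => x y /=; rewrite sqr_sqrtr// addr_ge0// sqr_ge0. Qed.

Lemma Re_le_normc u : `|complex.Re u| <= normc u.
Proof.
by rewrite -ler_sqr ?nnegrE ?normc_ge0// sqr_normc_ReIm real_normK ?num_real// lerDl sqr_ge0.
Qed.

Lemma Im_le_normc u : `|complex.Im u| <= normc u.
Proof.
by rewrite -ler_sqr ?nnegrE ?normc_ge0// sqr_normc_ReIm real_normK ?num_real// lerDr sqr_ge0.
Qed.

Lemma normc_le_ReIm u : normc u <= `|complex.Re u| + `|complex.Im u|.
Proof.
rewrite -ler_sqr ?nnegrE ?normc_ge0 ?addr_ge0// sqr_normc_ReIm sqrrD.
by rewrite !real_normK ?num_real// addrAC lerDl mulrn_wge0// mulr_ge0.
Qed.

Lemma ReD u w : complex.Re (u + w) = complex.Re u + complex.Re w.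
Proof. by case: u w => [? ?] [? ?]. Qed.

Lemma ImD u w : complex.Im (u + w) = complex.Im u + complex.Im w.
Proof. by case: u w => [? ?] [? ?]. Qed.

Lemma ReN u : complex.Re (- u) = - complex.Re u.
Proof. by case: u. Qed.

Lemma ImN u : complex.Im (- u) = - complex.Im u.
Proof. by case: u. Qed.

Lemma ReM u w : complex.Re (u * w) =
  complex.Re u * complex.Re w - complex.Im u * complex.Im w.
Proof. by case: u w => [? ?] [? ?]. Qed.

Lemma ImM u w : complex.Im (u * w) =
  complex.Re u * complex.Im w + complex.Im u * complex.Re w.
Proof. by case: u w => [? ?] [? ?]. Qed.

Lemma ReJ u : complex.Re (u^*)%C = complex.Re u.
Proof. by case: u. Qed.

Lemma ImJ u : complex.Im (u^*)%C = - complex.Im u.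
Proof. by case: u. Qed.

Lemma Re_sum I (r : seq I) (P : pred I) (F : I -> R[i]) :
  complex.Re (\sum_(i <- r | P i) F i) = \sum_(i <- r | P i) complex.Re (F i).
Proof. exact: (big_morph _ ReD). Qed.

Lemma Im_sum I (r : seq I) (P : pred I) (F : I -> R[i]) :
  complex.Im (\sum_(i <- r | P i) F i) = \sum_(i <- r | P i) complex.Im (F i).
Proof. exact: (big_morph _ ImD). Qed.

Lemma complex_eq u w :
  complex.Re u = complex.Re w -> complex.Im u = complex.Im w -> u = w.
Proof. by case: u w => [? ?] [? ?] /= -> ->. Qed.

Lemma normc_conj u : normc (u^*)%C = normc u.
Proof. by case: u => a b /=; rewrite sqrrN. Qed.

Lemma normc_real (x : R) : normc (x%:C)%C = `|x|.
Proof. by rewrite /= expr0n addr0 sqrtr_sqr. Qed.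

Lemma le_normc_sum I (r : seq I) (P : pred I) (F : I -> R[i]) :
  normc (\sum_(i <- r | P i) F i) <= \sum_(i <- r | P i) normc (F i).
Proof.
apply: (big_ind2 (fun u x => normc u <= x)) => //; first by rewrite normc0.
by move=> u x w y ux wy; rewrite (le_trans (le_normcD _ _))// lerD.
Qed.

Lemma normcB u w : normc (u - w) = normc (w - u).
Proof. by rewrite -normcN opprB. Qed.

Lemma ler_normcB u w : normc u - normc w <= normc (u - w).
Proof. by rewrite lerBlDr (le_trans _ (le_normcD _ _))// subrK. Qed.

End complex_modulus.

Section ball_geometry.
Variables (R : realType) (d : nat).
Local Notation Cd := (d.-tuple R[i]).
Implicit Types a z w : Cd.

Definition bdist z : R := 1 - \sum_(j < d) normc (tnth z j) ^+ 2.

Lemma bdist_le1 z : bdist z <= 1.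
Proof. by rewrite gerBl sumr_ge0// => j _; rewrite sqr_ge0. Qed.

Lemma unit_ballE : @unit_ball R d = [set z | 0 < bdist z].
Proof. by apply/seteqP; split => z; rewrite /bdist /= subr_gt0. Qed.

Lemma unit_ballP z : unit_ball z <-> 0 < bdist z.
Proof. by rewrite unit_ballE. Qed.

Lemma hdotC z w : hdot w z = ((hdot z w)^*)%C.
Proof.
apply: complex_eq; rewrite /hdot ?ReJ ?ImJ ?Re_sum ?Im_sum.
  by apply: eq_bigr => j _; rewrite !ReM !ReJ !ImJ; ring.
by rewrite -sumrN; apply: eq_bigr => j _; rewrite !ImM !ReJ !ImJ; ring.
Qed.

Lemma normc_1hdotC z w : normc (1 - hdot w z) = normc (1 - hdot z w).
Proof.
rewrite hdotC -[RHS]normc_conj; congr normc.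
by apply: complex_eq; rewrite ?ReD ?ImD ?ReN ?ImN ?ReJ ?ImJ ?ReD ?ImD ?ReN ?ImN/=; ring.
Qed.

(** Polarization of |z - w|^2. On the ball all three terms on the right are nonnegative: dropping
    the last one bounds the kernel from above, dropping the first two shows that w is close to z
    when 1 - <z,w> is small. *)
Lemma Re_1hdot z w : 2 * complex.Re (1 - hdot z w) =
  bdist z + bdist w + \sum_(j < d) normc (tnth z j - tnth w j) ^+ 2.
Proof.
rewrite /bdist ReD ReN Re_sum /= mulrDr mulrN mulr1.
have -> : \sum_(j < d) normc (tnth z j - tnth w j) ^+ 2 =
    \sum_(j < d) normc (tnth z j) ^+ 2 + \sum_(j < d) normc (tnth w j) ^+ 2
    - 2 * \sum_(j < d) complex.Re (tnth z j * ((tnth w j)^*)%C).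
  rewrite mulr_sumr -big_split -sumrB/=; apply: eq_bigr => j _.
  by rewrite !sqr_normc_ReIm ReM ReJ ImJ ReD ImD ReN ImN; ring.
ring.
Qed.

Lemma sumsq_ge0 z w : 0 <= \sum_(j < d) normc (tnth z j - tnth w j) ^+ 2.
Proof. by apply: sumr_ge0 => j _; exact: sqr_ge0. Qed.

Lemma Re_1hdot_ge z w : (bdist z + bdist w) / 2 <= complex.Re (1 - hdot z w).
Proof.
by have := Re_1hdot z w; have := sumsq_ge0 z w; lra.
Qed.

Lemma Re_1hdot_gt0 z w : unit_ball z -> unit_ball w -> 0 < complex.Re (1 - hdot z w).
Proof.
move=> /unit_ballP z0 /unit_ballP w0; apply: lt_le_trans (Re_1hdot_ge z w).
by rewrite divr_gt0// addr_gt0.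
Qed.

Lemma normc_1hdot_ge z w : (bdist z + bdist w) / 2 <= normc (1 - hdot z w).
Proof.
by rewrite (le_trans (Re_1hdot_ge z w))// (le_trans (ler_norm _))// Re_le_normc.
Qed.

Lemma normc_1hdot_gt0 z w : unit_ball z -> unit_ball w -> 0 < normc (1 - hdot z w).
Proof.
move=> /unit_ballP z0 /unit_ballP w0; apply: lt_le_trans (normc_1hdot_ge z w).
by rewrite divr_gt0// addr_gt0.
Qed.

Lemma coord_le1 z j : unit_ball z -> normc (tnth z j) <= 1.
Proof.
move=> /unit_ballP; rewrite subr_gt0 => z1.
rewrite -(@expr_le1 _ 2) ?normc_ge0//; apply/ltW; apply: le_lt_trans z1.
by rewrite (bigD1 j)//= lerDl sumr_ge0// => i _; rewrite sqr_ge0.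
Qed.

Lemma hdotBl z z' w : hdot z w - hdot z' w = \sum_(j < d) (tnth z j - tnth z' j) * ((tnth w j)^*)%C.
Proof. by rewrite /hdot -sumrB; apply: eq_bigr => j _; rewrite mulrBl. Qed.

Lemma normc_hdotBl z z' w : unit_ball w ->
  normc (hdot z w - hdot z' w) <= \sum_(j < d) normc (tnth z j - tnth z' j).
Proof.
move=> Bw; rewrite hdotBl (le_trans (le_normc_sum _ _ _))//.
apply: ler_sum => j _; rewrite normcM normc_conj ler_piMr ?normc_ge0//.
exact: coord_le1.
Qed.

Lemma normc_hdot_le1 z w : unit_ball z -> unit_ball w -> normc (hdot z w) <= 1.
Proof.
move=> /unit_ballP; rewrite subr_gt0 => z1 /unit_ballP; rewrite subr_gt0 => w1.
rewrite (le_trans (le_normc_sum _ _ _))//.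
have : 2 * \sum_(j < d) normc (tnth z j * ((tnth w j)^*)%C) <=
   \sum_(j < d) normc (tnth z j) ^+ 2 + \sum_(j < d) normc (tnth w j) ^+ 2.
  rewrite mulr_sumr -big_split; apply: ler_sum => j _ /=.
  rewrite normcM normc_conj; have := sqr_ge0 (normc (tnth z j) - normc (tnth w j)).
  by rewrite sqrrB -mulr_natl; lra.
lra.
Qed.

End ball_geometry.

(** * Volumes *)

Section measurable_complex_ops.
Context d (T : measurableType d) (R : realType).
Implicit Types f g : T -> R[i].

Lemma measurable_Re f : measurable_fun setT f ->
  measurable_fun setT (fun x => complex.Re (f x)).
Proof. by case/measurable_complexP. Qed.

Lemma measurable_Im f : measurable_fun setT f ->
  measurable_fun setT (fun x => complex.Im (f x)).
Proof. by case/measurable_complexP. Qed.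

Lemma measurable_cmul f g : measurable_fun setT f -> measurable_fun setT g ->
  measurable_fun setT (fun x => f x * g x).
Proof.
move=> mf mg; apply/measurable_complexP; split.
  under eq_fun do rewrite ReM.
  by apply: measurable_funB; apply: measurable_funM;
    [exact: measurable_Re|exact: measurable_Re|exact: measurable_Im|exact: measurable_Im].
under eq_fun do rewrite ImM.
by apply: measurable_funD; apply: measurable_funM;
  [exact: measurable_Re|exact: measurable_Im|exact: measurable_Im|exact: measurable_Re].
Qed.

Lemma measurable_conj f : measurable_fun setT f ->
  measurable_fun setT (fun x => ((f x)^*)%C).
Proof.
move=> mf; apply/measurable_complexP; split.
  by under eq_fun do rewrite ReJ; exact: measurable_Re.
by under eq_fun do rewrite ImJ; apply: measurable_funN; exact: measurable_Im.
Qed.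

Lemma measurable_csum (I : Type) (s : seq I) (F : I -> T -> R[i]) :
  (forall i, measurable_fun setT (F i)) ->
  measurable_fun setT (fun x => \sum_(i <- s) F i x).
Proof.
move=> mF; apply/measurable_complexP; split.
  under eq_fun do rewrite Re_sum.
  by apply: measurable_sum => i; exact: measurable_Re.
under eq_fun do rewrite Im_sum.
by apply: measurable_sum => i; exact: measurable_Im.
Qed.

Lemma measurable_normc_comp f : measurable_fun setT f ->
  measurable_fun setT (fun x => normc (f x)).
Proof. by move=> mf; apply: (measurableT_comp (@measurable_normc R)). Qed.

Lemma measurable_ler_set (f g : T -> R) :
  measurable_fun setT f -> measurable_fun setT g -> measurable [set x | f x <= g x].
Proof.
move=> mf mg; rewrite -[X in measurable X]setTI.
have := measurable_fun_ler mf mg measurableT (Y := [set true]).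
by apply.
Qed.

Lemma measurable_ltr_set (f g : T -> R) :
  measurable_fun setT f -> measurable_fun setT g -> measurable [set x | f x < g x].
Proof.
move=> mf mg; rewrite -[X in measurable X]setTI.
have := measurable_fun_ltr mf mg measurableT (Y := [set true]).
by apply.
Qed.

Lemma measurable_cst_set (P : Prop) : measurable [set _ : T | P].
Proof.
have [p|np] := pselect P.
  by rewrite (_ : mkset _ = setT) ?measurableT//; apply/seteqP; split.
by rewrite (_ : mkset _ = set0) ?measurable0//; apply/seteqP; split.
Qed.

End measurable_complex_ops.

Section product_bounds.
Context d1 d2 (T1 : measurableType d1) (T2 : measurableType d2) (R : realType).
Variable m1 : {sigma_finite_measure set T1 -> \bar R}.
Variable m2 : {sigma_finite_measure set T2 -> \bar R}.
Local Open Scope ereal_scope.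
Implicit Types A : set (T1 * T2).

Lemma product_measure2_eq A : measurable A -> (m1 \x m2) A = (m1 \x^ m2) A.
Proof. by move=> mA; apply: product_measure_unique => //= *; rewrite product_measure2E. Qed.

(** Cavalieri's principle as an inequality: sections vanish off D and have measure at most c over D.
    The volumes below are all obtained by slicing, since only their orders of magnitude matter. *)
Lemma product_measure_le1 A (D : set T1) (c : \bar R) :
  measurable A -> measurable D -> 0 <= c ->
  (forall x y, A (x, y) -> D x) ->
  (forall x, D x -> m2 (xsection A x) <= c) ->
  (m1 \x m2) A <= c * m1 D.
Proof.
move=> mA mD c0 AD Dc; rewrite /product_measure1.
rewrite [leLHS](_ : _ = \int[m1]_(x in D) (m2 \o xsection A) x).
  rewrite -(integral_cst _ mD); apply: ge0_le_integral => //.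
  by apply: measurable_funTS; exact: measurable_fun_xsection.
rewrite [RHS]integral_mkcond; apply: eq_integral => x _; rewrite patchE.
case: ifPn => // /negP xD; rewrite /= (_ : xsection A x = set0) ?measure0//.
by rewrite -subset0 => y; rewrite /xsection/= inE => /AD; rewrite -[D x]inE.
Qed.

Lemma product_measure_le2 A (D : set T2) (c : \bar R) :
  measurable A -> measurable D -> 0 <= c ->
  (forall x y, A (x, y) -> D y) ->
  (forall y, D y -> m1 (ysection A y) <= c) ->
  (m1 \x m2) A <= c * m2 D.
Proof.
move=> mA mD c0 AD Dc; rewrite product_measure2_eq// /product_measure2.
rewrite [leLHS](_ : _ = \int[m2]_(x in D) (m1 \o ysection A) x).
  rewrite -(integral_cst _ mD); apply: ge0_le_integral => //.
  by apply: measurable_funTS; exact: measurable_fun_ysection.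
rewrite [RHS]integral_mkcond; apply: eq_integral => x _; rewrite patchE.
case: ifPn => // /negP xD; rewrite /= (_ : ysection A x = set0) ?measure0//.
by rewrite -subset0 => y; rewrite /ysection/= inE => /AD; rewrite -[D x]inE.
Qed.

Lemma product_measure_ge2 A (D : set T2) (c : \bar R) :
  measurable A -> measurable D -> 0 <= c ->
  (forall y, D y -> c <= m1 (ysection A y)) ->
  c * m2 D <= (m1 \x m2) A.
Proof.
move=> mA mD c0 Dc; rewrite product_measure2_eq// /product_measure2.
rewrite -(integral_cst _ mD).
apply: (@le_trans _ _ (\int[m2]_(x in D) (m1 \o ysection A) x)).
  apply: ge0_le_integral => //.
  by apply: measurable_funTS; exact: measurable_fun_ysection.
by apply: ge0_subset_integral => //; exact: measurable_fun_ysection.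
Qed.

End product_bounds.

Section lebesgueC_cons.
Context (R : realType) (n : nat).
Local Open Scope ereal_scope.
Implicit Types A : set (n.+1.-tuple R[i]).
Let cons (xt : R[i] * n.-tuple R[i]) : n.+1.-tuple R[i] := [tuple of xt.1 :: xt.2].

Let mcons A : measurable A -> measurable (cons @^-1` A).
Proof.
move=> mA; rewrite -[X in measurable X]setTI.
exact: (measurable_cons measurable_fst measurable_snd).
Qed.

Lemma lebesgueC_consE A :
  lebesgueC R n.+1 A = (@complex_lebesgue R \x lebesgueC R n) (cons @^-1` A).
Proof. by []. Qed.

(** The slicing bounds read through C^(n+1) = C x C^n. In the [_head] form the slices are
    n-dimensional and D constrains the first coordinate; in the [_tail] forms the slices are planar
    and D constrains the last n coordinates. *)
Lemma lebesgueC_le_head A (D : set R[i]) (c : \bar R) :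
  measurable A -> measurable D -> 0 <= c ->
  (forall x (t : n.-tuple R[i]), A [tuple of x :: t] -> D x) ->
  (forall x, D x -> lebesgueC R n [set t : n.-tuple R[i] | A [tuple of x :: t]] <= c) ->
  lebesgueC R n.+1 A <= c * @complex_lebesgue R D.
Proof.
move=> mA mD c0 AD Dc; rewrite lebesgueC_consE; apply: product_measure_le1 => //; first exact: mcons.
move=> x Dx; apply: le_trans (Dc x Dx); rewrite le_eqVlt; apply/orP; left; apply/eqP.
by congr (lebesgueC R n _); apply/seteqP; split => t; rewrite /xsection/= inE.
Qed.

Lemma lebesgueC_le_tail A (D : set (n.-tuple R[i])) (c : \bar R) :
  measurable A -> measurable D -> 0 <= c ->
  (forall x (t : n.-tuple R[i]), A [tuple of x :: t] -> D t) ->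
  (forall t : n.-tuple R[i], D t -> @complex_lebesgue R [set x | A [tuple of x :: t]] <= c) ->
  lebesgueC R n.+1 A <= c * lebesgueC R n D.
Proof.
move=> mA mD c0 AD Dc; rewrite lebesgueC_consE; apply: product_measure_le2 => //; first exact: mcons.
move=> x Dx; apply: le_trans (Dc x Dx); rewrite le_eqVlt; apply/orP; left; apply/eqP.
by congr (complex_lebesgue _); apply/seteqP; split => t; rewrite /ysection/= inE.
Qed.

Lemma lebesgueC_ge_tail A (D : set (n.-tuple R[i])) (c : \bar R) :
  measurable A -> measurable D -> 0 <= c ->
  (forall t : n.-tuple R[i], D t -> c <= @complex_lebesgue R [set x | A [tuple of x :: t]]) ->
  c * lebesgueC R n D <= lebesgueC R n.+1 A.
Proof.
move=> mA mD c0 Dc; rewrite lebesgueC_consE; apply: product_measure_ge2 => //; first exact: mcons.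
move=> x Dx; apply: (le_trans (Dc x Dx)); rewrite le_eqVlt; apply/orP; left; apply/eqP.
by congr (complex_lebesgue _); apply/seteqP; split => t; rewrite /ysection/= inE.
Qed.

End lebesgueC_cons.

Section volumes.
Variable R : realType.
Local Notation area := (@complex_lebesgue R).

Lemma complex_lebesgue_rect (I J : set (measurableTypeR R)) :
  measurable I -> measurable J ->
  measurable [set z : R[i] | I (complex.Re z) /\ J (complex.Im z)] /\
  area [set z | I (complex.Re z) /\ J (complex.Im z)] =
    (lebesgue_measure I * lebesgue_measure J)%E.
Proof.
move=> mI mJ.
have E : [set z : R[i] | I (complex.Re z) /\ J (complex.Im z)] =
    @complex_pair R @^-1` (I `*` J) by [].
split.
  rewrite E -[X in measurable X]setTI.
  by apply: measurable_complex_pair => //; exact: measurableX.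
rewrite E /complex_lebesgue /pushforward -comp_preimage.
rewrite (_ : _ \o _ = id) ?preimage_id; last first.
  by apply/funext => x /=; exact: pair_complexK.
by rewrite product_measure1E.
Qed.

Lemma lebesgue_itv_center (c r : R) : 0 <= r ->
  lebesgue_measure (`[c - r, c + r]%classic : set R) = (2 * r)%:E.
Proof.
move=> r0; rewrite lebesgue_measure_itv/= lte_fin -EFinD; case: ltP => h.
  by congr _%:E; lra.
by congr _%:E; lra.
Qed.

Lemma area_square (c : R[i]) (r : R) : 0 <= r ->
  area [set z | `|complex.Re (z - c)| <= r /\ `|complex.Im (z - c)| <= r] =
    ((2 * r) ^+ 2)%:E.
Proof.
move=> r0.
have [_] := complex_lebesgue_rect
  (measurable_itv `[complex.Re c - r, complex.Re c + r])
  (measurable_itv `[complex.Im c - r, complex.Im c + r]).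
rewrite !lebesgue_itv_center// -EFinM -expr2 => <-; congr (area _).
apply/seteqP; split => z /=; rewrite !in_itv/= ReD ImD ReN ImN !ler_norml => -[h1 h2];
  split; lra.
Qed.

Lemma measurable_square (c : R[i]) (r : R) :
  measurable [set z : R[i] | `|complex.Re (z - c)| <= r /\ `|complex.Im (z - c)| <= r].
Proof.
have mB : measurable_fun setT (fun z : R[i] => z - c).
  exact: (measurable_csub (@measurable_id _ _ _) (measurable_cst c)).
apply: measurableI; apply: measurable_ler_set => //; apply: measurableT_comp => //.
  exact: measurable_Re.
exact: measurable_Im.
Qed.

Lemma measurable_disc (c : R[i]) (r : R) : measurable [set z : R[i] | normc (z - c) <= r].
Proof.
apply: measurable_ler_set => //; apply: measurable_normc_comp.
exact: (measurable_csub (@measurable_id _ _ _) (measurable_cst c)).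
Qed.

Lemma area_disc_le (c : R[i]) (r : R) : 0 <= r ->
  (area [set z | (normc (z - c) <= r)%R] <= (4 * r ^+ 2)%:E)%E.
Proof.
move=> r0; rewrite (_ : 4 * _ = (2 * r) ^+ 2); last by ring.
rewrite -(area_square c r0); apply: le_measure; rewrite ?inE.
- exact: measurable_disc.
- exact: measurable_square.
by move=> z /= h; split; rewrite (le_trans _ h) ?Re_le_normc ?Im_le_normc.
Qed.

Lemma area_disc_ge (c : R[i]) (r : R) : 0 <= r ->
  ((r ^+ 2)%:E <= area [set z | (normc (z - c) <= r)%R])%E.
Proof.
move=> r0; have r20 : 0 <= r / 2 by lra.
rewrite (_ : r ^+ 2 = (2 * (r / 2)) ^+ 2); last by field.
rewrite -(area_square c r20); apply: le_measure; rewrite ?inE.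
- exact: measurable_square.
- exact: measurable_disc.
by move=> z /= [h1 h2]; rewrite (le_trans (normc_le_ReIm _))//; lra.
Qed.

Section polydisc.
Variable n : nat.

Definition polydisc (m : n.-tuple R[i]) (r : R) : set (n.-tuple R[i]) :=
  [set w | forall i, normc (tnth w i - tnth m i) <= r].

Lemma measurable_polydisc m r : measurable (polydisc m r).
Proof.
rewrite [X in measurable X](_ : _ =
    \bigcap_(i in [set: 'I_n]) [set w | normc (tnth w i - tnth m i) <= r]).
  apply: fin_bigcap_measurable => // i _; apply: measurable_ler_set => //.
  apply: measurable_normc_comp.
  by apply: (measurable_csub _ (measurable_cst _)); exact: measurable_tnth.
by apply/seteqP; split=> [w Aw i _|w Aw i]; exact: Aw.
Qed.

Lemma polydisc_cons (x c : R[i]) (t m : n.-tuple R[i]) r :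
  (forall i, normc (tnth [tuple of x :: t] i - tnth [tuple of c :: m] i) <= r) <->
  normc (x - c) <= r /\ polydisc m r t.
Proof.
split=> [h|[h0 h] i].
  split=> [|i]; first by have := h ord0.
  by have := h (lift ord0 i); rewrite !tnthS.
by case: (unliftP ord0 i) => [j ->|->]; rewrite ?tnthS.
Qed.

End polydisc.

Lemma tuple_consE (T : Type) n (m : n.+1.-tuple T) : exists x (t : n.-tuple T), m = [tuple of x :: t].
Proof. by exists (thead m), [tuple of behead m]; exact: tuple_eta. Qed.

Lemma sum_tnth_cons n (F : 'I_n.+1 -> R[i]) (x : R[i]) (t : n.-tuple R[i]) :
  \sum_(i < n.+1) tnth [tuple of x :: t] i * F i =
  x * F ord0 + \sum_(i < n) tnth t i * F (lift ord0 i).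
Proof.
by rewrite big_ord_recl tnth0; congr (_ + _); apply: eq_bigr => i _; rewrite tnthS.
Qed.

Lemma volume_polydisc_le n (m : n.-tuple R[i]) (r : R) : 0 <= r ->
  (lebesgueC R n (polydisc m r) <= ((4 * r ^+ 2) ^+ n)%:E)%E.
Proof.
move=> r0; elim: n m => [|n IH] m.
  rewrite expr0 /lebesgueC/= diracE; case: (_ \in _) => //=.
have [x [t ->]] := tuple_consE m.
rewrite exprSr EFinM; apply: (@le_trans _ _
    (((4 * r ^+ 2) ^+ n)%:E * area [set z | (normc (z - x) <= r)%R])%E).
  apply: lebesgueC_le_head.
  - exact: measurable_polydisc.
  - exact: measurable_disc.
  - by rewrite lee_fin exprn_ge0// mulr_ge0// sqr_ge0.
  - by move=> y s /polydisc_cons[].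
  move=> y _; apply: le_trans (IH t); apply: le_measure; rewrite ?inE.
  - have -> : [set s : n.-tuple R[i] | polydisc [tuple of x :: t] r [tuple of y :: s]] =
        [set s | normc (y - x) <= r] `&` polydisc t r.
      by apply/seteqP; split => s /polydisc_cons.
    apply: measurableI (measurable_polydisc _ _).
    exact: measurable_cst_set.
  - exact: measurable_polydisc.
  - by move=> s /polydisc_cons[].
apply: lee_pmul => //; first by rewrite lee_fin exprn_ge0// mulr_ge0// sqr_ge0.
exact: area_disc_le.
Qed.

Lemma volume_polydisc_ge n (m : n.-tuple R[i]) (r : R) : 0 <= r ->
  (((r ^+ 2) ^+ n)%:E <= lebesgueC R n (polydisc m r))%E.
Proof.
move=> r0; elim: n m => [|n IH] m.
  rewrite expr0 /lebesgueC/= diracE mem_set// => i; by case: i.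
have [x [t ->]] := tuple_consE m.
rewrite exprS EFinM; apply: (@le_trans _ _
    (area [set z | (normc (z - x) <= r)%R] * lebesgueC R n (polydisc t r))%E).
  apply: lee_pmul => //.
  - by rewrite lee_fin sqr_ge0.
  - by rewrite lee_fin exprn_ge0// sqr_ge0.
  exact: area_disc_ge.
apply: lebesgueC_ge_tail => //.
- exact: measurable_polydisc.
- exact: measurable_polydisc.
move=> s Ds; rewrite le_eqVlt; apply/orP; left; apply/eqP; congr (area _).
by apply/seteqP; split => y /= => [h|/polydisc_cons[]//]; exact/polydisc_cons.
Qed.

Lemma measurable_slab n (m : n.-tuple R[i]) (F : 'I_n -> R[i]) (c : R[i]) (r s : R) :
  measurable (polydisc m r `&` [set w | normc (\sum_(i < n) tnth w i * F i - c) <= s]).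
Proof.
apply: measurableI; first exact: measurable_polydisc.
apply: measurable_ler_set => //; apply: measurable_normc_comp.
apply: (measurable_csub _ (measurable_cst _)); apply: measurable_csum => i.
by apply: measurable_cmul => //; exact: measurable_tnth.
Qed.

(* Only the coordinate j is constrained by the slab, hence the loss of a single
   factor r ^+ 2. *)
Lemma volume_slab_le n (m : n.-tuple R[i]) (F : 'I_n -> R[i]) (c : R[i]) (r s kappa : R) j :
  0 <= r -> 0 <= s -> 0 < kappa -> kappa <= normc (F j) ->
  (lebesgueC R n (polydisc m r `&` [set w | (normc (\sum_(i < n) tnth w i * F i - c) <= s)%R])
    <= ((4 * r ^+ 2) ^+ n.-1 * (4 * (s / kappa) ^+ 2))%:E)%E.
Proof.
move=> r0 s0 k0; elim: n m F c j => [|n IH] m F c j kj; first by case: j kj.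
have [x [t ->]] := tuple_consE m.
have p40 a : 0 <= 4 * a ^+ 2 :> R by rewrite mulr_ge0// sqr_ge0.
(* If j is the first coordinate, the others range over a polydisc and the slab confines the first
   one to a disc; otherwise the first coordinate ranges over a disc and the induction hypothesis
   applies to the others. *)
case: (unliftP ord0 j) kj => [j' ->|->] kj; last first.
  have F0 : F ord0 != 0.
    by apply/eqP => F0; move: kj; rewrite F0 normc0 leNgt k0.
  rewrite mulrC EFinM; apply: (@le_trans _ _
    ((4 * (s / kappa) ^+ 2)%:E * lebesgueC R n (polydisc t r))%E).
    apply: lebesgueC_le_tail.
    - exact: measurable_slab.
    - exact: measurable_polydisc.
    - by rewrite lee_fin.
    - by move=> y u [/polydisc_cons[]].
    move=> u _.
    (* Centre of the disc, obtained by dividing the slab inequality by [F ord0], whose modulus is at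
       least kappa. *)
    pose g := (c - \sum_(i < n) tnth u i * F (lift ord0 i)) / F ord0.
    have sk0 : 0 <= s / kappa by rewrite divr_ge0// ltW.
    apply: le_trans (area_disc_le g sk0).
    have mS : measurable [set w : R[i] | normc (w * F ord0 + (\sum_(i < n) tnth u i * F (lift ord0 i) - c)) <= s].
      apply: measurable_ler_set => //; apply: measurable_normc_comp.
      apply: (measurable_cadd _ (measurable_cst _)).
      by apply: measurable_cmul => //.
    apply: le_measure; rewrite ?inE.
    - have -> : [set y : R[i] | (polydisc [tuple of x :: t] r `&`
          [set w | normc (\sum_(i < n.+1) tnth w i * F i - c) <= s]) [tuple of y :: u]] =
         [set y | normc (y - x) <= r] `&` ([set y | polydisc t r u] `&`
          [set w : R[i] | normc (w * F ord0 + (\sum_(i < n) tnth u i * F (lift ord0 i) - c)) <= s]).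
        apply/seteqP; split => y.
          by move=> [/polydisc_cons[? ?]]; rewrite /mkset sum_tnth_cons -addrA.
        move=> [? [? ?]]; split; first exact/polydisc_cons.
        by rewrite /mkset sum_tnth_cons -addrA.
      apply: measurableI; first exact: measurable_disc.
      apply: measurableI => //.
      exact: measurable_cst_set.
    - exact: measurable_disc.
    - move=> y [_]; rewrite /mkset sum_tnth_cons -addrA => ys; rewrite /g ler_pdivlMr//.
      apply: (le_trans (ler_wpM2l (normc_ge0 _) kj)).
      rewrite -normcM mulrBl divfK//; apply: le_trans ys; rewrite le_eqVlt; apply/orP; left.
      by apply/eqP; congr normc; ring.
  apply: lee_pmul => //; first by rewrite lee_fin.
  exact: volume_polydisc_le.
have n0 : (0 < n)%N by case: j' {kj} => i; exact: leq_trans.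
have -> : (4 * r ^+ 2) ^+ n.+1.-1 * (4 * (s / kappa) ^+ 2) =
   (4 * r ^+ 2) ^+ n.-1 * (4 * (s / kappa) ^+ 2) * (4 * r ^+ 2).
  by rewrite -pred_Sn -[in LHS](prednK n0) exprSr; ring.
rewrite EFinM; apply: (@le_trans _ _
  (((4 * r ^+ 2) ^+ n.-1 * (4 * (s / kappa) ^+ 2))%:E *
    area [set z | (normc (z - x) <= r)%R])%E).
  apply: lebesgueC_le_head.
  - exact: measurable_slab.
  - exact: measurable_disc.
  - by rewrite lee_fin mulr_ge0// exprn_ge0.
  - by move=> y u [/polydisc_cons[]].
  (* Once the first coordinate is fixed at y, its term is moved into the constant of the slab. *)
  move=> y _; apply: le_trans (IH t (fun i => F (lift ord0 i)) (c - y * F ord0) j' kj).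
  have sub : [set u : n.-tuple R[i] | (polydisc [tuple of x :: t] r `&`
          [set w | normc (\sum_(i < n.+1) tnth w i * F i - c) <= s]) [tuple of y :: u]] =
     [set u | normc (y - x) <= r] `&` (polydisc t r `&`
        [set w | normc (\sum_(i < n) tnth w i * F (lift ord0 i) - (c - y * F ord0)) <= s]).
    have e (u : n.-tuple R[i]) : \sum_(i < n.+1) tnth [tuple of y :: u] i * F i - c =
        \sum_(i < n) tnth u i * F (lift ord0 i) - (c - y * F ord0).
      by rewrite sum_tnth_cons; ring.
    apply/seteqP; split => u.
      by move=> [/polydisc_cons[? ?]]; rewrite /mkset e.
    move=> [? [? ?]]; split; first exact/polydisc_cons.
    by rewrite /mkset e.
  rewrite sub; apply: le_measure; rewrite ?inE.
  - apply: measurableI; last exact: measurable_slab.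
    exact: measurable_cst_set.
  - exact: measurable_slab.
  - by move=> u [].
apply: lee_pmul => //; first by rewrite lee_fin mulr_ge0// exprn_ge0.
exact: area_disc_le.
Qed.

End volumes.

(** * Areas of annuli *)

Section shell_volumes.
Variable R : realType.
Local Notation area := (@complex_lebesgue R).

Lemma measurable_sqr_slice (h a b : R) :
  measurable ([set x | h <= `|x| /\ a <= x ^+ 2 <= b] : set (measurableTypeR R)).
Proof.
apply: measurableI; first by apply: measurable_ler_set => //; exact: measurableT_comp.
have mX : measurable_fun setT (fun x : measurableTypeR R => x ^+ 2) by exact: measurable_funX.
rewrite [X in measurable X](_ : _ = [set x : measurableTypeR R | a <= x ^+ 2] `&` [set x : measurableTypeR R | x ^+ 2 <= b]).
  by apply: measurableI; exact: measurable_ler_set.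
by apply/seteqP; split => x /= => [/andP[]|[-> ->]].
Qed.

(** Two points x, c >= h whose squares lie in an interval of length r satisfy 2 h |x - c| <= |x^2 -
    c^2| <= r, so any point of the set serves as centre. *)
Lemma sqr_slice_pos (h a r : R) : 0 < h -> 0 <= r -> exists c,
  [set x | h <= x /\ a <= x ^+ 2 <= a + r] `<=` `[c - r / (2 * h), c + r / (2 * h)]%classic.
Proof.
move=> h0 r0.
have [[c [hc /andP[ac cb]]]|n] := pselect (exists x, h <= x /\ a <= x ^+ 2 <= a + r); last first.
  by exists 0 => x xP; case: n; exists x.
exists c => x [hx /andP[ax xb]] /=; rewrite in_itv/= -ler_distl ler_pdivlMr ?mulr_gt0//.
rewrite (@le_trans _ _ (`|x - c| * (x + c)))//.
  by rewrite ler_wpM2l//; lra.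
rewrite -[X in _ * X]ger0_norm; last by lra.
by rewrite -normrM -subr_sqr ler_norml; apply/andP; split; lra.
Qed.

Lemma lebesgue_sqr_slice (h a r : R) : 0 < h -> 0 <= r ->
  (lebesgue_measure ([set x | (h <= `|x|)%R /\ (a <= x ^+ 2 <= a + r)%R] : set (measurableTypeR R))
    <= (2 * (r / h))%:E)%E.
Proof.
move=> h0 r0; have [c cP] := sqr_slice_pos a h0 r0.
have rh : 0 <= r / (2 * h) by rewrite divr_ge0// mulr_ge0// ltW.
pose I (c : R) : set (measurableTypeR R) := `[c - r / (2 * h), c + r / (2 * h)]%classic.
have mI e : measurable (I e) by exact: measurable_itv.
have lI e : lebesgue_measure (I e) = (r / h)%:E.
  transitivity ((2 * (r / (2 * h)))%:E); first exact: lebesgue_itv_center.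
  by congr _%:E; field; rewrite gt_eqF.
apply: (@le_trans _ _ (lebesgue_measure (I c `|` I (- c)))).
  apply: le_measure; rewrite ?inE//; [exact: measurable_sqr_slice|exact: measurableU|].
  move=> x /= [hx xP]; have [x0|x0] := leP 0 x.
    by left; apply: cP; split => //; rewrite -(ger0_norm x0).
  right; have : (- x) \in `[c - r / (2 * h), c + r / (2 * h)].
    apply: cP; split; last by rewrite sqrrN.
    by rewrite -(ltr0_norm x0).
  by rewrite /I /= !in_itv/= => /andP[? ?]; apply/andP; split; lra.
apply: (le_trans (measureU2 _ (mI _) (mI _))).
have -> : (2 * (r / h))%:E = ((r / h)%:E + (r / h)%:E)%E by rewrite -EFinD; congr _%:E; ring.
by apply: leeD; rewrite le_eqVlt; apply/orP; left; apply/eqP; exact: lI.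
Qed.

Lemma measurable_annulus (b r : R) : measurable [set z : R[i] | b - r <= normc z ^+ 2 <= b].
Proof.
have m : measurable_fun setT (fun z : R[i] => normc z ^+ 2).
  by apply: measurable_funX; exact: measurable_normc.
rewrite [X in measurable X](_ : _ = [set z | b - r <= normc z ^+ 2] `&` [set z | normc z ^+ 2 <= b]).
  by apply: measurableI; exact: measurable_ler_set.
by apply/seteqP; split => x /= => [/andP[]|[-> ->]].
Qed.

(** On the half where |y| <= |x| one has x^2 >= (b - r) / 2 > b / 4, so |x| >= h = sqrt(b) / 2 and
    each horizontal slice has length at most 2 r / h. As |y| <= 2 h, the total is at most 8 r: the
    radius cancels out. The second bound is for the mirror half. *)
Let half_annulus (b r : R) : 0 < r -> 2 * r < b ->
  let A := [set xy : measurableTypeR R * measurableTypeR R |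
    b - r <= xy.1 ^+ 2 + xy.2 ^+ 2 <= b /\ xy.2 ^+ 2 <= xy.1 ^+ 2] in
  [/\ measurable A, (((@lebesgue_measure R \x @lebesgue_measure R)%E A) <= (8 * r)%:E)%E
    & (((@lebesgue_measure R \x @lebesgue_measure R)%E ((fun xy => (xy.2, xy.1)) @^-1` A)) <= (8 * r)%:E)%E].
Proof.
move=> r0 rb A; pose h := Num.sqrt b / 2.
have b0 : 0 < b by lra.
have h0 : 0 < h by rewrite divr_gt0// sqrtr_gt0.
have h2 : (2 * h) ^+ 2 = b.
  by rewrite (_ : 2 * h = Num.sqrt b) ?sqr_sqrtr ?ltW// /h; field.
have mA : measurable A.
  have m1 : measurable_fun setT (fun xy : measurableTypeR R * measurableTypeR R => xy.1 ^+ 2).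
    by apply: measurable_funX; exact: measurable_fst.
  have m2 : measurable_fun setT (fun xy : measurableTypeR R * measurableTypeR R => xy.2 ^+ 2).
    by apply: measurable_funX; exact: measurable_snd.
  have m3 : measurable_fun setT (fun xy : measurableTypeR R * measurableTypeR R => xy.1 ^+ 2 + xy.2 ^+ 2).
    exact: measurable_funD.
  apply: measurableI; last exact: measurable_ler_set.
  rewrite [X in measurable X](_ : _ = [set xy : measurableTypeR R * measurableTypeR R | b - r <= xy.1 ^+ 2 + xy.2 ^+ 2] `&`
     [set xy : measurableTypeR R * measurableTypeR R | xy.1 ^+ 2 + xy.2 ^+ 2 <= b]).
    by apply: measurableI; exact: measurable_ler_set.
  by apply/seteqP; split => x /= => [/andP[]|[-> ->]].
pose I : set (measurableTypeR R) := `[- (2 * h), 2 * h]%classic.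
have mI : measurable I by exact: measurable_itv.
have lI : lebesgue_measure I = (4 * h)%:E.
  have := @lebesgue_itv_center R 0 (2 * h); rewrite sub0r add0r => ->.
    by congr _%:E; ring.
  by rewrite mulr_ge0// ltW.
have rhh : ((2 * (r / h))%:E * (4 * h)%:E <= (8 * r)%:E :> \bar R)%E.
  by rewrite -EFinM lee_fin le_eqVlt; apply/orP; left; apply/eqP; field; rewrite gt_eqF.
have c0 : (0 <= (2 * (r / h))%:E :> \bar R)%E by rewrite lee_fin mulr_ge0// divr_ge0 ?ltW.
have AI x y : A (x, y) -> I y.
  move=> [/= /andP[h1 hb2] h3]; rewrite /I /= in_itv/= -ler_norml.
  rewrite -ler_sqr ?nnegrE ?mulr_ge0 ?(ltW h0)//.
  by rewrite h2 real_normK ?num_real//; have := sqr_ge0 x; lra.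
have slice y : (lebesgue_measure ([set x | A (x, y)] : set (measurableTypeR R)) <= (2 * (r / h))%:E)%E.
  apply: le_trans (lebesgue_sqr_slice (b - r - y ^+ 2) h0 (ltW r0)).
  apply: le_measure; rewrite ?inE.
  - rewrite (_ : [set x | A (x, y)] = ysection A y); first exact: measurable_ysection.
    by apply/seteqP; split => x; rewrite /ysection /= inE.
  - exact: measurable_sqr_slice.
  - move=> x [/= /andP[h1 hb2] h3]; split; last by lra.
    rewrite -ler_sqr ?nnegrE ?(ltW h0)// real_normK ?num_real//.
    have h4 : h ^+ 2 = b / 4 by rewrite -h2; field.
    by rewrite h4; lra.
split => //.
  apply: le_trans rhh; rewrite -lI; apply: product_measure_le2 => // y _.
  apply: le_trans (slice y); rewrite le_eqVlt; apply/orP; left; apply/eqP; congr (lebesgue_measure _).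
  by apply/seteqP; split => x; rewrite /ysection /= inE.
apply: le_trans rhh; rewrite -lI; apply: product_measure_le1 => //.
- by rewrite -[X in measurable X]setTI; apply: measurable_swap.
- by move=> x y; exact: AI.
move=> y _; apply: le_trans (slice y); rewrite le_eqVlt; apply/orP; left; apply/eqP; congr (lebesgue_measure _).
by apply/seteqP; split => x; rewrite /xsection /= inE.
Qed.

(** The bound must not depend on b, which will be the squared radius left over by the other
    coordinates and can be arbitrarily small. When b <= 2 r the disc of radius sqrt(2 r) is already
    small enough. *)
Lemma area_annulus_le (b r : R) : 0 < r ->
  (area [set z | (b - r <= normc z ^+ 2 <= b)%R] <= (16 * r)%:E)%E.
Proof.
move=> r0; have [br|rb] := leP b (2 * r).
  have s0 : 0 <= Num.sqrt (2 * r) by exact: sqrtr_ge0.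
  apply: (@le_trans _ _ (area [set z | (normc (z - 0) <= Num.sqrt (2 * r))%R])).
    apply: le_measure; rewrite ?inE; [exact: measurable_annulus|exact: measurable_disc|].
    move=> z /= /andP[_ zb]; rewrite subr0 -ler_sqr ?nnegrE ?normc_ge0//.
    by rewrite sqr_sqrtr; lra.
  apply: (le_trans (area_disc_le _ s0)).
  by rewrite sqr_sqrtr ?lee_fin; lra.
have [mA A1 A2] := half_annulus r0 rb.
set A := (X in measurable X) in mA A1 A2.
have mA' : measurable ((fun xy => (xy.2, xy.1)) @^-1` A).
  by rewrite -[X in measurable X]setTI; apply: measurable_swap.
rewrite /complex_lebesgue /pushforward.
apply: (@le_trans _ _ ((@lebesgue_measure R \x @lebesgue_measure R)%E
   (A `|` (fun xy => (xy.2, xy.1)) @^-1` A))).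
  apply: le_measure; rewrite ?inE.
  - by rewrite -[X in measurable X]setTI; apply: measurable_pair_complex => //; exact: measurable_annulus.
  - exact: measurableU.
  move=> [x y]; rewrite /pair_complex /A /= sqr_sqrtr ?addr_ge0 ?sqr_ge0// => h.
  by have [xy|xy] := leP (y ^+ 2) (x ^+ 2); [left|right; rewrite [y ^+ 2 + _]addrC; split => //; exact: ltW].
apply: (le_trans (measureU2 _ mA mA')).
rewrite (_ : 16 * r = 8 * r + 8 * r); last by ring.
by rewrite EFinD; apply: leeD.
Qed.

End shell_volumes.

Section ball_volumes.
Variables (R : realType) (d : nat).
Local Notation Cd := (d.-tuple R[i]).
Local Notation v := (ball_measure R d).
Implicit Types z w : Cd.

Lemma measurable_tnthC j : measurable_fun setT (fun z : Cd => tnth z j).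
Proof. exact: measurable_tnth. Qed.

Lemma measurable_bdist : measurable_fun setT (@bdist R d).
Proof.
apply: measurable_funB => //; apply: measurable_sum => j; apply: measurable_funX.
by apply: measurable_normc_comp; exact: measurable_tnth.
Qed.

Lemma measurable_hdot : measurable_fun setT (fun zw : Cd * Cd => hdot zw.1 zw.2).
Proof.
apply: measurable_csum => j; apply: measurable_cmul; last apply: measurable_conj.
  by apply: (measurableT_comp (@measurable_tnthC j)); exact: measurable_fst.
by apply: (measurableT_comp (@measurable_tnthC j)); exact: measurable_snd.
Qed.

Lemma measurable_1hdot : measurable_fun setT (fun zw : Cd * Cd => 1 - hdot zw.1 zw.2).
Proof. exact: measurable_csub (measurable_cst _) measurable_hdot. Qed.

Lemma ball_measure_bound (A : set Cd) (c : R) :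
  (lebesgueC R d (A `&` unit_ball) <= c%:E)%E ->
  (v A <= (c / fine (lebesgueC R d unit_ball))%:E)%E.
Proof.
move=> Ac; rewrite ball_measureE EFinM lee_wpmul2r// lee_fin invr_ge0 fine_ge0//.
Qed.

Lemma ball_measure_setIB (A : set Cd) : v A = v (A `&` unit_ball).
Proof. by rewrite !ball_measureE -setIA setIid. Qed.

End ball_volumes.

(** * Volumes of shells and of sublevel sets of the kernel *)

Section kernel_volumes.
Variables (R : realType) (d : nat).
Local Notation Cd := (d.-tuple R[i]).
Local Notation v := (ball_measure R d).

(** With the last n coordinates fixed, the first one ranges over an annulus whose squared radii
    differ by r; the last n coordinates stay in the unit polydisc. *)
Lemma volume_shell_le : (0 < d)%N -> exists2 C : R, 0 < C & forall r : R, 0 < r ->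
  (v [set w : Cd | (bdist w <= r)%R] <= (C * r)%:E)%E.
Proof.
case: d => [//|n] _; have /andP[v0 voo] := lebesgueC_unit_ball R n.+1.
have V0 : 0 < fine (lebesgueC R n.+1 unit_ball) by rewrite fine_gt0// v0 voo.
exists (16 * 4 ^+ n / fine (lebesgueC R n.+1 unit_ball)).
  by rewrite divr_gt0// mulr_gt0// exprn_gt0.
move=> r r0.
rewrite mulrAC; apply: ball_measure_bound.
pose o : n.-tuple R[i] := [tuple 0 | _ < n].
have m0 : measurable (polydisc o 1) by exact: measurable_polydisc.
rewrite (_ : 16 * 4 ^+ n * r = (16 * r) * 4 ^+ n); last by ring.
rewrite EFinM; apply: (@le_trans _ _ ((16 * r)%:E * lebesgueC R n (polydisc o 1))%E).
  apply: lebesgueC_le_tail => //.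
  - apply: measurableI; last exact: measurable_unit_ball.
    by apply: measurable_ler_set => //; exact: measurable_bdist.
  - by rewrite lee_fin mulr_ge0// ltW.
  - move=> x t [_ Bt] i; rewrite tnth_mktuple subr0.
    by have := coord_le1 (lift ord0 i) Bt; rewrite tnthS.
  move=> t _; apply: le_trans (area_annulus_le (1 - \sum_(j < n) normc (tnth t j) ^+ 2) r0).
  have E : [set x | ([set w : n.+1.-tuple R[i] | bdist w <= r] `&` unit_ball) [tuple of x :: t]] `<=`
    [set z | 1 - \sum_(j < n) normc (tnth t j) ^+ 2 - r <= normc z ^+ 2 <= 1 - \sum_(j < n) normc (tnth t j) ^+ 2].
    have bE (x : R[i]) : bdist [tuple of x :: t] =
        1 - (normc x ^+ 2 + \sum_(j < n) normc (tnth t j) ^+ 2).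
      rewrite /bdist big_ord_recl tnth0; congr (_ - (_ + _)).
      by apply: eq_bigr => j _; rewrite tnthS.
    move=> x [+ /unit_ballP]; rewrite /mkset bE => h1 h2.
    by apply/andP; split; lra.
  apply: le_measure => //; rewrite ?inE; last exact: measurable_annulus.
  have mc : measurable_fun setT (fun x : R[i] => [tuple of x :: t]).
    exact: (measurable_cons (@measurable_id _ _ _) (measurable_cst t)).
  rewrite -[X in measurable X]setTI; apply: mc => //.
  apply: measurableI; last exact: measurable_unit_ball.
  by apply: measurable_ler_set => //; exact: measurable_bdist.
apply: lee_pmul => //; first by rewrite lee_fin mulr_ge0// ltW.
by apply: le_trans (volume_polydisc_le _ ler01) _; rewrite expr1n mulr1.
Qed.

(** If |1 - <z,w>| <= r, then [Re_1hdot] gives |z - w|^2 <= 2 r, and <w,z> lies within r of 1, which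
    is a slab. The polydisc of radius sqrt(2 r) would give r^d only; the slab turns one factor r
    into r^2. *)
Lemma volume_kernel_le : (0 < d)%N -> exists2 C : R, 0 < C & forall (z : Cd) (r : R),
  unit_ball z -> 0 < r ->
  (v [set w : Cd | (normc (1 - hdot z w) <= r)%R] <= (C * r ^+ d.+1)%:E)%E.
Proof.
move=> d0; have /andP[v0 voo] := lebesgueC_unit_ball R d.
set V := fine (lebesgueC R d unit_ball).
have V0 : 0 < V by rewrite fine_gt0// v0 voo.
pose C1 : R := 8 ^+ d.-1 * (4 * (2 * d%:R) ^+ 2).
have dR : 0 < d%:R :> R by rewrite ltr0n.
have C10 : 0 < C1 by rewrite mulr_gt0 ?exprn_gt0 ?mulr_gt0 ?exprn_gt0 ?mulr_gt0.
exists (4 ^+ d.+1 + C1 / V).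
  by rewrite addr_gt0 ?exprn_gt0// divr_gt0.
move=> z r Bz r0.
have mA : measurable [set w : Cd | normc (1 - hdot z w) <= r].
  apply: measurable_ler_set => //; apply: measurable_normc_comp.
  apply: (measurable_csub (measurable_cst _)).
  apply: measurable_csum => i; apply: measurable_cmul => //.
  by apply: measurable_conj; exact: measurable_tnth.
(* For r >= 1/4 the total mass 1 is at most (4 r)^(d + 1). *)
have [r4|r4] := leP (1 / 4) r.
  apply: (@le_trans _ _ 1%E); first exact: probability_le1.
  rewrite lee_fin mulrDl -exprMn; have : 1 <= (4 * r) ^+ d.+1 by apply: exprn_ege1; lra.
  have : 0 <= C1 / V * r ^+ d.+1 by rewrite mulr_ge0 ?exprn_ge0 ?divr_ge0// ltW.
  lra.
apply: (@le_trans _ _ ((C1 * r ^+ d.+1) / V)%:E); last first.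
  rewrite lee_fin mulrDl [C1 * _ / V]mulrAC lerDr mulr_ge0 ?exprn_ge0// ltW//.
apply: ball_measure_bound.
(* The slab needs a coordinate of z bounded below. If all are below 1 / (2 d), then |z|^2 <= 1/2, so
   |1 - <z,w>| > 1/4 > r on the ball and the set is empty. *)
have [[j zj]|n] := pselect (exists j, (2 * d%:R)^-1 <= normc (tnth z j)); last first.
  suff -> : [set w : Cd | normc (1 - hdot z w) <= r] `&` unit_ball = set0.
    by rewrite measure0 lee_fin mulr_ge0 ?exprn_ge0// ltW.
  rewrite -subset0 => w [/= wr /unit_ballP w0].
  have := normc_1hdot_ge z w.
  have : \sum_(j < d) normc (tnth z j) ^+ 2 <= 2^-1; last first.
    move=> h; have : 2^-1 <= bdist z by rewrite /bdist; lra.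
    by move: wr w0 r4; lra.
  apply: (@le_trans _ _ (\sum_(j < d) (2 * d%:R)^-1)); last first.
    rewrite sumr_const card_ord -[X in X <= _]mulr_natl (_ : _ * _ = 2^-1)//.
    by field; rewrite gt_eqF.
  apply: ler_sum => j _; apply: (@le_trans _ _ (normc (tnth z j))).
    by rewrite expr2 ler_piMr ?normc_ge0//; exact: coord_le1.
  by rewrite leNgt; apply/negP => /ltW zj; apply: n; exists j.
have s0 : 0 <= Num.sqrt (2 * r) by exact: sqrtr_ge0.
have k0 : 0 < (2 * d%:R)^-1 :> R by rewrite invr_gt0 mulr_gt0.
have kj : (2 * d%:R)^-1 <= normc ((tnth z j)^*)%C by rewrite normc_conj.
apply: (@le_trans _ _ (lebesgueC R d (polydisc z (Num.sqrt (2 * r)) `&`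
    [set w | (normc (\sum_(i < d) tnth w i * ((tnth z i)^*)%C - 1) <= r)%R]))); last first.
  apply: (le_trans (@volume_slab_le R d z (fun i => ((tnth z i)^*)%C) 1 _ _ _ j s0 (ltW r0) k0 kj)).
  rewrite sqr_sqrtr; last by lra.
  rewrite lee_fin invrK le_eqVlt; apply/orP; left; apply/eqP.
  rewrite (_ : 4 * (2 * r) = 8 * r); last by ring.
  rewrite /C1 exprMn; have -> : r ^+ d.+1 = r ^+ d.-1 * r ^+ 2.
    by rewrite -exprD addn2 prednK.
  by ring.
apply: le_measure; rewrite ?inE.
- by apply: measurableI; [exact: mA|exact: measurable_unit_ball].
- exact: measurable_slab.
move=> w [/= wr Bw]; split; last first.
  by rewrite /mkset -/(hdot w z) normcB normc_1hdotC.
move=> i; rewrite -ler_sqr ?nnegrE ?normc_ge0// sqr_sqrtr; last by lra.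
rewrite normcB; have := Re_1hdot z w.
have : normc (tnth z i - tnth w i) ^+ 2 <= \sum_(j < d) normc (tnth z j - tnth w j) ^+ 2.
  by rewrite [leRHS](bigD1 i)//= lerDl sumr_ge0// => k _; rewrite sqr_ge0.
have := Re_le_normc (1 - hdot z w); have := ler_norm (complex.Re (1 - hdot z w)).
have /unit_ballP := Bw; have /unit_ballP := Bz; lra.
Qed.

End kernel_volumes.

(** * Integrals of negative powers *)

Section layer_cake.
Context dd (T : measurableType dd) (R : realType) (mu : {measure set T -> \bar R}).

Lemma powR_exp (a x : R) n : 0 <= a -> (a ^+ n) `^ x = (a `^ x) ^+ n.
Proof. by move=> a0; rewrite -(powR_mulrn n a0) -(powR_mulrn n (powR_ge0 a x)) powRAC. Qed.

Lemma dyadic_bracket (x : R) : 0 < x < 1 -> exists k, 2^-1 ^+ k.+1 < x <= 2^-1 ^+ k.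
Proof.
move=> /andP[x0 x1].
have ex : exists n, 2^-1 ^+ n < x.
  have : (2^-1 : R) ^+ n @[n --> \oo] --> 0 by apply: cvg_expr; rewrite ger0_norm; lra.
  move=> /cvgrPdist_lt /(_ _ x0)[N _ /(_ N (leqnn N))] /=.
  by rewrite sub0r normrN ger0_norm ?exprn_ge0// => ?; exists N.
case: (ex_minnP ex) => -[|k] kx kmin; first by move: kx; rewrite expr0; lra.
exists k; rewrite kx /= leNgt; apply/negP => /kmin; rewrite ltnn //.
Qed.

(** On the dyadic layer 2^-(k+1) < phi <= 2^-k the integrand is at most A^(k+1) with A = 2^b, and
    the layer has mass at most C M^k with M = 2^-m. The series is geometric of ratio A M = 2^(b - m)
    < 1, and the term 1 accounts for phi >= 1. The constant K does not depend on D or phi, hence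
    later not on the point z. *)
Lemma layer_cake (C b m : R) : 0 <= C -> 0 < b < m -> exists2 K : R, 0 < K &
  forall (D : set T) (phi : T -> R), measurable D -> measurable_fun setT phi ->
  (forall x, D x -> 0 < phi x) -> (mu D <= 1)%E ->
  (forall r : R, 0 < r -> (mu (D `&` [set x | (phi x <= r)%R]) <= (C * r `^ m)%:E)%E) ->
  (\int[mu]_(x in D) (phi x `^ (- b))%:E <= K%:E)%E.
Proof.
move=> C0 /andP[b0 bm]; pose a : R := 2^-1; pose A := a `^ (- b); pose M := a `^ m.
have a0 : 0 < a by rewrite /a; lra.
have A0 : 0 < A by exact: powR_gt0.
have M0 : 0 < M by exact: powR_gt0.
have AM1 : A * M < 1.
  rewrite /A /M -powRD; last by apply/implyP => _; rewrite gt_eqF.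
  rewrite addrC /powR gt_eqF// expR_lt1 nmulr_llt0; first by rewrite subr_gt0.
  by rewrite ln_lt0// /a; lra.
have AM0 : 0 < A * M by exact: mulr_gt0.
exists (1 + C * A / (1 - A * M)).
  by rewrite ltr_pwDl// divr_ge0 ?mulr_ge0 ?(ltW A0)// subr_ge0 ltW.
move=> D phi mD mphi phi0 D1 Dr.
pose E k := D `&` [set x | phi x <= a ^+ k].
have mE k : measurable (E k) by apply: measurableI => //; exact: measurable_ler_set.
pose f k x : \bar R := (A ^+ k.+1 * \1_(E k) x)%:E.
have f0 k x : (0 <= f k x)%E.
  by rewrite lee_fin mulr_ge0// exprn_ge0// ltW.
have mf k : measurable_fun setT (f k).
  apply/measurable_EFinP; apply: measurable_funM => //; exact: measurable_indic.
have intf k : (\int[mu]_(x in D) f k x <= (geometric (C * A) (A * M) k)%:E)%E.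
  rewrite /f; under eq_integral do rewrite EFinM.
  rewrite ge0_integralZl//; last 2 first.
  - apply: measurable_funTS; apply/measurable_EFinP; exact: measurable_indic.
  - by rewrite lee_fin exprn_ge0// ltW.
  rewrite integral_indic// (_ : E k `&` D = E k); last first.
    by apply/seteqP; split => x [] // [].
  rewrite /geometric /=; apply: (@le_trans _ _ ((A ^+ k.+1)%:E * (C * (a ^+ k) `^ m)%:E)%E).
    by apply: lee_wpmul2l; [rewrite lee_fin exprn_ge0// ltW|apply: Dr; exact: exprn_gt0].
  rewrite -EFinM lee_fin powR_exp ?(ltW a0)// -/M exprS exprMn le_eqVlt; apply/orP; left.
  by apply/eqP; ring.
have ptw x : D x -> ((phi x `^ (- b))%:E <= 1 + \sum_(k <oo) f k x)%E.
  move=> Dx; have px := phi0 _ Dx.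
  have s0 : (0 <= \sum_(k <oo) f k x)%E by exact: nneseries_ge0.
  have [x1|x1] := leP 1 (phi x).
    apply: (@le_trans _ _ 1%E); last by rewrite leeDl.
    by rewrite lee_fin powRN invf_le1 ?powR_gt0// -(powRr0 (phi x)) ler_powR// ltW.
  have [|k /andP[k1 k2]] := @dyadic_bracket (phi x); first by rewrite px.
  apply: (@le_trans _ _ (f k x)); last first.
    apply: (@le_trans _ _ (\sum_(k <oo) f k x)%E); last by rewrite leeDr// lee01.
    apply: le_trans (@nneseries_lim_ge R (f ^~ x) predT 0 k.+1 _) => //.
    by rewrite big_nat_recr//= leeDr// sume_ge0.
  have Ekx : E k x by split.
  rewrite /f indicE mem_set// mulr1 lee_fin /A -powR_exp ?(ltW a0)// !powRN.
  by rewrite lef_pV2 ?posrE ?powR_gt0 ?exprn_gt0// ge0_ler_powR ?nnegrE ?exprn_ge0 ?ltW.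
apply: (@le_trans _ _ (\int[mu]_(x in D) (1 + \sum_(k <oo) f k x)))%E.
  apply: ge0_le_integral => //.
  - by move=> x _; rewrite lee_fin powR_ge0.
  - apply: measurable_funTS; apply/measurable_EFinP.
    by apply: (measurableT_comp (measurable_powR _)).
  - apply: measurable_funTS; apply: emeasurable_funD => //.
    by apply: ge0_emeasurable_sum.
rewrite ge0_integralD//; last 2 first.
- by move=> x _; exact: nneseries_ge0.
- by apply: measurable_funTS; apply: ge0_emeasurable_sum.
rewrite integral_cst// mul1e EFinD; apply: leeD => //.
rewrite integral_nneseries//; last by move=> k; apply: measurable_funTS.
apply: (@le_trans _ _ (\sum_(k <oo) (geometric (C * A) (A * M) k)%:E)%E).
  apply: lee_nneseries => // k _ _; exact: integral_ge0.
have cg : series (geometric (C * A) (A * M)) @ \oo --> C * A / (1 - A * M).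
  by apply: cvg_geometric_series; rewrite ger0_norm// ltW.
rewrite -(cvg_lim _ cg)// -EFin_lim//; last by apply/cvg_ex; eexists; exact: cg.
rewrite le_eqVlt; apply/orP; left; apply/eqP; congr (limn _); apply/funext => n.
by rewrite /= /series /= sumEFin.
Qed.

End layer_cake.

(** * Norms in complex L^p spaces *)

Section complex_Lnorm.
Context dd (T : measurableType dd) (R : realType).

Lemma cLnormE (mu : {measure set T -> \bar R}) (p : R) (f : T -> R[i]) :
  cLnorm mu p%:E f = ((\int[mu]_x (normc (f x) `^ p)%:E) `^ p^-1)%E.
Proof.
rewrite /cLnorm unlock; congr (_ `^ _)%E; apply: eq_integral => x _.
by rewrite /= ger0_norm ?normc_ge0.
Qed.

Lemma measurable_normc_powR (p : R) (f : T -> R[i]) : measurable_fun setT f ->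
  measurable_fun setT (fun x => (normc (f x) `^ p)%:E).
Proof.
move=> mf; apply/measurable_EFinP.
by apply: (measurableT_comp (measurable_powR _)); exact: measurable_normc_comp.
Qed.

Lemma poweR_ge0_le (x y : \bar R) (r : R) : 0 <= r -> (0 <= x)%E -> (x <= y)%E ->
  (x `^ r <= y `^ r)%E.
Proof.
move=> r0 x0 xy; apply: gt0_ler_poweR => //; rewrite in_itv/= leey andbT//.
exact: le_trans xy.
Qed.

Lemma cLnorm_leP (mu : {measure set T -> \bar R}) (p M : R) (f : T -> R[i]) : 0 < p -> 0 <= M ->
  (cLnorm mu p%:E f <= M%:E)%E <-> (\int[mu]_x (normc (f x) `^ p)%:E <= (M `^ p)%:E)%E.
Proof.
move=> p0 M0; rewrite cLnormE.
have I0 : (0 <= \int[mu]_x (normc (f x) `^ p)%:E)%E.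
  by apply: integral_ge0 => x _; rewrite lee_fin powR_ge0.
split=> h.
  have := poweR_ge0_le (ltW p0) (poweR_ge0 _ _) h.
  by rewrite -poweRrM mulVf ?gt_eqF// poweRe1// poweR_EFin.
have pV0 : 0 <= p^-1 by rewrite invr_ge0 ltW.
have := poweR_ge0_le pV0 I0 h.
by rewrite poweR_EFin -powRrM mulfV ?gt_eqF// powRr1.
Qed.

Lemma cLnorm_lty (mu : {measure set T -> \bar R}) (p : R) (f : T -> R[i]) : 0 < p ->
  (cLnorm mu p%:E f < +oo)%E -> exists2 M : R, 0 <= M & cLnorm mu p%:E f = M%:E.
Proof.
move=> p0; rewrite /cLnorm; have := Lnorm_ge0 mu p%:E (fun x => (normc (f x))%:E).
by case: Lnorm => // M M0 _; exists M.
Qed.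

Lemma cLnorm_ge0 (mu : {measure set T -> \bar R}) (p : \bar R) (f : T -> R[i]) :
  (0 <= cLnorm mu p f)%E.
Proof. exact: Lnorm_ge0. Qed.

Lemma cLnormZ (mu : {measure set T -> \bar R}) (p : \bar R) (c : R) (f : T -> R[i]) :
  (1 <= p)%E -> measurable_fun setT f -> 0 < c ->
  cLnorm mu p (fun x => (c%:C)%C * f x) = (c%:E * cLnorm mu p f)%E.
Proof.
move=> p1 mf c0; have e x : normc ((c%:C)%C * f x) = c * normc (f x).
  by rewrite normcM normc_real gtr0_norm.
case: p p1 => [p| |//] p1.
  rewrite !cLnormE; under eq_integral do rewrite e powRM ?normc_ge0 ?(ltW c0)// EFinM.
  have p0 : 0 < p by rewrite (lt_le_trans ltr01).
  rewrite ge0_integralZl//; last 3 first.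
  - exact: measurable_normc_powR.
  - by move=> x _; rewrite lee_fin powR_ge0.
  - by rewrite lee_fin powR_ge0.
  rewrite poweRM//; last 2 first.
  - by rewrite lee_fin powR_ge0.
  - by apply: integral_ge0 => x _; rewrite lee_fin powR_ge0.
  by rewrite poweR_EFin -powRrM mulfV ?gt_eqF// powRr1// ltW.
rewrite /cLnorm unlock /Lnorm; case: ifPn => _; last by rewrite mule0.
rewrite -ess_sup_pZl//; congr ess_sup; apply/funext => x /=.
by rewrite e normrM gtr0_norm// EFinM.
Qed.

Lemma ae_le_cLnorm_oo (mu : probability T R) (f : T -> R[i]) (M : R) :
  cLnorm mu +oo%E f = M%:E -> {ae mu, forall x, normc (f x) <= M}.
Proof.
have m0 : (0 < mu setT)%E by rewrite probability_setT.
rewrite /cLnorm unlock /Lnorm m0 => h.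
have /ess_supP : (ess_sup mu (abse \o (fun x => (normc (f x))%:E)) <= M%:E)%E by rewrite h.
apply: filterS => x /=; rewrite lee_fin; exact: le_trans (ler_norm _).
Qed.

Lemma cLnorm_oo_le (mu : probability T R) (f : T -> R[i]) (M : R) :
  (forall x, normc (f x) <= M) -> (cLnorm mu +oo%E f <= M%:E)%E.
Proof.
move=> fM; have m0 : (0 < mu setT)%E by rewrite probability_setT.
rewrite /cLnorm unlock /Lnorm m0.
by apply/ess_supP; apply: nearW => x /=; rewrite lee_fin ger0_norm ?normc_ge0.
Qed.

(** Hölder's inequality with exponent q/p against the constant 1, whose norms are 1 because [mu] has
    total mass 1; for q infinite, integration of the essential bound. *)
Lemma cLnorm_le_exponent (mu : probability T R) (p q : \bar R) (f : T -> R[i]) :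
  (1 <= p)%E -> (p <= q)%E -> measurable_fun setT f ->
  (cLnorm mu p f <= cLnorm mu q f)%E.
Proof.
case: p => [p| |//]; last by case: q => // _ _ _.
rewrite lee_fin => p1 pq mf; have p0 : 0 < p by rewrite (lt_le_trans ltr01).
have [->|noo] := eqVneq (cLnorm mu q f) +oo%E; first by rewrite leey.
have := cLnorm_ge0 mu q f.
case NM: (cLnorm mu q f) noo => [M| |]// _ M0.
apply/cLnorm_leP => //.
case: q pq NM => [q| |//].
  rewrite lee_fin le_eqVlt => /predU1P[<-|pq] NM.
    by apply/cLnorm_leP => //; rewrite NM.
  have q0 : 0 < q by exact: lt_trans pq.
  have hq : (\int[mu]_x (normc (f x) `^ q)%:E <= (M `^ q)%:E)%E.
    by apply/cLnorm_leP => //; rewrite NM.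
  pose r := q / p; pose r' := (1 - r^-1)^-1.
  have r0 : 0 < r by rewrite divr_gt0.
  have r1 : r^-1 < 1 by rewrite /r invf_div ltr_pdivrMr// mul1r.
  have r'0 : 0 < r' by rewrite invr_gt0 subr_gt0.
  have rr' : r^-1 + r'^-1 = 1 by rewrite /r' invrK; ring.
  have mfp : measurable_fun setT (fun x => normc (f x) `^ p).
    by apply/measurable_EFinP; exact: measurable_normc_powR.
  have := hoelder mu mfp (measurable_cst (1 : R)) r0 r'0 rr'.
  rewrite Lnorm1 (_ : (EFin \o cst 1) = cst 1%E)// Lnorm_cst1.
  rewrite [X in poweR X _](_ : _ = 1%E); last exact: probability_setT.
  rewrite poweR1r mule1 => h.
  rewrite (_ : \int[mu]_x (normc (f x) `^ p)%:E = \int[mu]_x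
      `|(EFin \o ((fun x0 : T => normc (f x0) `^ p) \* cst 1)%R) x|)%E; last first.
    by apply: eq_integral => x _; rewrite /= mulr1 ger0_norm ?powR_ge0.
  apply: (le_trans h); rewrite unlock /Lnorm.
  under eq_integral.
    move=> x _; rewrite /= ger0_norm ?powR_ge0// -powRrM /r mulrC divfK ?gt_eqF//.
    over.
  have rV0 : 0 <= r^-1 by rewrite invr_ge0 ltW.
  apply: (le_trans (poweR_ge0_le rV0 _ hq)).
    by apply: integral_ge0 => x _; rewrite lee_fin powR_ge0.
  by rewrite poweR_EFin -powRrM /r invf_div mulrC divfK ?gt_eqF.
move=> _ /ae_le_cLnorm_oo fM.
apply: (@le_trans _ _ (\int[mu]_x (M `^ p)%:E)%E).
  apply: ae_ge0_le_integral => //.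
  - by move=> x _; rewrite lee_fin powR_ge0.
  - exact: measurable_normc_powR.
  - by move=> x _; rewrite lee_fin powR_ge0.
  - apply: filterS fM => x fxM _.
    by rewrite lee_fin ge0_ler_powR ?nnegrE ?normc_ge0// ltW.
rewrite integral_cst// [X in (_ * X)%E](_ : _ = 1%E) ?mule1//.
exact: probability_setT.
Qed.

Lemma bounded_op_exponent (mu : probability T R) (p p' q q' : \bar R)
    (S : (T -> R[i]) -> (T -> R[i])) :
  (1 <= p)%E -> (p <= p')%E -> (1 <= q')%E -> (q' <= q)%E ->
  bounded_op mu p q S -> bounded_op mu p' q' S.
Proof.
move=> p1 pp' q1 qq' [C bC]; exists `|C| => f [mf fp'].
have lp := cLnorm_le_exponent mu p1 pp' mf.
have fp : cLfun mu p f by split => //; exact: le_lt_trans fp'.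
have [[mS Sq] SC] := bC _ fp.
have lq := cLnorm_le_exponent mu q1 qq' mS.
split; first by split => //; exact: le_lt_trans Sq.
apply: (le_trans lq); apply: (le_trans SC).
apply: (@le_trans _ _ (`|C|%:E * cLnorm mu p f)%E).
  by apply: lee_wpmul2r; [exact: cLnorm_ge0|rewrite lee_fin ler_norm].
by apply: lee_wpmul2l.
Qed.

End complex_Lnorm.

(** * Integral operators on the ball *)

Section kernel_operator.
Variables (R : realType) (d : nat).
Hypothesis d0 : (0 < d)%N.
Local Notation Cd := (d.-tuple R[i]).
Local Notation v := (ball_measure R d).
Local Notation B := (@unit_ball R d).
Implicit Types (z w : Cd) (f : Cd -> R[i]) (g : Cd -> R).

(** The two indicators make the kernel symmetric and Borel on the whole product, so that Tonelli's
    theorem applies without restricted domains. *)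
Definition ball_kernel (b : R) (zw : Cd * Cd) : R :=
  \1_B zw.1 * \1_B zw.2 * normc (1 - hdot zw.1 zw.2) `^ (- b).

Lemma ball_kernel_ge0 b zw : 0 <= ball_kernel b zw.
Proof. by rewrite !mulr_ge0// powR_ge0. Qed.

Lemma ball_kernelC b z w : ball_kernel b (z, w) = ball_kernel b (w, z).
Proof. by rewrite /ball_kernel /= [\1_B z * _]mulrC normc_1hdotC. Qed.

Lemma measurable_ball_kernel b : measurable_fun setT (ball_kernel b).
Proof.
have mB := @measurable_unit_ball R d.
apply: measurable_funM; first apply: measurable_funM.
- by apply: measurableT_comp; [exact: measurable_indic|exact: measurable_fst].
- by apply: measurableT_comp; [exact: measurable_indic|exact: measurable_snd].
apply: (measurableT_comp (measurable_powR _)).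
by apply: measurable_normc_comp; exact: measurable_1hdot.
Qed.

Lemma measurable_ball_kernel_l b z : measurable_fun setT (fun w => ball_kernel b (z, w)).
Proof.
by apply: (measurableT_comp (measurable_ball_kernel b)); exact: measurable_pair1.
Qed.

Lemma ball_kernel_in b z w : B z -> B w -> ball_kernel b (z, w) = normc (1 - hdot z w) `^ (- b).
Proof. by move=> Bz Bw; rewrite /ball_kernel !indicE !mem_set// !mul1r. Qed.

(** The volume bound r^(d + 1) of [volume_kernel_le] makes every exponent b < d + 1 integrable,
    uniformly in z, as Schur's test requires. *)
Lemma ball_kernel_integral_le b : 0 < b < d.+1%:R ->
  exists2 A : R, 0 < A & forall z, (\int[v]_w (ball_kernel b (z, w))%:E <= A%:E)%E.
Proof.
move=> b0; have [C C0 hC] := @volume_kernel_le R d d0.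
have [K K0 hK] := @layer_cake _ _ R v C b d.+1%:R (ltW C0) b0.
exists K => // z; have mB := @measurable_unit_ball R d.
have [Bz|nBz] := pselect (B z); last first.
  under eq_integral do rewrite /ball_kernel /= indicE memNset// !mul0r.
  by rewrite integral0 lee_fin ltW.
rewrite [leLHS](_ : _ = \int[v]_(w in B) (normc (1 - hdot z w) `^ (- b))%:E)%E; last first.
  rewrite [RHS]integral_mkcond; apply: eq_integral => w _; rewrite patchE.
  rewrite /ball_kernel/= indicE mem_set// mul1r; case: ifPn => [|/negP] Bw.
    by rewrite indicE Bw mul1r.
  by rewrite indicE (negbTE (introN idP Bw)) mul0r.
apply: hK => //.
- apply: measurable_normc_comp; apply: (measurableT_comp (@measurable_1hdot R d) (measurable_pair1 z)).
- by move=> w Bw; exact: normc_1hdot_gt0.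
- exact: probability_le1.
- move=> r r0; rewrite powR_mulrn ?(ltW r0)//; apply: le_trans (hC z r Bz r0).
  by rewrite setIC le_eqVlt; apply/orP; left; apply/eqP; exact/esym/ball_measure_setIB.
Qed.

Lemma bdist_integral_le b : 0 < b < 1 ->
  exists2 K : R, 0 < K & (\int[v]_(w in B) (bdist w `^ (- b))%:E <= K%:E)%E.
Proof.
move=> b0; have [C C0 hC] := @volume_shell_le R d d0.
have [K K0 hK] := @layer_cake _ _ R v C b 1 (ltW C0) b0.
have mB := @measurable_unit_ball R d.
exists K => //; apply: hK => //.
- exact: measurable_bdist.
- by move=> w /unit_ballP.
- exact: probability_le1.
- move=> r r0; rewrite powRr1 ?(ltW r0)//; apply: le_trans (hC r r0).
  by rewrite setIC le_eqVlt; apply/orP; left; apply/eqP; exact/esym/ball_measure_setIB.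
Qed.

Definition ball_kernel_op b g z : \bar R := (\int[v]_w (g w * ball_kernel b (z, w))%:E)%E.

Lemma measurable_ball_kernel_op_arg b g : measurable_fun setT g ->
  measurable_fun setT (fun zw : Cd * Cd => (g zw.2 * ball_kernel b zw)%:E).
Proof.
move=> mg; apply/measurable_EFinP; apply: measurable_funM (measurable_ball_kernel b).
by apply: (measurableT_comp mg); exact: measurable_snd.
Qed.

Lemma measurable_ball_kernel_op b g : measurable_fun setT g -> (forall w, 0 <= g w) ->
  measurable_fun setT (ball_kernel_op b g).
Proof.
move=> mg g0.
apply: (measurable_fun_fubini_tonelli_F (m2 := v) _ (measurable_ball_kernel_op_arg b mg)) => zw.
by rewrite lee_fin mulr_ge0// ball_kernel_ge0.
Qed.

Lemma ball_kernel_op_ge0 b g z : (forall w, 0 <= g w) -> (0 <= ball_kernel_op b g z)%E.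
Proof. by move=> g0; apply: integral_ge0 => w _; rewrite lee_fin mulr_ge0// ball_kernel_ge0. Qed.

(** First half of Schur's test. With k the kernel, g k is factored as (g k^(1/p)) k^(1/p') and
    Hölder's inequality is raised to the power p; the exponent of A is p/p' = p - 1. *)
Lemma ball_kernel_op_holder b g (p A : R) z : 1 < p -> 0 < A -> measurable_fun setT g -> (forall w, 0 <= g w) ->
  (\int[v]_w (ball_kernel b (z, w))%:E <= A%:E)%E ->
  (ball_kernel_op b g z `^ p <= (A `^ (p - 1))%:E * ball_kernel_op b (fun w => (g w `^ p)%R) z)%E.
Proof.
move=> p1 A0 mg g0 hA; have p0 : 0 < p by lra.
pose p' := (1 - p^-1)^-1.
have pi1 : p^-1 < 1 by rewrite invf_lt1.
have p'0 : 0 < p' by rewrite invr_gt0 subr_gt0.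
have pp' : p^-1 + p'^-1 = 1 by rewrite /p' invrK; ring.
have mk := measurable_ball_kernel_l b z.
pose F w := g w * ball_kernel b (z, w) `^ p^-1.
pose G w := ball_kernel b (z, w) `^ p'^-1.
have mG : measurable_fun setT G by apply: (measurableT_comp (measurable_powR _)).
have mF : measurable_fun setT F.
  by apply: measurable_funM => //; apply: (measurableT_comp (measurable_powR _)).
have := hoelder v mF mG p0 p'0 pp'; rewrite Lnorm1.
rewrite (_ : \int[v]_x `|(EFin \o (F \* G)%R) x| = ball_kernel_op b g z)%E; last first.
  apply: eq_integral => w _; rewrite /= ger0_norm; last first.
    by rewrite !mulr_ge0// powR_ge0.
  rewrite /F /G -mulrA; congr (_ * _)%:E.
  by rewrite -powRD pp' ?powRr1 ?ball_kernel_ge0// oner_eq0.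
move=> h; have := poweR_ge0_le (ltW p0) (ball_kernel_op_ge0 b z g0) h.
rewrite poweRM ?Lnorm_ge0// poweR_Lnorm ?gt_eqF//.
move=> {}h; apply: (le_trans h); rewrite muleC; apply: lee_pmul.
- exact: poweR_ge0.
- by apply: integral_ge0 => w _; exact: poweR_ge0.
- rewrite unlock -poweRrM.
  under eq_integral.
    move=> w _; rewrite /= ger0_norm ?powR_ge0// /G -powRrM mulVf ?gt_eqF// powRr1 ?ball_kernel_ge0//.
    over.
  rewrite (_ : p'^-1 * p = p - 1); last by rewrite /p' invrK; field; rewrite gt_eqF.
  rewrite -poweR_EFin; apply: poweR_ge0_le => //; first by rewrite subr_ge0 ltW.
  by apply: integral_ge0 => w _; rewrite lee_fin ball_kernel_ge0.
- rewrite le_eqVlt; apply/orP; left; apply/eqP; apply: eq_integral => w _.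
  rewrite /= ger0_norm; last by rewrite mulr_ge0// powR_ge0.
  by rewrite /F powRM ?powR_ge0// -powRrM mulVf ?gt_eqF// powRr1 ?ball_kernel_ge0.
Qed.

(** Second half of Schur's test: Tonelli's theorem exchanges the variables, and by symmetry of the
    kernel the integral in the other variable brings the last factor A. *)
Lemma ball_kernel_op_Lp b g (p A : R) : 1 < p -> 0 < A -> measurable_fun setT g -> (forall w, 0 <= g w) ->
  (forall z, (\int[v]_w (ball_kernel b (z, w))%:E <= A%:E)%E) ->
  (\int[v]_z (ball_kernel_op b g z `^ p) <= (A `^ p)%:E * \int[v]_w (g w `^ p)%:E)%E.
Proof.
move=> p1 A0 mg g0 hA; have p0 : 0 < p by lra.
have mgp : measurable_fun setT (fun w => g w `^ p) by apply: (measurableT_comp (measurable_powR _)).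
have gp0 w : 0 <= g w `^ p by exact: powR_ge0.
apply: (@le_trans _ _ (\int[v]_z ((A `^ (p - 1))%:E * ball_kernel_op b (fun w => (g w `^ p)%R) z))%E).
  apply: ge0_le_integral => //.
  - by move=> z _; exact: poweR_ge0.
  - by apply: (measurableT_comp (measurable_poweR p)); exact: measurable_ball_kernel_op.
  - by apply: measurable_funeM; exact: measurable_ball_kernel_op.
  - by move=> z _; exact: ball_kernel_op_holder.
rewrite ge0_integralZl//; last 3 first.
- exact: measurable_ball_kernel_op.
- by move=> z _; exact: ball_kernel_op_ge0.
- by rewrite lee_fin powR_ge0.
rewrite (_ : A `^ p = A `^ (p - 1) * A); last first.
  by rewrite mulrC mulr_powRB1// ltW.
rewrite EFinM -muleA; apply: lee_wpmul2l; first by rewrite lee_fin powR_ge0.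
rewrite /ball_kernel_op (fubini_tonelli (m1 := v) (m2 := v) (fun zw : Cd * Cd => (g zw.2 `^ p * ball_kernel b zw)%:E)); last 2 first.
- exact: (measurable_ball_kernel_op_arg b mgp).
- by move=> zw; rewrite lee_fin mulr_ge0// ball_kernel_ge0.
rewrite -ge0_integralZl; last 4 first.
- by [].
- exact/measurable_EFinP.
- by move=> w _; rewrite lee_fin powR_ge0.
- by rewrite lee_fin ltW.
apply: ge0_le_integral => //.
- by move=> w _; apply: integral_ge0 => z _; rewrite lee_fin mulr_ge0// ball_kernel_ge0.
- apply: (measurable_fun_fubini_tonelli_G (m1 := v) _ (measurable_ball_kernel_op_arg b mgp)) => zw.
  by rewrite lee_fin mulr_ge0// ball_kernel_ge0.
- by apply: measurable_funeM; exact/measurable_EFinP.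
move=> w _; rewrite /=.
under eq_integral do rewrite ball_kernelC EFinM.
rewrite ge0_integralZl//; last 3 first.
- by apply/measurable_EFinP; exact: measurable_ball_kernel_l.
- by move=> z _; rewrite lee_fin ball_kernel_ge0.
- by rewrite lee_fin powR_ge0.
by rewrite muleC; apply: lee_wpmul2r; rewrite ?lee_fin.
Qed.

Lemma ball_kernel_shift (b s : R) z w : B z -> 0 <= s ->
  ball_kernel b (z, w) <= 2 `^ s * bdist z `^ (- s) * ball_kernel (b - s) (z, w).
Proof.
move=> Bz s0; have [Bw|nBw] := pselect (B w); last first.
  by rewrite /ball_kernel/= [\1_B w]indicE memNset// mulr0 !mul0r mulr0.
have z0 : 0 < bdist z by exact/unit_ballP.
have w0 : 0 < bdist w by exact/unit_ballP.
have n0 := normc_1hdot_gt0 Bz Bw.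
rewrite !ball_kernel_in//; move: n0 (normc_1hdot_ge z w); set n := normc _ => n0 h.
have -> : n `^ (- b) = n `^ (- s) * n `^ (- (b - s)).
  rewrite -powRD; last by rewrite (gt_eqF n0) implybT.
  by rewrite (_ : - s - (b - s) = - b)//; ring.
apply: ler_wpM2r; first exact: powR_ge0.
rewrite !powRN ler_pdivlMr ?powR_gt0// mulrC ler_pdivrMr ?powR_gt0//.
rewrite -powRM ?(ltW n0)//; apply: ge0_ler_powR => //; rewrite ?nnegrE ?(ltW z0)//.
  by rewrite mulr_ge0// ltW.
lra.
Qed.

End kernel_operator.

Section generic_operator.
Variables (R : realType) (d : nat).
Hypothesis d0 : (0 < d)%N.
Local Notation Cd := (d.-tuple R[i]).
Local Notation v := (ball_measure R d).
Local Notation B := (@unit_ball R d).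
Implicit Types (z w : Cd) (f : Cd -> R[i]) (kap : R[i] -> R[i]).

(** Common form of the two operators. Only the values of [kap] on Re u > 0 matter, since 1 - <z,w>
    stays there. *)
Definition kernel_op kap f z : R[i] :=
  if z \in unit_ball then cintegral v unit_ball (fun w => f w * kap (1 - hdot z w)) else 0.

Lemma kernel_op_out kap f z : ~ B z -> kernel_op kap f z = 0.
Proof. by move=> nBz; rewrite /kernel_op memNset. Qed.

Lemma kernel_op_eq kap kap' f : (forall u, 0 < complex.Re u -> kap u = kap' u) ->
  kernel_op kap f = kernel_op kap' f.
Proof.
move=> kk; apply/funext => z; rewrite /kernel_op; case: ifPn => //; rewrite inE => Bz.
rewrite /cintegral; congr Complex; rewrite /Rintegral; congr fine;
  by apply: eq_integral => w; rewrite inE => Bw; rewrite kk//; exact: Re_1hdot_gt0.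
Qed.

(** [fine] sends infinite values to 0, so bounds of real-valued integrals built on this inequality
    need no integrability. *)
Lemma abse_fine_le (x : \bar R) : (`|fine x|%:E <= `|x|)%E.
Proof. by case: x => [r| |] //=; rewrite ?normr0 leey. Qed.

(** No integrability is assumed, so the positive and negative parts are treated separately by
    Tonelli's theorem and recombined under the measurable function [fine]. *)
Lemma measurable_real_integral (h : Cd * Cd -> R) : measurable_fun setT h ->
  measurable_fun setT (fun z => \int[v]_(w in B) h (z, w)).
Proof.
move=> mh; have mB := @measurable_unit_ball R d.
pose F (zw : Cd * Cd) : \bar R := (h zw * \1_B zw.2)%:E.
have mF : measurable_fun setT F.
  apply/measurable_EFinP; apply: measurable_funM => //.
  by apply: measurableT_comp; [exact: measurable_indic|exact: measurable_snd].
rewrite (_ : (fun z => _) = fine \o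
  (fun z => \int[v]_w (F^\+ (z, w)) - \int[v]_w (F^\- (z, w)))%E); last first.
  apply/funext => z; rewrite /Rintegral/= integral_mkcond integralE.
  congr (fine (_ - _)); apply: eq_integral => w _;
    rewrite !(funeposE, funenegE) /F patchE indicE;
    by case: ifPn; rewrite ?mulr1 ?mulr0.
apply: (measurableT_comp (fine_measurable measurableT)); apply: emeasurable_funB.
  apply: (measurable_fun_fubini_tonelli_F (m2 := v) _ (measurable_funepos mF)) => zw.
  exact: funepos_ge0.
apply: (measurable_fun_fubini_tonelli_F (m2 := v) _ (measurable_funeneg mF)) => zw.
exact: funeneg_ge0.
Qed.

Section bounds.
Variables (kap : R[i] -> R[i]) (alpha : R).
Hypothesis mkap : measurable_fun setT kap.
Hypothesis kap_le : forall u, 0 < complex.Re u -> normc (kap u) <= normc u `^ (- alpha).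

Lemma measurable_integrand f : measurable_fun setT f ->
  measurable_fun setT (fun zw : Cd * Cd => f zw.2 * kap (1 - hdot zw.1 zw.2)).
Proof.
move=> mf; apply: measurable_cmul.
  by apply: (measurableT_comp mf); exact: measurable_snd.
by apply: (measurableT_comp mkap); exact: measurable_1hdot.
Qed.

Lemma measurable_integrand_l f z : measurable_fun setT f ->
  measurable_fun setT (fun w : Cd => f w * kap (1 - hdot z w)).
Proof.
by move=> mf; exact: (measurableT_comp (measurable_integrand mf) (measurable_pair1 z)).
Qed.

Lemma measurable_kernel_op f : measurable_fun setT f -> measurable_fun setT (kernel_op kap f).
Proof.
move=> mf; have mB := @measurable_unit_ball R d.
have mi := measurable_integrand mf.
rewrite (_ : kernel_op kap f = fun z => ((\1_B z)%:C)%C *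
  Complex (\int[v]_(w in B) complex.Re (f w * kap (1 - hdot z w)))
    (\int[v]_(w in B) complex.Im (f w * kap (1 - hdot z w)))); last first.
  apply/funext => z; rewrite /kernel_op indicE; case: ifPn => _.
    by rewrite mul1r.
  by rewrite mul0r.
apply: measurable_cmul.
  apply/measurable_complexP; split => //=; exact: measurable_indic.
apply/measurable_complexP; split => /=.
  exact: (measurable_real_integral (measurable_Re mi)).
exact: (measurable_real_integral (measurable_Im mi)).
Qed.

Lemma abs_Rintegral_le (h : Cd -> R) (g : Cd -> R) z : measurable_fun setT h -> measurable_fun setT g ->
  B z -> (forall w, 0 <= g w) -> (forall w, B w -> `|h w| <= g w * normc (1 - hdot z w) `^ (- alpha)) ->
  (`|\int[v]_(w in B) h w|%:E <= ball_kernel_op alpha g z)%E.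
Proof.
move=> mh mg Bz g0 hg; have mB := @measurable_unit_ball R d.
apply: (le_trans (abse_fine_le _)).
apply: (le_trans (le_abse_integral _ _ _)) => //.
  by apply: measurable_funTS; exact/measurable_EFinP.
rewrite /ball_kernel_op integral_mkcond; apply: ge0_le_integral => //.
- by move=> w _; rewrite patchE; case: ifPn.
- apply/(measurable_restrictT _ mB); apply: measurable_funTS.
  by apply: measurableT_comp => //; exact/measurable_EFinP.
- apply/measurable_EFinP; apply: measurable_funM => //; exact: measurable_ball_kernel_l.
- move=> w _; rewrite patchE; case: ifPn => [|_].
    rewrite inE => Bw; rewrite /= lee_fin; apply: (le_trans (hg _ Bw)).
    by rewrite ball_kernel_in.
  by rewrite lee_fin mulr_ge0// ball_kernel_ge0.
Qed.

(** The factor 2 comes from bounding the real and imaginary parts separately. *)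
Lemma normc_kernel_op_le f z : measurable_fun setT f ->
  ((normc (kernel_op kap f z))%:E <= 2%:E * ball_kernel_op alpha (fun w => normc (f w)) z)%E.
Proof.
move=> mf; have [Bz|nBz] := pselect (B z); last first.
  rewrite kernel_op_out// normc0; apply: mule_ge0; first by rewrite lee_fin.
  by apply: ball_kernel_op_ge0 => w; exact: normc_ge0.
have mi := measurable_integrand_l z mf.
have bnd w : B w -> normc (f w * kap (1 - hdot z w)) <= normc (f w) * normc (1 - hdot z w) `^ (- alpha).
  move=> Bw; rewrite normcM ler_wpM2l ?normc_ge0//; apply: kap_le.
  exact: Re_1hdot_gt0.
have bR : (`|\int[v]_(w in B) complex.Re (f w * kap (1 - hdot z w))|%:E
    <= ball_kernel_op alpha (fun w => normc (f w)) z)%E.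
  apply: abs_Rintegral_le => //.
  - exact: measurable_Re.
  - exact: measurable_normc_comp.
  - by move=> w; exact: normc_ge0.
  - by move=> w Bw; apply: le_trans (bnd _ Bw); exact: Re_le_normc.
have bI : (`|\int[v]_(w in B) complex.Im (f w * kap (1 - hdot z w))|%:E
    <= ball_kernel_op alpha (fun w => normc (f w)) z)%E.
  apply: abs_Rintegral_le => //.
  - exact: measurable_Im.
  - exact: measurable_normc_comp.
  - by move=> w; exact: normc_ge0.
  - by move=> w Bw; apply: le_trans (bnd _ Bw); exact: Im_le_normc.
rewrite /kernel_op mem_set// /cintegral; apply: (le_trans (y := (`|\int[v]_(w in B) complex.Re (f w * kap (1 - hdot z w))| +
  `|\int[v]_(w in B) complex.Im (f w * kap (1 - hdot z w))|)%:E)).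
  by rewrite lee_fin; exact: normc_le_ReIm.
by rewrite EFinD mule_natl mule2n; exact: leeD.
Qed.

Definition integrable_c f := measurable_fun setT f /\ (\int[v]_w (normc (f w))%:E < +oo)%E.

Lemma cLfun_integrable_c (p : \bar R) f : (1 <= p)%E -> cLfun v p f -> integrable_c f.
Proof.
move=> p1 [mf fp]; split => //; apply: le_lt_trans fp.
apply: le_trans (cLnorm_le_exponent v (lexx 1%E) p1 mf).
rewrite le_eqVlt; apply/orP; left; apply/eqP.
rewrite /cLnorm Lnorm1; apply: eq_integral => w _ /=.
by rewrite ger0_norm ?normc_ge0.
Qed.

Lemma integrable_integrand f z : B z -> integrable_c f ->
  v.-integrable B (fun w => (complex.Re (f w * kap (1 - hdot z w)))%:E) /\
  v.-integrable B (fun w => (complex.Im (f w * kap (1 - hdot z w)))%:E).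
Proof.
move=> Bz [mf fi]; have mB := @measurable_unit_ball R d.
have mi := measurable_integrand_l z mf.
have z0 : 0 < bdist z by exact/unit_ballP.
(* For fixed z, |1 - <z,w>| lies between bdist z / 2 and 2. The first term of C serves when alpha >=
   0, the second when alpha < 0. *)
pose C := (bdist z / 2) `^ (- `|alpha|) + 2 `^ `|alpha|.
have C0 : 0 <= C by rewrite addr_ge0// powR_ge0.
have bnd w : B w -> normc (f w * kap (1 - hdot z w)) <= C * normc (f w).
  move=> Bw; rewrite normcM mulrC ler_wpM2r ?normc_ge0//.
  have n0 := normc_1hdot_gt0 Bz Bw; have n1 := normc_1hdot_ge z w.
  have w0 : 0 < bdist w by exact/unit_ballP.
  have n2 : normc (1 - hdot z w) <= 2.
    apply: (le_trans (le_normcD _ _)); rewrite normcN normc1.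
    by have := normc_hdot_le1 Bz Bw; lra.
  apply: (le_trans (kap_le (Re_1hdot_gt0 Bz Bw))).
  have [a0|a0] := leP 0 alpha.
    rewrite /C (ger0_norm a0) -[leLHS]addr0; apply: lerD; last exact: powR_ge0.
    rewrite !powRN lef_pV2 ?posrE ?powR_gt0 ?divr_gt0//.
    by apply: ge0_ler_powR; rewrite ?nnegrE; lra.
  rewrite /C (ltr0_norm a0) -[leLHS]add0r; apply: lerD; first exact: powR_ge0.
  by apply: ge0_ler_powR; rewrite ?nnegrE; lra.
have int_bnd (h : Cd -> R) : measurable_fun setT h -> (forall w, `|h w| <= normc (f w * kap (1 - hdot z w))) ->
    v.-integrable B (EFin \o h).
  move=> mh hb; apply/integrableP; split.
    by apply: measurable_funTS; exact/measurable_EFinP.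
  apply: (@le_lt_trans _ _ (\int[v]_(w in B) (C%:E * (normc (f w))%:E))%E).
    apply: ge0_le_integral => //.
    - by apply: measurable_funTS; apply: measurableT_comp => //; exact/measurable_EFinP.
    - apply: measurable_funTS; apply: measurable_funeM; apply/measurable_EFinP.
      exact: measurable_normc_comp.
    - move=> w Bw; rewrite /= -EFinM lee_fin; apply: (le_trans (hb w)); exact: bnd.
  rewrite ge0_integralZl//; last 2 first.
  - by apply: measurable_funTS; apply/measurable_EFinP; exact: measurable_normc_comp.
  - by move=> w _; rewrite lee_fin normc_ge0.
  apply: lte_mul_pinfty => //; apply: le_lt_trans fi.
  apply: ge0_subset_integral => //.
  - by apply/measurable_EFinP; exact: measurable_normc_comp.
  - by move=> w _; rewrite lee_fin normc_ge0.
split; apply: int_bnd.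
- exact: measurable_Re.
- by move=> w; exact: Re_le_normc.
- exact: measurable_Im.
- by move=> w; exact: Im_le_normc.
Qed.

Lemma kernel_op_linear f g (c : R) : integrable_c f -> integrable_c g ->
  kernel_op kap (fun w => (c%:C)%C * f w + g w) =
  (fun z => (c%:C)%C * kernel_op kap f z + kernel_op kap g z).
Proof.
move=> fi gi; apply/funext => z; rewrite /kernel_op; case: ifPn; last by rewrite mulr0 addr0.
rewrite inE => Bz; have mB := @measurable_unit_ball R d.
have [fR fI] := integrable_integrand Bz fi; have [gR gI] := integrable_integrand Bz gi.
apply: complex_eq; rewrite ?ReD ?ImD ?ReM ?ImM /cintegral /= mul0r ?subr0 ?addr0.
- rewrite -RintegralZl// -RintegralD//; last first.
    rewrite (_ : EFin \o _ = fun w => (c%:E * (complex.Re (f w * kap (1 - hdot z w)))%:E)%E); first exact: integrableZl.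
    by apply/funext => w; rewrite /= EFinM.
  congr fine; apply: eq_integral => w _; congr (_%:E).
  by rewrite mulrDl ReD -mulrA ReM /= mul0r subr0.
- rewrite -RintegralZl// -RintegralD//; last first.
    rewrite (_ : EFin \o _ = fun w => (c%:E * (complex.Im (f w * kap (1 - hdot z w)))%:E)%E); first exact: integrableZl.
    by apply/funext => w; rewrite /= EFinM.
  congr fine; apply: eq_integral => w _; congr (_%:E).
  by rewrite mulrDl ImD -mulrA ImM /= mul0r addr0.
Qed.

Lemma kernel_op0 z : kernel_op kap (fun=> 0) z = 0.
Proof.
rewrite /kernel_op; case: ifPn => // _; rewrite /cintegral /Rintegral.
by under eq_integral do rewrite mul0r; under [X in Complex _ (fine X)]eq_integral do rewrite mul0r;
  rewrite integral0.
Qed.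

Lemma kernel_opZ f (c : R) : integrable_c f -> kernel_op kap (fun w => (c%:C)%C * f w) =
  (fun z => (c%:C)%C * kernel_op kap f z).
Proof.
move=> fi; have oi : integrable_c (fun _ : Cd => 0 : R[i]).
  by split => //; under eq_integral do rewrite normc0; rewrite integral0.
have := kernel_op_linear c fi oi; under eq_fun do rewrite addr0.
by move=> ->; apply/funext => z; rewrite kernel_op0 addr0.
Qed.

End bounds.

End generic_operator.

(** * The weighted estimate with a spare power of the distance *)

Section weighted_bound.
Variables (R : realType) (d : nat).
Hypothesis d0 : (0 < d)%N.
Local Notation Cd := (d.-tuple R[i]).
Local Notation v := (ball_measure R d).
Local Notation B := (@unit_ball R d).
Variables (kap : R[i] -> R[i]) (alpha : R).
Hypothesis mkap : measurable_fun setT kap.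
Hypothesis kap_le : forall u, 0 < complex.Re u -> normc (kap u) <= normc u `^ (- alpha).
Hypothesis halpha : d%:R + 1 < alpha < d%:R + 2.

(** Young's inequality with the conjugate exponents p/q and r/q, whose coefficients are at most 1.
    Used pointwise for normalized f, it plays the part of Hölder's inequality; homogeneity is
    restored afterwards. *)
Lemma young_powR (x y p q r : R) : 0 <= x -> 0 <= y -> 0 < q -> q < p -> 0 < r ->
  q^-1 = p^-1 + r^-1 -> (x * y) `^ q <= x `^ p + y `^ r.
Proof.
move=> x0 y0 q0 qp r0 pqr; have p0 : 0 < p by exact: lt_trans qp.
have P0 : 0 < p / q by rewrite divr_gt0.
have r'0 : 0 < r / q by rewrite divr_gt0.
have e : (p / q)^-1 + (r / q)^-1 = 1.
  by rewrite !invf_div -mulrDr -pqr mulfV// gt_eqF.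
have := conjugate_powR (powR_ge0 x q) (powR_ge0 y q) P0 r'0 e.
rewrite -!powRrM ![q * (_ / q)]mulrC !divfK ?gt_eqF// -powRM// => h.
apply: (le_trans h); apply: lerD.
  by rewrite ler_piMr ?powR_ge0// invf_le1// ler_pdivlMr// mul1r ltW.
rewrite ler_piMr ?powR_ge0//; have : 0 <= (p / q)^-1 by rewrite invr_ge0 ltW.
lra.
Qed.

Variables p q : R.
Hypothesis p1 : 1 <= p.
Hypothesis q1 : 1 <= q.
Hypothesis pq : p^-1 + (alpha - (d%:R + 1)) < q^-1.

Lemma kernel_op_weighted_unit : exists s K : R, [/\ 0 < s, 0 < K & forall f : Cd -> R[i],
  measurable_fun setT f -> (\int[v]_w (normc (f w) `^ p)%:E <= 1)%E ->
  (\int[v]_(z in B) (bdist z `^ (- (s * q)) * normc (kernel_op kap f z) `^ q)%:E <= K%:E)%E].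
Proof.
have /andP[al1 al2] := halpha.
(* The slack 1/q - 1/p - t is cut into three equal parts s. Removing the power t + s from the kernel
   leaves the exponent b = d + 1 - s, below the threshold d + 1; the weight takes a second s; with
   tau = t + 2 s and 1/r = 1/q - 1/p, tau r = 1 - s r < 1, so bdist^(-tau) lies in L^r. *)
pose t := alpha - (d%:R + 1); pose s := (q^-1 - p^-1 - t) / 3.
have t0 : 0 < t by rewrite /t; lra.
have pq' : p^-1 + t < q^-1 by exact: pq.
have p0 : 0 < p := lt_le_trans ltr01 p1.
have q0 : 0 < q := lt_le_trans ltr01 q1.
have pV0 : 0 < p^-1 by rewrite invr_gt0.
have qV1 : q^-1 <= 1 by rewrite invf_le1.
have s0 : 0 < s by rewrite divr_gt0//; lra.
have s1 : 3 * s = q^-1 - p^-1 - t by rewrite /s mulrC divfK// pnatr_eq0.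
have d1 : 0 <= d%:R :> R by [].
pose b := alpha - (t + s).
have bE : b = d.+1%:R - s by rewrite /b /t -natr1; ring.
have b01 : 0 < b < d.+1%:R by rewrite bE -natr1; apply/andP; split; lra.
pose tau := t + 2 * s; pose r := (q^-1 - p^-1)^-1.
have rV0 : 0 < q^-1 - p^-1 by lra.
have r0 : 0 < r by rewrite invr_gt0.
have qp : q < p.
  by rewrite -ltf_pV2 ?posrE//; lra.
have pqr : q^-1 = p^-1 + r^-1 by rewrite /r invrK; ring.
have tr : 0 < tau * r < 1.
  rewrite mulr_gt0//=; last by rewrite /tau; lra.
  by rewrite /r ltr_pdivrMr// mul1r /tau; lra.
have [A A0 hA] := @ball_kernel_integral_le R d d0 b b01.
have [K1 K10 hK1] := @bdist_integral_le R d d0 (tau * r) tr.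
pose c := (2 * 2 `^ (t + s)) `^ q.
have c0 : 0 < c by rewrite powR_gt0// mulr_gt0// powR_gt0.
exists s, (c * (A `^ p + K1)); split => //.
  by rewrite mulr_gt0// addr_gt0// powR_gt0.
move=> f mf hf; have mB := @measurable_unit_ball R d.
pose g w := normc (f w).
have mg : measurable_fun setT g by exact: measurable_normc_comp.
have g0 w : 0 <= g w by exact: normc_ge0.
have mQ := measurable_ball_kernel_op b mg g0.
have mQp : measurable_fun setT (fun z => ball_kernel_op b g z `^ p)%E.
  exact: (measurableT_comp (measurable_poweR p)).
have md : measurable_fun setT (fun z : Cd => (bdist z `^ (- (tau * r)))%:E).
  by apply/measurable_EFinP; apply: (measurableT_comp (measurable_powR _)); exact: measurable_bdist.
have d0' (z : Cd) : (0 <= (bdist z `^ (- (tau * r)))%:E :> \bar R)%E by rewrite lee_fin powR_ge0.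
apply: (@le_trans _ _ (\int[v]_(z in B) (c%:E * (ball_kernel_op b g z `^ p + (bdist z `^ (- (tau * r)))%:E)))%E).
  apply: ge0_le_integral => //.
  - by move=> z _; rewrite lee_fin mulr_ge0// powR_ge0.
  - apply: measurable_funTS; apply/measurable_EFinP; apply: measurable_funM.
      by apply: (measurableT_comp (measurable_powR _)); exact: measurable_bdist.
    apply: (measurableT_comp (measurable_powR _)); apply: measurable_normc_comp.
    exact: measurable_kernel_op.
  - by apply: measurable_funTS; apply: measurable_funeM; exact: emeasurable_funD.
  move=> z Bz; have z0 : 0 < bdist z by exact/unit_ballP.
  (* Where the integral of [g] against the kernel is infinite, so is the majorant; elsewhere it is a
     real number y. *)
  have := ball_kernel_op_ge0 b z g0; case QE : (ball_kernel_op b g z) => [y| |]// y0; last first.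
    by rewrite poweRyr ?gt_eqF// addye// gt0_muley ?leey// lte_fin.
  rewrite lee_fin in y0.
  have hz : normc (kernel_op kap f z) <= 2 * (2 `^ (t + s) * bdist z `^ (- (t + s)) * y).
    rewrite -lee_fin; apply: (le_trans (normc_kernel_op_le mkap kap_le z mf)).
    rewrite [leRHS]EFinM; apply: lee_wpmul2l; first by rewrite lee_fin.
    rewrite [leRHS]EFinM -QE -ge0_integralZl; last 4 first.
    - by [].
    - by apply/measurable_EFinP; apply: measurable_funM => //; exact: measurable_ball_kernel_l.
    - by move=> w _; rewrite lee_fin mulr_ge0 ?normc_ge0 ?ball_kernel_ge0.
    - by rewrite lee_fin mulr_ge0// powR_ge0.
    apply: ge0_le_integral => //.
    - by move=> w _; rewrite lee_fin mulr_ge0 ?normc_ge0 ?ball_kernel_ge0.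
    - by apply/measurable_EFinP; apply: measurable_funM => //; exact: measurable_ball_kernel_l.
    - apply: measurable_funeM; apply/measurable_EFinP; apply: measurable_funM => //.
      exact: measurable_ball_kernel_l.
    - move=> w _; rewrite -EFinM lee_fin [leRHS]mulrCA; apply: ler_wpM2l; first exact: normc_ge0.
      by apply: ball_kernel_shift => //; lra.
  rewrite poweR_EFin -EFinD -EFinM lee_fin mulrDr.
  have e1 : bdist z `^ (- (s * q)) = (bdist z `^ (- s)) `^ q by rewrite -powRrM mulNr.
  rewrite e1 -powRM ?powR_ge0 ?normc_ge0//.
  apply: (@le_trans _ _ ((2 * 2 `^ (t + s) * (y * bdist z `^ (- tau))) `^ q)).
    apply: ge0_ler_powR; rewrite ?nnegrE ?(ltW q0) ?mulr_ge0 ?normc_ge0 ?powR_ge0//.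
    have -> : bdist z `^ (- tau) = bdist z `^ (- s) * bdist z `^ (- (t + s)).
      rewrite -powRD; last by rewrite (gt_eqF z0) implybT.
      by rewrite (_ : - s - (t + s) = - tau)// /tau; ring.
    apply: (le_trans (ler_wpM2l (powR_ge0 _ _) hz)); rewrite le_eqVlt; apply/orP; left.
    by apply/eqP; ring.
  rewrite powRM ?mulr_ge0 ?powR_ge0// -mulrDr ler_wpM2l ?powR_ge0//.
  have := @young_powR y (bdist z `^ (- tau)) p q r y0 (powR_ge0 _ _) q0 qp r0 pqr.
  by rewrite -[X in _ <= _ + X]powRrM mulNr.
rewrite ge0_integralZl//; last 3 first.
- by apply: measurable_funTS; exact: emeasurable_funD.
- by move=> z _; apply: adde_ge0 => //; exact: poweR_ge0.
- by rewrite lee_fin ltW.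
rewrite EFinM; apply: lee_wpmul2l; first by rewrite lee_fin ltW.
rewrite ge0_integralD//; last 3 first.
- by move=> z _; exact: poweR_ge0.
- exact: measurable_funTS.
- exact: measurable_funTS.
rewrite EFinD; apply: leeD => //.
apply: (@le_trans _ _ (\int[v]_z (ball_kernel_op b g z `^ p))%E).
  by apply: ge0_subset_integral => // z _; exact: poweR_ge0.
apply: (le_trans (ball_kernel_op_Lp _ A0 mg g0 hA)); first exact: le_lt_trans qp.
by rewrite -[leRHS]mule1; apply: lee_wpmul2l => //; rewrite lee_fin powR_ge0.
Qed.

(** Homogeneity, applied to f / M. Any positive bound M of the norm is allowed, so that functions of
    norm 0 need no separate treatment. *)
Lemma kernel_op_weighted : exists s K : R, [/\ 0 < s, 0 < K & forall (f : Cd -> R[i]) (M : R),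
  cLfun v p%:E f -> 0 < M -> (cLnorm v p%:E f <= M%:E)%E ->
  (\int[v]_(z in B) (bdist z `^ (- (s * q)) * normc (kernel_op kap f z) `^ q)%:E <= (K * M `^ q)%:E)%E].
Proof.
have [s [K [s0 K0 hK]]] := kernel_op_weighted_unit; exists s, K; split => // f M fp M0 fM.
have p0 : 0 < p := lt_le_trans ltr01 p1.
have [mf _] := fp.
have fi := cLfun_integrable_c (p := p%:E) _ fp.
have MV : 0 < M^-1 by rewrite invr_gt0.
have mf' : measurable_fun setT (fun w => ((M^-1)%:C)%C * f w).
  exact: (measurable_cmul (measurable_cst _) mf).
have h : (\int[v]_w (normc (((M^-1)%:C)%C * f w) `^ p)%:E <= 1)%E.
  rewrite -[leRHS](poweR1r p) poweR_EFin; apply/cLnorm_leP => //.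
  by rewrite cLnormZ// muleC lee_pdivrMr// mul1e.
have := hK _ mf' h; rewrite (kernel_opZ mkap kap_le _ (fi p1)).
under eq_integral => z _.
  rewrite normcM normc_real gtr0_norm// powRM ?normc_ge0 ?(ltW MV)// mulrCA EFinM.
  over.
have mB := @measurable_unit_ball R d.
rewrite ge0_integralZl; last 4 first.
- by [].
- apply: measurable_funTS; apply/measurable_EFinP; apply: measurable_funM.
    by apply: (measurableT_comp (measurable_powR _)); exact: measurable_bdist.
  apply: (measurableT_comp (measurable_powR _)); apply: measurable_normc_comp.
  exact: measurable_kernel_op.
- by move=> z _; rewrite lee_fin mulr_ge0// powR_ge0.
- by rewrite lee_fin powR_ge0.
have -> : M^-1 `^ q = (M `^ q)^-1 by rewrite -powR_inv1 ?(ltW M0)// -powRrM mulN1r powRN.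
by rewrite muleC lee_pdivrMr ?powR_gt0// -EFinM.
Qed.

End weighted_bound.

(** * The two kernels *)

Section real_lipschitz.
Variable R : realType.

Lemma derive_lipschitz (f df : R -> R) (a b L : R) :
  (forall x, a <= x <= b -> is_derive x 1 f (df x)) ->
  (forall x, a <= x <= b -> `|df x| <= L) ->
  forall x y, a <= x <= b -> a <= y <= b -> `|f x - f y| <= L * `|x - y|.
Proof.
move=> fdf dfL; suff H x y : a <= x -> x <= y -> y <= b -> `|f x - f y| <= L * `|x - y|.
  move=> x y /andP[ax xb] /andP[ay yb]; have [xy|/ltW yx] := leP x y; first exact: H.
  by rewrite distrC [`|x - y|]distrC; exact: H.
move=> ax xy yb.
have xyab z : z \in `[x, y] -> a <= z <= b.
  by rewrite in_itv/= => /andP[? ?]; apply/andP; split; lra.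
have [||z zxy e] := @MVT_segment R f df x y xy.
- by move=> z zxy; apply: fdf; apply: xyab; move: zxy; rewrite !in_itv/= => /andP[/ltW -> /ltW ->].
- apply: derivable_within_continuous => z zxy.
  by have := fdf _ (xyab _ zxy) => -[].
rewrite distrC e normrM [`|x - y|]distrC ler_wpM2r//.
exact: dfL (xyab _ zxy).
Qed.

Lemma cos_lipschitz (x y : R) : `|cos x - cos y| <= `|x - y|.
Proof.
rewrite -[leRHS]mul1r.
apply: (@derive_lipschitz _ (fun x => - sin x) (Num.min x y) (Num.max x y)) => [z _||].
- by rewrite normrN sin_max.
- by rewrite ge_min le_max !lexx.
- by rewrite ge_min le_max !lexx !orbT.
Qed.

Lemma sin_lipschitz (x y : R) : `|sin x - sin y| <= `|x - y|.
Proof.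
rewrite -[leRHS]mul1r.
apply: (@derive_lipschitz _ cos (Num.min x y) (Num.max x y)) => [z _||].
- by rewrite cos_max.
- by rewrite ge_min le_max !lexx.
- by rewrite ge_min le_max !lexx !orbT.
Qed.

Lemma atan_lipschitz (x y : R) : `|atan x - atan y| <= `|x - y|.
Proof.
rewrite -[leRHS]mul1r.
apply: (@derive_lipschitz _ (fun x => (1 + x ^+ 2)^-1) (Num.min x y) (Num.max x y)) => [z _||].
- have := sqr_ge0 z => z0.
  by rewrite ger0_norm ?invr_ge0 ?addr_ge0// invf_le1 ?lerDl// ltr_pwDl.
- by rewrite ge_min le_max !lexx.
- by rewrite ge_min le_max !lexx !orbT.
Qed.

Lemma powRN_lipschitz (alpha c : R) : 0 <= alpha -> 0 < c ->
  exists2 L, 0 <= L & forall x y, c <= x -> c <= y ->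
    `|x `^ (- alpha) - y `^ (- alpha)| <= L * `|x - y|.
Proof.
move=> a0 c0; exists (alpha * c `^ (- alpha - 1)); first by rewrite mulr_ge0// powR_ge0.
move=> x y cx cy.
apply: (@derive_lipschitz (@powR R ^~ (- alpha)) (fun x => - alpha * x `^ (- alpha - 1)) c (Num.max x y)) => [z|z||].
- by move=> /andP[cz _]; apply: is_derive1_powR; exact: lt_le_trans cz.
- move=> /andP[cz _]; rewrite normrM normrN !ger0_norm ?powR_ge0//.
  apply: ler_wpM2l => //; rewrite -opprD !powRN.
  have z0 : 0 < z by exact: lt_le_trans cz.
  rewrite lef_pV2 ?posrE ?powR_gt0//; apply: ge0_ler_powR; rewrite ?nnegrE ?addr_ge0// ltW//.
- by rewrite cx le_max lexx.
- by rewrite cy le_max lexx orbT.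
Qed.

End real_lipschitz.

Section kernels.
Variables (R : realType) (alpha : R).
Implicit Types u : R[i].

(* Division is written as a power so that both kernels are visibly Borel on the
   whole plane; only the half-plane Re u > 0 matters. *)
Definition cangle u : R := atan (complex.Im u * complex.Re u `^ (- 1)).

(** Polar form of the principal value of u^(-alpha) on Re u > 0. *)
Definition K_kernel u : R[i] := ((normc u `^ (- alpha))%:C)%C *
  Complex (cos (alpha * cangle u)) (- sin (alpha * cangle u)).

Definition Kplus_kernel u : R[i] := ((normc u `^ (- alpha))%:C)%C.

Lemma cangleE u : 0 < complex.Re u -> cangle u = atan (complex.Im u / complex.Re u).
Proof. by move=> u0; rewrite /cangle powR_inv1// ltW. Qed.

Lemma normc_gt0 u : 0 < complex.Re u -> 0 < normc u.
Proof. by move=> u0; apply: (lt_le_trans u0); rewrite (le_trans (ler_norm _))// Re_le_normc. Qed.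

(** The angle theta = atan (Im u / Re u) has cosine Re u / |u| and lies in ]-pi/2, pi/2[, so acos
    returns |theta|; the sign test on Im u in [carg] restores theta. *)
Lemma carg_cangle u : 0 < complex.Re u -> carg u = cangle u.
Proof.
move=> u0; rewrite cangleE// /carg; set x := complex.Re u; set y := complex.Im u.
have n0 := normc_gt0 u0.
have e : x / normc u = cos (atan (y / x)).
  rewrite cos_atan; apply: (mulIf (lt0r_neq0 n0)); rewrite divfK ?gt_eqF//.
  apply: (@mulfI _ (Num.sqrt (1 + (y / x) ^+ 2))).
    by rewrite gt_eqF// sqrtr_gt0 ltr_pwDl// sqr_ge0.
  rewrite mulrA mulfV ?mul1r; last by rewrite gt_eqF// sqrtr_gt0 ltr_pwDl// sqr_ge0.
  apply/eqP; rewrite -(eqrXn2 (n := 2))// ?mulr_ge0 ?sqrtr_ge0 ?normc_ge0 ?(ltW u0)//.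
  rewrite exprMn sqr_sqrtr ?addr_ge0 ?sqr_ge0// sqr_normc_ReIm -/x -/y.
  by apply/eqP; field; rewrite gt_eqF.
have p0 := pi_gt0 R; have := atan_gtNpi2 (y / x); have := atan_ltpi2 (y / x) => h1 h2.
rewrite e; case: ifPn => y0.
  have : atan 0 <= atan (y / x) by apply: le_atan; rewrite divr_ge0// ltW.
  by rewrite atan0 => h0; rewrite cosK// in_itv/= h0/=; lra.
rewrite -ltNge in y0.
have : atan (y / x) <= atan 0 by apply: le_atan; rewrite ler_pdivrMr// mul0r ltW.
by rewrite atan0 => h0; rewrite cosKN ?opprK//; apply/andP; split; lra.
Qed.

Lemma cpowV u : 0 < complex.Re u -> (cpow u alpha)^-1 = K_kernel u.
Proof.
move=> u0; have n0 := normc_gt0 u0.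
have a0 : 0 < normc u `^ alpha by exact: powR_gt0.
apply: (@mulfI _ (cpow u alpha)).
  apply/eqP => /(congr1 (@normc R)); rewrite normc0 /cpow carg_cangle//= !exprMn -mulrDr cos2Dsin2 mulr1.
  by rewrite sqrtr_sqr ger0_norm ?(ltW a0)// => h; rewrite h ltxx in a0.
have cp0 : cpow u alpha != 0.
  apply/eqP => /(congr1 (@normc R)); rewrite normc0 /cpow carg_cangle//= !exprMn -mulrDr cos2Dsin2 mulr1.
  by rewrite sqrtr_sqr ger0_norm ?(ltW a0)// => h; rewrite h ltxx in a0.
rewrite mulfV//; apply: complex_eq; rewrite /cpow /K_kernel carg_cangle// powRN.
  rewrite !ReM !ImM/=; set A := _ `^ _; set c := cos _; set s := sin _.
  have := cos2Dsin2 (alpha * cangle u); rewrite -/c -/s => cs.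
  by rewrite -cs; field; rewrite gt_eqF.
rewrite !ImM !ReM/=; set A := _ `^ _; set c := cos _; set s := sin _.
by field; rewrite gt_eqF.
Qed.

Lemma normc_K_kernel u : normc (K_kernel u) = normc u `^ (- alpha).
Proof.
rewrite /K_kernel normcM normc_real ger0_norm ?powR_ge0// -[RHS]mulr1; congr (_ * _).
by rewrite /= sqrrN cos2Dsin2 sqrtr1.
Qed.

Lemma normc_Kplus_kernel u : normc (Kplus_kernel u) = normc u `^ (- alpha).
Proof. by rewrite /Kplus_kernel normc_real ger0_norm ?powR_ge0. Qed.

Lemma measurable_normc_powRN : measurable_fun setT (fun u : R[i] => normc u `^ (- alpha)).
Proof. by apply: (measurableT_comp (measurable_powR _)); exact: measurable_normc. Qed.

Lemma measurable_Kplus_kernel : measurable_fun setT Kplus_kernel.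
Proof. by apply/measurable_complexP; split => //=; exact: measurable_normc_powRN. Qed.

Lemma measurable_K_kernel : measurable_fun setT K_kernel.
Proof.
have mth : measurable_fun setT (fun u => alpha * cangle u).
  apply: measurable_funM => //; apply: (measurableT_comp (f := @atan R)).
    by apply: continuous_measurable_fun => x; exact: continuous_atan.
  apply: measurable_funM; first exact: (measurable_Im (@measurable_id _ _ _)).
  by apply: (measurableT_comp (measurable_powR _)); exact: (measurable_Re (@measurable_id _ _ _)).
apply: measurable_cmul; first exact: measurable_Kplus_kernel.
apply/measurable_complexP; split => /=.
  by apply: (measurableT_comp _ mth); apply: continuous_measurable_fun; exact: continuous_cos.
apply: measurable_funN.
by apply: (measurableT_comp _ mth); apply: continuous_measurable_fun; exact: continuous_sin.
Qed.

(** The constant cos 1 matches the bound for [K_kernel], so that one sector hypothesis covers both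
    kernels. *)
Lemma Re_Kplus_kernel_ge u : cos 1 * normc u `^ (- alpha) <= complex.Re (Kplus_kernel u).
Proof. by rewrite /= ler_piMl ?powR_ge0// cos_le1. Qed.

(** In this sector |alpha arg u| <= alpha |Im u| / Re u <= 1, and the cosine decreases on [0, pi],
    which contains [0, 1]. *)
Lemma Re_K_kernel_ge u : 0 < alpha -> 0 < complex.Re u -> alpha * `|complex.Im u| <= complex.Re u ->
  cos 1 * normc u `^ (- alpha) <= complex.Re (K_kernel u).
Proof.
move=> a0 u0 h; rewrite /K_kernel ReM/= mul0r subr0 mulrC ler_wpM2l ?powR_ge0//.
have th : `|alpha * cangle u| <= 1.
  rewrite cangleE// normrM gtr0_norm//.
  have := atan_lipschitz (complex.Im u / complex.Re u) 0; rewrite atan0 !subr0 => h1.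
  apply: (le_trans (ler_wpM2l (ltW a0) h1)).
  by rewrite normrM normfV (gtr0_norm u0) mulrA ler_pdivrMr// mul1r.
have -> : cos (alpha * cangle u) = cos `|alpha * cangle u|.
  by case: (ger0P (alpha * cangle u)) => _; rewrite ?cosN.
have p2 := pi_ge2 R.
by rewrite leNgt ltr_cos ?in_itv/= ?normr_ge0 ?ler01/= -?leNgt//; lra.
Qed.

(** Product rule in polar form: L is the Lipschitz constant of the modulus factor and N its bound, D
    is the Lipschitz constant of Im u / Re u for Re u >= c and |u| <= 2, and the factor 2 adds up
    real and imaginary parts. *)
Lemma K_kernel_lipschitz (c : R) : 0 <= alpha -> 0 < c -> exists2 L, 0 <= L & forall u w,
  c <= complex.Re u -> c <= complex.Re w -> normc u <= 2 -> normc w <= 2 ->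
  normc (K_kernel u - K_kernel w) <= L * normc (u - w).
Proof.
move=> a0 c0; have [L L0 hL] := powRN_lipschitz a0 c0.
pose N := c `^ (- alpha); pose D := c^-1 + 2 * (c^-1 * c^-1).
have N0 : 0 <= N by exact: powR_ge0.
have cV : 0 < c^-1 by rewrite invr_gt0.
have D0 : 0 <= D by rewrite /D; have := mulr_gt0 cV cV; lra.
exists (2 * (L + N * (alpha * D))).
  by rewrite mulr_ge0// addr_ge0// mulr_ge0// mulr_ge0.
move=> u w cu cw u2 w2.
have u0 : 0 < complex.Re u by exact: lt_le_trans cu.
have w0 : 0 < complex.Re w by exact: lt_le_trans cw.
have nu : c <= normc u by rewrite (le_trans cu)// (le_trans (ler_norm _))// Re_le_normc.
have nw : c <= normc w by rewrite (le_trans cw)// (le_trans (ler_norm _))// Re_le_normc.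
have Nw : normc w `^ (- alpha) <= N.
  rewrite /N !powRN lef_pV2 ?posrE ?powR_gt0 ?(lt_le_trans c0)//.
  by apply: ge0_ler_powR; rewrite ?nnegrE ?normc_ge0 ?(ltW c0).
set n := normc (u - w).
have n0 : 0 <= n by exact: normc_ge0.
have dn : `|normc u - normc w| <= n.
  by rewrite ler_norml lerNl opprB {1}/n normcB !ler_normcB.
have d1 : `|normc u `^ (- alpha) - normc w `^ (- alpha)| <= L * n.
  by apply: (le_trans (hL _ _ nu nw)); rewrite ler_wpM2l.
have th : `|alpha * cangle u - alpha * cangle w| <= alpha * D * n.
  rewrite -mulrBr normrM ger0_norm// -mulrA ler_wpM2l// !cangleE//.
  apply: (le_trans (atan_lipschitz _ _)).
  have -> : complex.Im u / complex.Re u - complex.Im w / complex.Re w =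
     (complex.Im u - complex.Im w) / complex.Re u +
     complex.Im w * (complex.Re w - complex.Re u) * ((complex.Re u)^-1 * (complex.Re w)^-1).
    by field; rewrite (gt_eqF u0) (gt_eqF w0).
  have uV : (complex.Re u)^-1 <= c^-1 by rewrite lef_pV2.
  have wV : (complex.Re w)^-1 <= c^-1 by rewrite lef_pV2.
  have uV0 : 0 <= (complex.Re u)^-1 by rewrite invr_ge0 ltW.
  have wV0 : 0 <= (complex.Re w)^-1 by rewrite invr_ge0 ltW.
  have hI : `|complex.Im u - complex.Im w| <= n.
    by rewrite -ImN -ImD Im_le_normc.
  have hR : `|complex.Re w - complex.Re u| <= n.
    by rewrite distrC -ReN -ReD Re_le_normc.
  have hw : `|complex.Im w| <= 2 by rewrite (le_trans (Im_le_normc _)).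
  apply: (le_trans (ler_normD _ _)); rewrite /D [leRHS]mulrDl; apply: lerD.
    by rewrite normrM mulrC (ger0_norm uV0); apply: ler_pM.
  rewrite !normrM (ger0_norm uV0) (ger0_norm wV0).
  rewrite [leRHS](_ : _ = 2 * n * (c^-1 * c^-1)); last by ring.
  by apply: ler_pM; rewrite ?mulr_ge0//; apply: ler_pM.
have key (f : R -> R) : (forall x y, `|f x - f y| <= `|x - y|) -> (forall x, `|f x| <= 1) ->
   `|normc u `^ (- alpha) * f (alpha * cangle u) - normc w `^ (- alpha) * f (alpha * cangle w)|
     <= (L + N * (alpha * D)) * n.
  move=> flip f1.
  have -> : normc u `^ (- alpha) * f (alpha * cangle u) - normc w `^ (- alpha) * f (alpha * cangle w) =
    (normc u `^ (- alpha) - normc w `^ (- alpha)) * f (alpha * cangle u) +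
     normc w `^ (- alpha) * (f (alpha * cangle u) - f (alpha * cangle w)) by ring.
  apply: (le_trans (ler_normD _ _)); rewrite [leRHS]mulrDl; apply: lerD.
    by rewrite normrM (le_trans _ d1)// ler_piMr.
  rewrite normrM ger0_norm ?powR_ge0// -mulrA; apply: ler_pM => //.
    exact: powR_ge0.
  exact: (le_trans (flip _ _)).
apply: (le_trans (normc_le_ReIm _)).
have -> : 2 * (L + N * (alpha * D)) * n = (L + N * (alpha * D)) * n + (L + N * (alpha * D)) * n by ring.
rewrite ReD ImD ReN ImN /K_kernel !ReM !ImM/= !mul0r !subr0 !addr0; apply: lerD.
  by apply: key => [x y|x]; [exact: cos_lipschitz|exact: cos_max].
apply: (key (fun x => - sin x)) => [x y|x]; last by rewrite normrN sin_max.
by rewrite -opprD normrN sin_lipschitz.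
Qed.

End kernels.

(** * Sufficiency *)

Section sufficiency.
Variables (R : realType) (d : nat).
Hypothesis d0 : (0 < d)%N.
Local Notation Cd := (d.-tuple R[i]).
Local Notation v := (ball_measure R d).
Local Notation B := (@unit_ball R d).
Variables (kap : R[i] -> R[i]) (alpha : R).
Hypothesis mkap : measurable_fun setT kap.
Hypothesis kap_le : forall u, 0 < complex.Re u -> normc (kap u) <= normc u `^ (- alpha).
Hypothesis halpha : d%:R + 1 < alpha < d%:R + 2.

(** Merges the two cases of condition (4) into one inequality between real exponents. For p
    infinite, p0 is finite with 1/p0 equal to half of the slack 1/q - t; on a probability space the
    L^p0 norm is below the L^oo norm. *)
Lemma exponents_reduce (p q : \bar R) : (1 <= p)%E -> (1 <= q)%E ->
  [/\ (((d%:R + 2 - alpha)^-1)%:E < p)%E, (p < +oo)%E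
         & (q^-1 > p^-1 + (alpha - (d%:R + 1))%:E)%E]
       \/ (p = +oo%E /\ (q < ((alpha - (d%:R + 1))^-1)%:E)%E) ->
  exists p0 q0 : R, [/\ 1 <= p0, 1 <= q0, (p0%:E <= p)%E, q = q0%:E &
    p0^-1 + (alpha - (d%:R + 1)) < q0^-1].
Proof.
have /andP[al1 al2] := halpha.
have t0 : 0 < alpha - (d%:R + 1) by lra.
move=> p1 q1 [[_ poo]|[-> qt]].
  case: p p1 poo => [p| |]// p1 _; rewrite lee_fin in p1.
  have p0 : 0 < p by exact: lt_le_trans p1.
  case: q q1 => [q| |]// q1; last first.
    rewrite invey inver gt_eqF// -EFinD lte_fin => h.
    have : 0 < p^-1 by rewrite invr_gt0.
    lra.
  rewrite lee_fin in q1; have q0 : 0 < q by exact: lt_le_trans q1.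
  by rewrite !inver !gt_eqF// -EFinD lte_fin => h; exists p, q; split.
case: q q1 qt => [q| |]// q1; rewrite lte_fin => qt; rewrite lee_fin in q1.
have q0 : 0 < q by exact: lt_le_trans q1.
have tq : alpha - (d%:R + 1) < q^-1 by rewrite -[ltLHS]invrK ltf_pV2 ?posrE ?invr_gt0.
have qV1 : q^-1 <= 1 by rewrite invf_le1.
pose e := (q^-1 - (alpha - (d%:R + 1))) / 2.
have e0 : 0 < e by rewrite divr_gt0// subr_gt0.
exists e^-1, q; split => //; last by rewrite invrK /e; lra.
  by rewrite invf_ge1 ?posrE// /e; lra.
by rewrite leey.
Qed.

Section real_exponents.
Variables p q : R.
Hypothesis p1 : 1 <= p.
Hypothesis q1 : 1 <= q.
Hypothesis pq : p^-1 + (alpha - (d%:R + 1)) < q^-1.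

Let q0 : 0 < q := lt_le_trans ltr01 q1.

(** Markov's inequality: eta^(s q) bdist^(-s q) >= 1 where 0 < bdist <= eta, and the image vanishes
    where bdist <= 0. The bound tends to 0 with eta, uniformly for norms at most M. *)
Lemma kernel_op_tail : exists s K : R, [/\ 0 < s, 0 < K & forall (f : Cd -> R[i]) (M eta : R),
  cLfun v p%:E f -> 0 < M -> (cLnorm v p%:E f <= M%:E)%E -> 0 < eta ->
  (\int[v]_(z in [set z | (bdist z <= eta)%R]) (normc (kernel_op kap f z) `^ q)%:E
     <= (eta `^ (s * q) * (K * M `^ q))%:E)%E].
Proof.
have [s [K [s0 K0 hK]]] := kernel_op_weighted d0 mkap kap_le halpha p1 q1 pq.
exists s, K; split => // f M eta fp M0 fM eta0.
have [mf _] := fp; have mB := @measurable_unit_ball R d.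
have mg := measurable_normc_powR q (measurable_kernel_op mkap mf).
have mw : measurable_fun setT (fun z : Cd => (bdist z `^ (- (s * q)))).
  by apply: (measurableT_comp (measurable_powR _)); exact: measurable_bdist.
have mE : measurable [set z : Cd | bdist z <= eta].
  by apply: measurable_ler_set => //; exact: measurable_bdist.
rewrite EFinM; apply: le_trans (lee_wpmul2l _ (hK f M fp M0 fM)); last by rewrite lee_fin powR_ge0.
have mi : measurable_fun setT (fun z => (bdist z `^ (- (s * q)) * normc (kernel_op kap f z) `^ q)%:E).
  by apply/measurable_EFinP; apply: measurable_funM => //; exact/measurable_EFinP.
rewrite -ge0_integralZl; last 4 first.
- by [].
- exact: measurable_funTS.
- by move=> z _; rewrite lee_fin mulr_ge0// powR_ge0.
- by rewrite lee_fin powR_ge0.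
rewrite [leLHS]integral_mkcond [leRHS]integral_mkcond; apply: ge0_le_integral => //.
- by move=> z _; rewrite patchE; case: ifPn => // _; rewrite lee_fin powR_ge0.
- by apply/(measurable_restrictT _ mE); exact: measurable_funTS.
- by apply/(measurable_restrictT _ mB); apply: measurable_funTS; exact: measurable_funeM.
move=> z _; rewrite !patchE; case: ifPn => [|_]; last first.
  by case: ifPn => // _; rewrite -EFinM lee_fin !mulr_ge0// powR_ge0.
rewrite inE => ze; case: ifPn => [|/negP nBz].
  rewrite inE => /unit_ballP z0; rewrite -EFinM lee_fin mulrA ler_peMl ?powR_ge0//.
  rewrite powRN ler_pdivlMr ?powR_gt0// mul1r; apply: ge0_ler_powR.
  - by rewrite mulr_ge0// ltW.
  - by rewrite nnegrE ltW.
  - by rewrite nnegrE ltW.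
  - exact: ze.
by rewrite kernel_op_out ?normc0 ?powR0 ?gt_eqF// => Bz; apply: nBz; rewrite inE.
Qed.

(** The case eta = 1 of the tail estimate, as bdist <= 1 everywhere. *)
Lemma kernel_op_norm_le : exists2 C : R, 0 < C & forall (f : Cd -> R[i]) (M : R),
  cLfun v p%:E f -> 0 < M -> (cLnorm v p%:E f <= M%:E)%E ->
  (cLnorm v q%:E (kernel_op kap f) <= (C * M)%:E)%E.
Proof.
have [s [K [s0 K0 hK]]] := kernel_op_tail.
exists (K `^ q^-1); first exact: powR_gt0.
move=> f M fp M0 fM; apply/cLnorm_leP => //.
  by rewrite mulr_ge0 ?powR_ge0// ltW.
rewrite powRM ?powR_ge0 ?(ltW M0)// -powRrM mulVf ?gt_eqF// powRr1 ?(ltW K0)//.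
have := hK f M 1 fp M0 fM ltr01; rewrite powR1 mul1r; apply: le_trans.
rewrite le_eqVlt; apply/orP; left; apply/eqP; congr integral.
by apply/seteqP; split => // z _; exact: bdist_le1.
Qed.

Lemma kernel_op_bounded : bounded_op v p%:E q%:E (kernel_op kap).
Proof.
have [C C0 hC] := kernel_op_norm_le; exists C => f fp.
have p0 : 0 < p := lt_le_trans ltr01 p1.
have [M M0 fM] := cLnorm_lty p0 fp.2.
have M10 : 0 < M + 1 by rewrite ltr_wpDl.
split.
  split; first by apply: (measurable_kernel_op mkap); have [] := fp.
  apply: (le_lt_trans (hC f (M + 1) fp M10 _)); last exact: ltry.
  by rewrite fM lee_fin lerDl.
(* The norm M of f may be 0, hence the positive bounds M + e / C and the limit e -> 0. *)
rewrite fM -EFinM; apply/lee_addgt0Pr => e e0.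
have h0 : 0 < M + e / C by rewrite ltr_wpDl// divr_gt0.
apply: (le_trans (hC f (M + e / C) fp h0 _)).
  by rewrite fM lee_fin lerDl divr_ge0// ltW.
by rewrite -EFinD lee_fin mulrDr [C * (e / C)]mulrC divfK// gt_eqF.
Qed.

End real_exponents.

Lemma kernel_op_sufficient (p q : \bar R) : (1 <= p)%E -> (1 <= q)%E ->
  [/\ (((d%:R + 2 - alpha)^-1)%:E < p)%E, (p < +oo)%E
         & (q^-1 > p^-1 + (alpha - (d%:R + 1))%:E)%E]
       \/ (p = +oo%E /\ (q < ((alpha - (d%:R + 1))^-1)%:E)%E) ->
  bounded_op v p q (kernel_op kap).
Proof.
move=> p1 q1 /(exponents_reduce p1 q1)[p0 [q0 [p01 q01 p0p -> pq0]]].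
by apply: (bounded_op_exponent (p := p0%:E) (q := q0%:E)) => //; exact: kernel_op_bounded.
Qed.

End sufficiency.

(** * Compactness *)

Section ultrafilter_compactness.
Variable R : realType.

(** A filter F on the closure of X is traded for an ultrafilter on X itself, finer than the traces
    on X of thickened members of F; its limit is a cluster point of F. *)
Lemma precompact_ultra (T : pseudoMetricType R) (X : set T) :
  (forall F : set_system T, UltraFilter F -> F X -> exists p : T, F --> p) -> precompact X.
Proof.
move=> hX; rewrite precompactE => F PF FX.
(* The closure of X is controlled through the sets of points of X that are
   e-close to a given member of F. *)
pose D := [set Ae : set T * R | F Ae.1 /\ 0 < Ae.2].
pose N (Ae : set T * R) := [set x | X x /\ exists2 y, Ae.1 y & ball y Ae.2 x].
have FN : ProperFilter (filter_from D N).
  apply: filter_from_proper.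
    apply: filter_from_filter; first by exists (setT, 1); split => //; exact: filterT.
    move=> [A e] [A' e'] [/= FA e0] [/= FA' e'0].
    exists (A `&` A', Num.min e e').
      by split => /=; [exact: filterI|rewrite lt_min e0].
    move=> x [Xx [y [Ay A'y]]] /= yx; split; split => //; exists y => //=;
      by apply: le_ball yx; rewrite ge_min lexx ?orbT.
  move=> [A e] [/= FA e0].
  have [y [Ay cXy]] := filter_ex (filterI FA FX).
  by have [x [Xx yx]] := cXy _ (nbhsx_ballx y e e0); exists x; split => //; exists y.
have [G [UG FG]] := ultraFilterLemma FN.
have GX : G X.
  by apply: FG; exists (setT, 1); [split => //; exact: filterT|move=> x []].
have [p Gp] := hX G UG GX; exists p; split.
  move=> U nU; have GU : G U by exact: Gp.
  by have [x []] := filter_ex (filterI GX GU); exists x.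
move=> A U FA /nbhs_ballP[e /= e0 eU].
have e20 : 0 < e / 2 by rewrite divr_gt0.
have GN : G (N (A, e / 2)) by apply: FG; exists (A, e / 2).
have Gb : G (ball p (e / 2)) by apply: Gp; exact: nbhsx_ballx.
have [x [[Xx [y Ay yx]] px]] := filter_ex (filterI GN Gb).
exists y; split => //; apply: eU; rewrite (splitr e).
by apply: ball_triangle px _; exact: ball_sym.
Qed.

(** The image filter has a cluster point in the compact segment, and for an ultrafilter a cluster
    point is a limit. *)
Lemma ultra_bounded_lim (T : Type) (F : set_system T) (h : T -> R) (C : R) :
  UltraFilter F -> F [set g | `|h g| <= C] -> exists l, forall e, 0 < e -> F [set g | `|h g - l| < e].
Proof.
move=> UF FC; have PF : ProperFilter (fmap h F) by exact: fmap_proper_filter.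
have FI : fmap h F `[- C, C]%classic.
  apply: (@filterS _ F _ _ (h @^-1` `[- C, C]%classic)) FC => g.
  by rewrite /= in_itv/= ler_norml.
have [l [_ cl]] := @segment_compact R (- C) C _ PF FI.
exists l => e e0; have [//|Fc] := in_ultra_setVsetC [set g | `|h g - l| < e] UF.
have Fc' : fmap h F [set x | ~ `|x - l| < e] by [].
have [x [xc /=]] := cl _ _ Fc' (nbhsx_ballx l e e0).
by rewrite /ball /= distrC.
Qed.

End ultrafilter_compactness.

Section grid.
Variables (R : realType) (d : nat).
Local Notation Cd := (d.-tuple R[i]).

Lemma ball_grid (e : R) : 0 < e -> exists (I : finType) (c : Cd -> I),
  forall z z', unit_ball z -> unit_ball z' -> c z = c z' ->
    \sum_(j < d) normc (tnth z j - tnth z' j) <= e.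
Proof.
(* Cells of side 1/N in 2 d real directions give a sum of at most 2 d / N <= e; d + 1 instead of d
   keeps N positive when d = 0. *)
move=> e0; pose N := 2 * (d.+1)%:R / e : R.
have N0 : 0 < N by rewrite divr_gt0// mulr_gt0.
pose m := (Num.truncn (N * 2)).
pose cc (x : R) : 'I_m.+1 := inord (Num.truncn (N * (x + 1))).
exists {ffun 'I_d -> 'I_m.+1 * 'I_m.+1},
  (fun z => [ffun j => (cc (complex.Re (tnth z j)), cc (complex.Im (tnth z j)))]).
have ccP x y : `|x| <= 1 -> `|y| <= 1 -> cc x = cc y -> `|x - y| <= N^-1.
  have tm u : `|u| <= 1 -> 0 <= N * (u + 1) /\ (Num.truncn (N * (u + 1)) < m.+1)%N.
    rewrite ler_norml => /andP[u1 u2].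
    have h : 0 <= N * (u + 1) by apply: mulr_ge0; lra.
    split => //; rewrite ltnS /m; apply: le_truncn; rewrite ler_wpM2l//; lra.
  move=> /tm[x0 xm] /tm[y0 ym] /(congr1 val) /=; rewrite !inordK// => e'.
  have /andP[x1 x2] := truncn_itv x0; have /andP[] := truncn_itv y0.
  rewrite -e' => y1 y2; rewrite -natr1 in x2 y2.
  have : `|N * (x + 1) - N * (y + 1)| <= 1.
    by rewrite ler_norml; move: x1 x2 y1 y2; set k := _%:R; move=> *; apply/andP; split; lra.
  rewrite -mulrBr opprD addrACA subrr addr0 normrM (gtr0_norm N0).
  by rewrite -ler_pdivlMl// mulr1.
move=> z z' Bz Bz' /ffunP h.
apply: (@le_trans _ _ (\sum_(j < d) (2 * N^-1))).
  apply: ler_sum => j _; have := h j; rewrite !ffunE => -[hR hI].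
  apply: (le_trans (normc_le_ReIm _)); rewrite ReD ImD ReN ImN mulr_natl mulr2n.
  have b (u : Cd) : unit_ball u -> `|complex.Re (tnth u j)| <= 1 /\ `|complex.Im (tnth u j)| <= 1.
    move=> Bu; have := coord_le1 j Bu => u1.
    by split; apply: le_trans u1; [exact: Re_le_normc|exact: Im_le_normc].
  have [zR zI] := b _ Bz; have [zR2 zI2] := b _ Bz'.
  by apply: lerD; exact: ccP.
rewrite sumr_const card_ord -[X in X <= _]mulr_natl.
have -> : N^-1 = e / (2 * (d.+1)%:R) by rewrite /N invf_div.
have d1 : 0 < d.+1%:R :> R by rewrite ltr0n.
have -> : d%:R * (2 * (e / (2 * d.+1%:R))) = e * (d%:R / d.+1%:R).
  by field; rewrite gt_eqF.
by rewrite ler_piMr ?(ltW e0)// ler_pdivrMr// mul1r ler_nat.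
Qed.

End grid.

Section compactness.
Variables (R : realType) (d : nat).
Hypothesis d0 : (0 < d)%N.
Local Notation Cd := (d.-tuple R[i]).
Local Notation v := (ball_measure R d).
Local Notation B := (@unit_ball R d).
Variables (kap : R[i] -> R[i]) (alpha : R).
Hypothesis mkap : measurable_fun setT kap.
Hypothesis kap_le : forall u, 0 < complex.Re u -> normc (kap u) <= normc u `^ (- alpha).
Hypothesis halpha : d%:R + 1 < alpha < d%:R + 2.
Hypothesis kap_lip : forall c : R, 0 < c -> exists2 L, 0 <= L & forall u w,
  c <= complex.Re u -> c <= complex.Re w -> normc u <= 2 -> normc w <= 2 ->
  normc (kap u - kap w) <= L * normc (u - w).

Lemma Rintegral_dist_le (h1 h2 g : Cd -> R) (e M : R) :
  v.-integrable B (EFin \o h1) -> v.-integrable B (EFin \o h2) ->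
  measurable_fun setT g -> (forall w, 0 <= g w) -> 0 <= e ->
  (\int[v]_w (g w)%:E <= M%:E)%E -> (forall w, B w -> `|h1 w - h2 w| <= e * g w) ->
  `|\int[v]_(w in B) h1 w - \int[v]_(w in B) h2 w| <= e * M.
Proof.
move=> i1 i2 mg g0 e0 gM hh; have mB := @measurable_unit_ball R d.
rewrite -RintegralB// -lee_fin; apply: (le_trans (abse_fine_le _)).
have mh : measurable_fun B (fun w => (h1 w - h2 w)%:E).
  have /integrableP[m1 _] := i1; have /integrableP[m2 _] := i2.
  by apply/measurable_EFinP; apply: measurable_funB; exact/measurable_EFinP.
apply: (le_trans (le_abse_integral _ mB mh)).
rewrite EFinM; apply: le_trans (lee_wpmul2l _ gM); last by rewrite lee_fin.
rewrite -ge0_integralZl; last 4 first.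
- by [].
- exact/measurable_EFinP.
- by move=> w _; rewrite lee_fin.
- by rewrite lee_fin.
apply: (@le_trans _ _ (\int[v]_(w in B) (e%:E * (g w)%:E))%E).
  apply: ge0_le_integral => //.
  - exact: measurableT_comp.
  - by apply: measurable_funTS; apply: measurable_funeM; exact/measurable_EFinP.
apply: ge0_subset_integral => //.
  by apply: measurable_funeM; exact/measurable_EFinP.
by move=> w _; rewrite mule_ge0 ?lee_fin.
Qed.

(** If bdist z >= eta, then Re (1 - <z,w>) >= eta / 2 for every w of the ball, a region where [kap]
    is Lipschitz; the constant is thus uniform in f once the L^1 norm is bounded. *)
Lemma kernel_op_equicontinuous (eta : R) : 0 < eta -> exists2 L, 0 <= L &
  forall (f : Cd -> R[i]) (M : R), measurable_fun setT f ->
  (\int[v]_w (normc (f w))%:E <= M%:E)%E ->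
  forall z z', eta <= bdist z -> eta <= bdist z' ->
  normc (kernel_op kap f z - kernel_op kap f z') <= L * M * \sum_(j < d) normc (tnth z j - tnth z' j).
Proof.
move=> eta0; have [|L L0 hL] := kap_lip (c := eta / 2); first by rewrite divr_gt0.
exists (2 * L); first by rewrite mulr_ge0.
move=> f M mf fM z z' ze ze'.
have fi : integrable_c f by split => //; apply: le_lt_trans fM _; exact: ltry.
have Bz : B z by apply/unit_ballP; exact: lt_le_trans ze.
have Bz' : B z' by apply/unit_ballP; exact: lt_le_trans ze'.
set D := \sum_(j < d) _.
have D0 : 0 <= D by apply: sumr_ge0 => j _; exact: normc_ge0.
have kk w : B w -> normc (kap (1 - hdot z w) - kap (1 - hdot z' w)) <= L * D.
  move=> Bw; have w0 : 0 < bdist w by exact/unit_ballP.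
  have n2 y : B y -> normc (1 - hdot y w) <= 2.
    move=> By; apply: (le_trans (le_normcD _ _)); rewrite normcN normc1.
    by have := normc_hdot_le1 By Bw; lra.
  have rg y : eta <= bdist y -> eta / 2 <= complex.Re (1 - hdot y w).
    by move=> ye; have := Re_1hdot_ge y w; lra.
  apply: (le_trans (hL _ _ (rg _ ze) (rg _ ze') (n2 _ Bz) (n2 _ Bz'))).
  apply: ler_wpM2l => //; rewrite (_ : _ - _ = - (hdot z w - hdot z' w)); last by ring.
  by rewrite normcN; exact: normc_hdotBl.
have bnd w : B w -> normc (f w * kap (1 - hdot z w) - f w * kap (1 - hdot z' w)) <= L * D * normc (f w).
  by move=> Bw; rewrite -mulrBr normcM mulrC ler_wpM2r ?normc_ge0//; exact: kk.
have [iR iI] := integrable_integrand mkap kap_le Bz fi.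
have [iR' iI'] := integrable_integrand mkap kap_le Bz' fi.
have mg := measurable_normc_comp mf.
have LD : 0 <= L * D by exact: mulr_ge0.
have g0 w : 0 <= normc (f w) by exact: normc_ge0.
apply: (le_trans (normc_le_ReIm _)).
rewrite /kernel_op !mem_set// ReD ImD ReN ImN /cintegral/=.
have -> : 2 * L * M * D = L * D * M + L * D * M by ring.
apply: lerD; apply: (Rintegral_dist_le (g := fun w => normc (f w))) => // w Bw; apply: le_trans (bnd w Bw).
  by rewrite -ReN -ReD Re_le_normc.
by rewrite -ImN -ImD Im_le_normc.
Qed.

(** The shift of the kernel by s = alpha leaves the exponent 0, that is, a factor at most 1. The
    constant depends on z. *)
Lemma kernel_op_pointwise (z : Cd) : exists C : R, forall (f : Cd -> R[i]) (M : R),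
  measurable_fun setT f -> 0 <= M -> (\int[v]_w (normc (f w))%:E <= M%:E)%E ->
  normc (kernel_op kap f z) <= C * M.
Proof.
have [Bz|nBz] := pselect (B z); last first.
  by exists 0 => f M _ _ _; rewrite kernel_op_out// normc0 mul0r.
have /andP[al1 al2] := halpha; have d1 : 0 <= d%:R :> R by [].
have a0 : 0 <= alpha by lra.
pose C := 2 `^ alpha * bdist z `^ (- alpha).
have C0 : 0 <= C by rewrite mulr_ge0// powR_ge0.
exists (2 * C) => f M mf M0 fM; rewrite -lee_fin.
apply: (le_trans (normc_kernel_op_le mkap kap_le z mf)).
rewrite -mulrA EFinM; apply: lee_wpmul2l; first by rewrite lee_fin.
rewrite EFinM; apply: le_trans (lee_wpmul2l _ fM); last by rewrite lee_fin.
have mg := measurable_normc_comp mf.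
rewrite -ge0_integralZl; last 4 first.
- by [].
- exact/measurable_EFinP.
- by move=> w _; rewrite lee_fin normc_ge0.
- by rewrite lee_fin.
apply: ge0_le_integral => //.
- by move=> w _; rewrite lee_fin mulr_ge0 ?normc_ge0 ?ball_kernel_ge0.
- by apply/measurable_EFinP; apply: measurable_funM => //; exact: measurable_ball_kernel_l.
- by apply: measurable_funeM; exact/measurable_EFinP.
move=> w _; rewrite -EFinM lee_fin mulrC ler_wpM2r ?normc_ge0//.
apply: (le_trans (ball_kernel_shift alpha w Bz a0)); rewrite -/C -[leRHS]mulr1 ler_wpM2l//.
rewrite subrr /ball_kernel oppr0 powRr0 mulr1 !indicE.
by case: (_ \in _); case: (_ \in _); rewrite ?(mulr0, mulr1, mul0r)//.
Qed.

Lemma powR_add_le (x y q : R) : 0 <= x -> 0 <= y -> 0 <= q ->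
  (x + y) `^ q <= 2 `^ q * (x `^ q + y `^ q).
Proof.
move=> x0 y0 q0; have m0 : 0 <= Num.max x y by rewrite le_max x0.
apply: (@le_trans _ _ ((2 * Num.max x y) `^ q)).
  apply: ge0_ler_powR; rewrite ?nnegrE ?mulr_ge0 ?addr_ge0//.
  by rewrite mulr_natl mulr2n lerD// le_max lexx ?orbT.
rewrite powRM// ler_wpM2l ?powR_ge0//.
by case: (leP x y) => _; rewrite ?lerDl ?lerDr powR_ge0.
Qed.

Section limit.
Variables p q : R.
Hypothesis p1 : 1 <= p.
Hypothesis q1 : 1 <= q.
Hypothesis pq : p^-1 + (alpha - (d%:R + 1)) < q^-1.
Hypothesis hq : (1 <= q%:E)%E.
Local Notation LT := (cLfunType v hq).
Variables (A : set (Cd -> R[i])) (M : R).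
Hypothesis M0 : 0 < M.
Hypothesis AM : forall f, A f -> cLfun v p%:E f /\ (cLnorm v p%:E f <= M%:E)%E.
Let X := [set g : LT | exists2 f, A f & g = kernel_op kap f :> (Cd -> R[i])].
Variable F : set_system LT.
Hypothesis UF : UltraFilter F.
Hypothesis FX : F X.

Let q0 : 0 < q := lt_le_trans ltr01 q1.

Let A1 f : A f -> measurable_fun setT f /\ (\int[v]_w (normc (f w))%:E <= M%:E)%E.
Proof.
move=> /AM[[mf fp] fM]; split => //; apply: le_trans fM.
have p1' : (1 <= p%:E)%E by rewrite lee_fin.
apply: le_trans (cLnorm_le_exponent v (lexx 1%E) p1' mf).
rewrite le_eqVlt; apply/orP; left; apply/eqP.
rewrite /cLnorm Lnorm1; apply: eq_integral => w _ /=.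
by rewrite ger0_norm ?normc_ge0.
Qed.

(** At each z the values of the members of X are bounded, so their real and imaginary parts converge
    along the ultrafilter. *)
Let pointwise_limit : exists G : Cd -> R[i], (forall z, ~ B z -> G z = 0) /\
  forall z e, 0 < e -> F [set g : LT | normc (g z - G z) < e].
Proof.
suff H z : exists l : R[i], (~ B z -> l = 0) /\ forall e, 0 < e -> F [set g : LT | normc (g z - l) < e].
  have [G hG] := choice H; exists G; split => [z|z e e0]; first by have [] := hG z.
  by have [_] := hG z; apply.
have [Bz|nBz] := pselect (B z); last first.
  exists 0; split => // e e0; apply: filterS FX => g [f Af gE] /=.
  by rewrite gE kernel_op_out// subrr normc0.
have [C hC] := kernel_op_pointwise z.
have bnd : F [set g : LT | normc (g z) <= C * M].
  apply: filterS FX => g [f Af gE] /=; rewrite gE.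
  by have [mf fM] := A1 Af; apply: hC => //; exact: ltW.
have [lR hR] : exists l, forall e, 0 < e -> F [set g : LT | `|complex.Re (g z) - l| < e].
  apply: (ultra_bounded_lim (C := C * M)) UF _.
  by apply: filterS bnd => g /=; apply: le_trans; exact: Re_le_normc.
have [lI hI] : exists l, forall e, 0 < e -> F [set g : LT | `|complex.Im (g z) - l| < e].
  apply: (ultra_bounded_lim (C := C * M)) UF _.
  by apply: filterS bnd => g /=; apply: le_trans; exact: Im_le_normc.
exists (Complex lR lI); split => // e e0; have e20 : 0 < e / 2 by rewrite divr_gt0.
apply: filterS (filterI (hR _ e20) (hI _ e20)) => g [/= gR gI].
apply: le_lt_trans (normc_le_ReIm _) _; rewrite ReD ImD ReN ImN/= (splitr e).
exact: ltrD.
Qed.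

(** The argument of Ascoli: convergence at one representative of each of finitely many cells, and
    equicontinuity inside the cells. *)
Let uniform_limit (G : Cd -> R[i]) (eta e : R) :
  (forall z e, 0 < e -> F [set g : LT | normc (g z - G z) < e]) ->
  0 < eta -> 0 < e -> F [set g : LT | X g /\ forall z, eta <= bdist z -> normc (g z - G z) <= e].
Proof.
move=> hG eta0 e0; have [L L0 hL] := kernel_op_equicontinuous eta0.
have e40 : 0 < e / 8 by rewrite divr_gt0.
have LM : 0 < L * M + 1 by rewrite ltr_wpDl// mulr_ge0// ltW.
have [I [c hc]] := @ball_grid R d (e / 8 / (L * M + 1)) (divr_gt0 e40 LM).
have eqc (g : LT) z z' : X g -> eta <= bdist z -> eta <= bdist z' -> c z = c z' ->
    normc (g z - g z') <= e / 8.
  move=> [f Af ->] ze ze' cz; have [mf fM] := A1 Af.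
  apply: (le_trans (hL f M mf fM z z' ze ze')).
  have Bz : B z by apply/unit_ballP; exact: lt_le_trans ze.
  have Bz' : B z' by apply/unit_ballP; exact: lt_le_trans ze'.
  have h := hc z z' Bz Bz' cz.
  have LM0 : 0 <= L * M by rewrite mulr_ge0// ltW.
  apply: (le_trans (ler_wpM2l LM0 h)).
  rewrite mulrCA -[leRHS]mulr1 ler_wpM2l ?(ltW e40)// ler_pdivrMr// mul1r lerDl//.
(* Cells without a point at bdist >= eta receive the default [point], where pointwise convergence
   holds as well. *)
pose rep (i : I) : Cd := xget point [set z | c z = i /\ eta <= bdist z].
have repP z : eta <= bdist z -> c (rep (c z)) = c z /\ eta <= bdist (rep (c z)).
  by move=> ze; apply: (@xgetPex _ point [set y | c y = c z /\ eta <= bdist y]); exists z.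
have Frep : F [set g : LT | forall i, normc (g (rep i) - G (rep i)) < e / 8].
  by apply: (@filter_forall LT I (fun i g => normc (g (rep i) - G (rep i)) < e / 8)) => i; exact: hG.
apply: filterS (filterI FX Frep) => g [Xg gr]; split => // z ze.
have [cr er] := repP z ze; set y := rep (c z) in cr er.
have tri (x1 x2 x3 x4 : R[i]) :
    normc (x1 - x4) <= normc (x1 - x2) + normc (x2 - x3) + normc (x3 - x4).
  have -> : x1 - x4 = (x1 - x2) + (x2 - x3) + (x3 - x4) by ring.
  by rewrite (le_trans (le_normcD _ _))// lerD2r le_normcD.
(* Equicontinuity is known for members of X, not for G: some h of X, chosen after z and close to G
   at both y and z, carries it over. The total is 5 e / 8. *)
have [h [[Xh hr] hz]] := filter_ex (filterI (filterI FX Frep) (hG z _ e40)).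
have k1 := eqc h y z Xh er ze cr; have k2 := eqc g y z Xg er ze cr.
move: hz (hr (c z)) (gr (c z)); rewrite /= -/y => k3 k4 k5.
have t1 := tri (G y) (h y) (h z) (G z); have t2 := tri (g z) (g y) (G y) (G z).
move: t1 t2; rewrite (normcB (G y) (h y)) (normcB (g z) (g y)); lra.
Qed.

(** Substitute for Fatou's lemma along F. On each set n.+1^-1 <= bdist <= eta some g in X is
    uniformly within tau^(1/q) of G, which costs at most tau because the total mass is 1; monotone
    convergence then exhausts the shell. *)
Let shell_integral_le (G : Cd -> R[i]) (eta tau : R) :
  measurable_fun setT G ->
  (forall z e, 0 < e -> F [set g : LT | normc (g z - G z) < e]) ->
  0 < tau ->
  (forall g : LT, X g -> (\int[v]_(z in [set z | (bdist z <= eta)%R]) (normc (g z) `^ q)%:E <= tau%:E)%E) ->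
  (\int[v]_(z in [set z | (0 < bdist z <= eta)%R]) (normc (G z) `^ q)%:E <= (2 `^ q * (tau + tau))%:E)%E.
Proof.
move=> mG hG tau0 htau.
pose E n := [set z : Cd | n.+1%:R^-1 <= bdist z <= eta].
have mb := @measurable_bdist R d.
have mI a : measurable [set z : Cd | a <= bdist z <= eta].
  rewrite [X in measurable X](_ : _ = [set z : Cd | a <= bdist z] `&` [set z : Cd | bdist z <= eta]).
    by apply: measurableI; exact: measurable_ler_set.
  by apply/seteqP; split => x /= => [/andP[]|[-> ->]].
have mGq := measurable_normc_powR q mG.
have EU : \bigcup_n E n = [set z : Cd | 0 < bdist z <= eta].
  apply/seteqP; split => z /=.
    move=> [n _ /andP[n1 n2]]; rewrite n2 andbT; apply: lt_le_trans n1.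
    by rewrite invr_gt0 ltr0n.
  move=> /andP[z0 ze]; have [N _ hN] := near_infty_natSinv_lt (PosNum z0).
  by exists N => //; rewrite /E /= ze andbT ltW//; exact: (hN N (leqnn N)).
rewrite -EU.
have cv := @ge0_nondecreasing_set_cvg_integral _ _ R E (fun z => (normc (G z) `^ q)%:E) v.
have ndE : nondecreasing_seq E.
  move=> m n mn; apply/subsetPset => z /andP[z1 z2]; apply/andP; split => //.
  by apply: le_trans z1; rewrite lef_pV2 ?posrE ?ltr0n// ler_nat.
have {}cv := cv ndE (fun n => mI _) (fun n => measurable_funTS mGq) _.
have {}cv : ((\int[v]_(x in E i) (normc (G x) `^ q)%:E)%E @[i --> \oo] -->
    (\int[v]_(x in \bigcup_i E i) (normc (G x) `^ q)%:E)%E).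
  by apply: cv => n z _; rewrite lee_fin powR_ge0.
rewrite -(cvg_lim _ cv)//; apply: lime_le; first by apply/cvg_ex; eexists; exact: cv.
apply: nearW => n.
pose e := tau `^ q^-1; have e0 : 0 < e by exact: powR_gt0.
have eq : e `^ q = tau by rewrite /e -powRrM mulVf ?gt_eqF// powRr1// ltW.
have n0 : 0 < n.+1%:R^-1 :> R by rewrite invr_gt0 ltr0n.
have [g [Xg gG]] := filter_ex (uniform_limit hG n0 e0).
have mg : measurable_fun setT g by have [] := clfunP g.
have mgq := measurable_normc_powR q mg.
apply: (@le_trans _ _ (\int[v]_(z in E n) ((2 `^ q)%:E * ((normc (g z) `^ q)%:E + tau%:E)))%E).
  apply: ge0_le_integral => //.
  - exact: mI.
  - by move=> z _; rewrite lee_fin powR_ge0.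
  - exact: measurable_funTS.
  - by apply: measurable_funTS; apply: measurable_funeM; exact: emeasurable_funD.
  move=> z /andP[z1 _]; rewrite -EFinD -EFinM lee_fin -eq.
  apply: le_trans (powR_add_le (normc_ge0 _) (ltW e0) (ltW q0)).
  apply: ge0_ler_powR; rewrite ?nnegrE ?normc_ge0 ?addr_ge0 ?normc_ge0 ?(ltW e0) ?(ltW q0)//.
  have -> : G z = g z - (g z - G z) by ring.
  by rewrite (le_trans (le_normcD _ _))// normcN lerD2l gG.
have mg2 : measurable_fun (E n) (fun z => (normc (g z) `^ q)%:E + tau%:E)%E.
  by apply: measurable_funTS; exact: emeasurable_funD.
rewrite ge0_integralZl; last 4 first.
- exact: mI.
- by [].
- by move=> z _; rewrite -EFinD lee_fin addr_ge0 ?powR_ge0// ltW.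
- by rewrite lee_fin powR_ge0.
rewrite EFinM; apply: lee_wpmul2l; first by rewrite lee_fin powR_ge0.
rewrite ge0_integralD//; last 4 first.
- exact: mI.
- by move=> z _; rewrite lee_fin powR_ge0.
- exact: measurable_funTS.
- by move=> z _; rewrite lee_fin ltW.
rewrite EFinD; apply: leeD.
  apply: le_trans (htau g Xg); apply: ge0_subset_integral => //.
  - exact: mI.
  - by apply: measurable_ler_set.
  - exact: measurable_funTS.
  - by move=> z _; rewrite lee_fin powR_ge0.
  - by move=> z /andP[].
rewrite integral_cst; last exact: mI.
rewrite -[leRHS]mule1; apply: lee_wpmul2l; first by rewrite lee_fin ltW.
by apply: probability_le1; exact: mI.
Qed.

Lemma kernel_op_ultra_cvg : exists G : LT, F --> G.
Proof.
have [G0 [Gout hG]] := pointwise_limit.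
have [s [K [s0 K0 hK]]] := kernel_op_tail d0 mkap kap_le halpha p1 q1 pq.
pose tau eta := eta `^ (s * q) * (K * M `^ q).
have KM : 0 < K * M `^ q by rewrite mulr_gt0// powR_gt0.
have tau0 eta : 0 < eta -> 0 < tau eta by move=> e0; rewrite mulr_gt0// powR_gt0.
have htau eta (g : LT) : 0 < eta -> X g ->
    (\int[v]_(z in [set z | (bdist z <= eta)%R]) (normc (g z) `^ q)%:E <= (tau eta)%:E)%E.
  by move=> e0 [f Af ->]; have [fp fM] := AM Af; exact: hK.
have X0 (g : LT) z : X g -> ~ B z -> g z = 0.
  by move=> [f Af ->] nBz; rewrite kernel_op_out.
(* A pointwise limit along an ultrafilter need not be measurable; a sequence of members of X
   converging pointwise to G0 is extracted from the uniform limits. *)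
have /choice[gs hgs] : forall n : nat, exists g : LT, X g /\
    forall z, n.+1%:R^-1 <= bdist z -> normc (g z - G0 z) <= n.+1%:R^-1.
  move=> n; have n0 : 0 < n.+1%:R^-1 :> R by rewrite invr_gt0 ltr0n.
  exact: (filter_ex (uniform_limit hG n0 n0)).
have mgs n : measurable_fun setT (gs n) by have [] := clfunP (gs n).
have cvgs z e : 0 < e -> \forall n \near \oo, normc (gs n z - G0 z) <= e.
  move=> e0; have [/unit_ballP z0|nBz] := pselect (B z); last first.
    by apply: nearW => n; rewrite Gout// X0 ?subrr ?normc0 ?(ltW e0)//; have [] := hgs n.
  near=> n; have [_ h] := hgs n; apply: (le_trans (h z _)).
    by apply: ltW; near: n; exact: (near_infty_natSinv_lt (PosNum z0)).
  by apply: ltW; near: n; exact: (near_infty_natSinv_lt (PosNum e0)).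
have mG : measurable_fun setT G0.
  apply/measurable_complexP; split.
    apply: (measurable_fun_cvg (h := fun n z => complex.Re (gs n z))) => [n|z _].
      exact: measurable_Re.
    apply/cvgrPdist_le => e e0; apply: filterS (cvgs z e e0) => n; apply: le_trans.
    by rewrite distrC -ReN -ReD Re_le_normc.
  apply: (measurable_fun_cvg (h := fun n z => complex.Im (gs n z))) => [n|z _].
    exact: measurable_Im.
  apply/cvgrPdist_le => e e0; apply: filterS (cvgs z e e0) => n; apply: le_trans.
  by rewrite distrC -ImN -ImD Im_le_normc.
have mGq := measurable_normc_powR q mG.
have Gtau eta : 0 < eta ->
    (\int[v]_(z in [set z | (0 < bdist z <= eta)%R]) (normc (G0 z) `^ q)%:E
       <= (2 `^ q * (tau eta + tau eta))%:E)%E.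
  by move=> e0; apply: shell_integral_le => // [|g Xg]; [exact: tau0|exact: htau].
have GL : cLfun v q%:E G0.
  split => //; apply: (@le_lt_trans _ _ ((2 `^ q * (tau 1 + tau 1)) `^ q^-1)%:E); last exact: ltry.
  have c0 : 0 <= 2 `^ q * (tau 1 + tau 1).
    by rewrite mulr_ge0 ?powR_ge0// addr_ge0// ltW// tau0.
  apply/cLnorm_leP => //; first exact: powR_ge0.
  rewrite -powRrM mulVf ?gt_eqF// powRr1//; apply: le_trans (Gtau 1 ltr01).
  rewrite le_eqVlt; apply/orP; left; apply/eqP; rewrite [RHS]integral_mkcond.
  apply: eq_integral => z _; rewrite patchE; case: ifPn => // /negP nz.
  rewrite Gout ?normc0 ?powR0 ?gt_eqF// => /unit_ballP z0; apply: nz.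
  by rewrite inE /= z0 bdist_le1.
exists (CLfun hq GL); apply/cvg_ballP => e e0.
pose e' := e / 2; have e'0 : 0 < e' by rewrite divr_gt0.
(* On the shell |g - G0|^q <= 2^q (|G0|^q + |g|^q), with integrals at most 2^q (2 tau) for G0 and
   tau for g: hence c. Then eta makes c tau equal to half of e'^q, and e1 leaves the other half to
   the uniform part. *)
pose c := 2 `^ q * (2 `^ q * 2 + 1) : R.
have c0 : 0 < c by rewrite mulr_gt0 ?powR_gt0// addr_gt0// mulr_gt0// powR_gt0.
pose eta := (e' `^ q / 2 / (c * (K * M `^ q))) `^ (s * q)^-1.
have sq0 : 0 < s * q by exact: mulr_gt0.
have eq0 : 0 < e' `^ q / 2 by rewrite divr_gt0// powR_gt0.
have eta0 : 0 < eta by rewrite powR_gt0// divr_gt0// mulr_gt0.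
have etaE : c * tau eta = e' `^ q / 2.
  rewrite /tau /eta -powRrM mulVf ?gt_eqF// powRr1; last first.
    by rewrite ltW// divr_gt0// mulr_gt0.
  by field; rewrite !gt_eqF ?powR_gt0//.
pose e1 := (e' `^ q / 2) `^ q^-1; have e10 : 0 < e1 by exact: powR_gt0.
have e1E : e1 `^ q = e' `^ q / 2 by rewrite /e1 -powRrM mulVf ?gt_eqF// powRr1// ltW.
apply: filterS (uniform_limit hG eta0 e10) => g [Xg gG].
rewrite /ball /=; apply: (@le_lt_trans _ _ e'%:E); last by rewrite lte_fin /e' ltr_pdivrMr//; lra.
have mg : measurable_fun setT g by have [] := clfunP g.
have mgq := measurable_normc_powR q mg.
apply/cLnorm_leP => //; first exact: ltW.
pose D := [set z : Cd | 0 < bdist z <= eta].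
have mD : measurable D.
  rewrite /D [X in measurable X](_ : _ = [set z : Cd | 0 < bdist z] `&` [set z : Cd | bdist z <= eta]).
    by apply: measurableI; [apply: measurable_ltr_set|apply: measurable_ler_set] => //; exact: measurable_bdist.
  by apply/seteqP; split => x /= => [/andP[]|[-> ->]].
pose H z : \bar R := ((2 `^ q)%:E * ((normc (G0 z) `^ q)%:E + (normc (g z) `^ q)%:E))%E.
have H0 z : (0 <= H z)%E.
  apply: mule_ge0; first by rewrite lee_fin powR_ge0.
  by rewrite -EFinD lee_fin addr_ge0 ?powR_ge0.
have mH : measurable_fun setT H by apply: measurable_funeM; exact: emeasurable_funD.
apply: (@le_trans _ _ (\int[v]_z ((e1 `^ q)%:E + (H \_ D) z))%E).
  apply: ge0_le_integral => //.
  - by move=> z _; rewrite lee_fin powR_ge0.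
  - by apply: measurable_normc_powR; exact: measurable_csub.
  - apply: emeasurable_funD => //; apply/(measurable_restrictT _ mD).
    exact: measurable_funTS.
  move=> z _; rewrite patchE; case: ifPn => [_|/negP nDz].
    apply: (@le_trans _ _ (H z)); last by rewrite leeDr// lee_fin powR_ge0.
    rewrite /H -EFinD -EFinM lee_fin.
    apply: le_trans (powR_add_le (normc_ge0 _) (normc_ge0 _) (ltW q0)).
    apply: ge0_ler_powR; rewrite ?nnegrE ?addr_ge0 ?normc_ge0 ?(ltW q0)//.
    by rewrite (le_trans (le_normcD _ _))// normcN.
  rewrite adde0 lee_fin; apply: ge0_ler_powR; rewrite ?nnegrE ?normc_ge0 ?(ltW q0) ?(ltW e10)//.
  have [/unit_ballP z0|nBz] := pselect (B z); last first.
    by rewrite /= Gout// (X0 g)// subrr normc0 ltW.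
  rewrite /= normcB; apply: gG; rewrite leNgt; apply/negP => /ltW ze; apply: nDz.
  by rewrite inE /D /= z0.
rewrite ge0_integralD; last 5 first.
- by [].
- by move=> z _; rewrite lee_fin powR_ge0.
- by [].
- by move=> z _; rewrite patchE; case: ifPn.
- by apply/(measurable_restrictT _ mD); exact: measurable_funTS.
rewrite (_ : e' `^ q = e1 `^ q + c * tau eta); last by rewrite e1E etaE; field.
rewrite EFinD; apply: leeD.
  rewrite integral_cst// -[leRHS]mule1; apply: lee_wpmul2l; first by rewrite lee_fin powR_ge0.
  exact: probability_le1.
rewrite -integral_mkcond ge0_integralZl; last 4 first.
- exact: mD.
- by apply: measurable_funTS; exact: emeasurable_funD.
- by move=> z _; rewrite -EFinD lee_fin addr_ge0 ?powR_ge0.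
- by rewrite lee_fin powR_ge0.
rewrite /c -mulrA EFinM; apply: lee_wpmul2l; first by rewrite lee_fin powR_ge0.
rewrite ge0_integralD; last 5 first.
- exact: mD.
- by move=> z _; rewrite lee_fin powR_ge0.
- exact: measurable_funTS.
- by move=> z _; rewrite lee_fin powR_ge0.
- exact: measurable_funTS.
rewrite (_ : (2 `^ q * 2 + 1) * tau eta = 2 `^ q * (tau eta + tau eta) + tau eta); last by ring.
rewrite EFinD; apply: leeD; first exact: Gtau.
apply: le_trans (htau eta g eta0 Xg); apply: ge0_subset_integral => //.
- by apply: measurable_ler_set => //; exact: measurable_bdist.
- exact: measurable_funTS.
- by move=> z _; rewrite lee_fin powR_ge0.
- by move=> z /andP[].
Unshelve. all: by end_near. Qed.

End limit.

Lemma kernel_op_compact (p q : \bar R) (p1 : (1 <= p)%E) (hq : (1 <= q)%E) :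
  [/\ (((d%:R + 2 - alpha)^-1)%:E < p)%E, (p < +oo)%E
         & (q^-1 > p^-1 + (alpha - (d%:R + 1))%:E)%E]
       \/ (p = +oo%E /\ (q < ((alpha - (d%:R + 1))^-1)%:E)%E) ->
  compact_op v p hq (kernel_op kap).
Proof.
move=> cond; have [C bC] := kernel_op_sufficient d0 mkap kap_le halpha p1 hq cond.
have [p0 [q0 [p01 q01 p0p qE pq0]]] := exponents_reduce halpha p1 hq cond.
split=> [f /bC[]//|A AL [M AM]]; subst q.
apply: precompact_ultra => F UF FX.
have M0 : 0 < `|M| + 1 by rewrite ltr_wpDl.
apply: (kernel_op_ultra_cvg p01 q01 pq0 M0 _ UF FX) => f Af.
have [mf fp] := AL f Af; have p01' : (1 <= p0%:E)%E by rewrite lee_fin.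
have h := cLnorm_le_exponent v p01' p0p mf.
split; first by split => //; exact: le_lt_trans fp.
apply: (le_trans h); apply: (le_trans (AM f Af)).
by rewrite lee_fin (le_trans (ler_norm M))// lerDl.
Qed.

End compactness.

(** * Random signs *)

Section random_signs.
Variables (R : realType) (I : finType).

Definition bool_sign (b : bool) : R := (-1) ^+ b.

Lemma normr_bool_sign b : `|bool_sign b| = 1.
Proof. by rewrite /bool_sign; case: b; rewrite ?expr1 ?normrN normr1. Qed.

(* Flipping the sign of index k pairs up sign vectors whose sums differ by
   2 a_k, so one of the two has modulus at least |a_k|. *)
Lemma sum_signs_ge (a : I -> R[i]) (q : R) (k : I) : 0 <= q ->
  #|{ffun I -> bool}|%:R / 2 * normc (a k) `^ q <=
  \sum_(e : {ffun I -> bool}) normc (\sum_i ((bool_sign (e i))%:C)%C * a i) `^ q.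
Proof.
move=> q0; pose X (e : {ffun I -> bool}) := \sum_i ((bool_sign (e i))%:C)%C * a i.
pose flip (e : {ffun I -> bool}) : {ffun I -> bool} := [ffun i => if i == k then ~~ e i else e i].
have flipK : involutive flip.
  by move=> e; apply/ffunP => i; rewrite !ffunE; case: (i == k); rewrite ?negbK.
have XX e : X e - X (flip e) = 2 * (((bool_sign (e k))%:C)%C * a k).
  rewrite /X (bigD1 k)//= [X in _ - X](bigD1 k)//= ffunE eqxx.
  have -> : \sum_(i | i != k) ((bool_sign (flip e i))%:C)%C * a i = \sum_(i | i != k) ((bool_sign (e i))%:C)%C * a i.
    by apply: eq_bigr => i ik; rewrite ffunE (negbTE ik).
  have -> : bool_sign (~~ e k) = - bool_sign (e k) by rewrite /bool_sign; case: (e k); rewrite ?expr0 ?expr1 ?opprK.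
  by rewrite rmorphN; ring.
have nX e : normc (a k) `^ q <= normc (X e) `^ q + normc (X (flip e)) `^ q.
  have h : 2 * normc (a k) <= normc (X e) + normc (X (flip e)).
    rewrite -[normc (X (flip e))]normcN; apply: le_trans (le_normcD _ _).
    by rewrite XX !normcM normc_real normr_bool_sign mul1r normcMn normc1.
  have [x|x] := leP (normc (a k)) (normc (X e)).
    rewrite -[leLHS]addr0; apply: lerD; last exact: powR_ge0.
    by apply: ge0_ler_powR; rewrite ?nnegrE ?normc_ge0.
  rewrite -[leLHS]add0r; apply: lerD; first exact: powR_ge0.
  by apply: ge0_ler_powR; rewrite ?nnegrE ?normc_ge0//; lra.
have S2 : \sum_e normc (X (flip e)) `^ q = \sum_e normc (X e) `^ q.
  by rewrite [RHS](reindex_inj (inv_inj flipK)).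
have : \sum_(e : {ffun I -> bool}) normc (a k) `^ q <= \sum_e (normc (X e) `^ q + normc (X (flip e)) `^ q).
  by apply: ler_sum.
rewrite big_split/= S2 sumr_const -[X in X <= _]mulr_natl.
rewrite -/X mulrAC ler_pdivrMr// mulr_natr mulr2n; apply.
Qed.

End random_signs.

Section sign_lower_bound.
Variables (R : realType) (d : nat).
Local Notation Cd := (d.-tuple R[i]).
Local Notation v := (ball_measure R d).
Local Notation B := (@unit_ball R d).
Variables (kap : R[i] -> R[i]) (alpha : R).
Hypothesis mkap : measurable_fun setT kap.
Hypothesis kap_le : forall u, 0 < complex.Re u -> normc (kap u) <= normc u `^ (- alpha).

Lemma kernel_op_sum (I : Type) (r : seq I) (c : I -> R) (F : I -> Cd -> R[i]) :
  (forall i, integrable_c (F i)) ->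
  integrable_c (fun w => \sum_(i <- r) ((c i)%:C)%C * F i w) /\
  kernel_op kap (fun w => \sum_(i <- r) ((c i)%:C)%C * F i w) =
  fun z => \sum_(i <- r) ((c i)%:C)%C * kernel_op kap (F i) z.
Proof.
move=> iF; elim: r => [|i r [IH1 IH2]].
  split.
    under eq_fun do rewrite big_nil.
    by split => //; under eq_integral do rewrite normc0; rewrite integral0.
  under eq_fun do rewrite big_nil.
  by apply/funext => z; rewrite big_nil kernel_op0.
split.
  under eq_fun do rewrite big_cons.
  have [mi ii] := iF i; have [mr ir] := IH1; split.
    by apply: measurable_cadd => //; apply: measurable_cmul.
  apply: (@le_lt_trans _ _ (\int[v]_w (`|c i|%:E * (normc (F i w))%:E +
     (normc (\sum_(i <- r) ((c i)%:C)%C * F i w))%:E))%E).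
    apply: ge0_le_integral => //.
    - by move=> w _; rewrite lee_fin normc_ge0.
    - apply/measurable_EFinP; apply: measurable_normc_comp.
      by apply: measurable_cadd => //; apply: measurable_cmul.
    - apply: emeasurable_funD; [apply: measurable_funeM|];
        by apply/measurable_EFinP; exact: measurable_normc_comp.
    by move=> w _; rewrite -EFinM -EFinD lee_fin (le_trans (le_normcD _ _))// normcM normc_real.
  rewrite ge0_integralD//; last 4 first.
  - by move=> w _; rewrite -EFinM lee_fin mulr_ge0// normc_ge0.
  - by apply: measurable_funeM; apply/measurable_EFinP; exact: measurable_normc_comp.
  - by move=> w _; rewrite lee_fin normc_ge0.
  - by apply/measurable_EFinP; exact: measurable_normc_comp.
  rewrite ge0_integralZl//; last 2 first.
  - by apply/measurable_EFinP; exact: measurable_normc_comp.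
  - by move=> w _; rewrite lee_fin normc_ge0.
  by apply: lte_add_pinfty => //; exact: lte_mul_pinfty.
under eq_fun do rewrite big_cons.
rewrite (kernel_op_linear mkap kap_le (c i) (iF i) IH1) IH2.
by apply/funext => z; rewrite big_cons.
Qed.

Variables (I : finType) (E : I -> set Cd) (c rho vol : I -> R) (c1 q : R).
Hypothesis q0 : 0 < q.
Hypothesis c10 : 0 < c1.
Hypothesis mE : forall i, measurable (E i).
Hypothesis EB : forall i, E i `<=` B.
Hypothesis dE : forall i j z, E i z -> E j z -> i = j.
Hypothesis c0 : forall i, 0 < c i.
Hypothesis rho0 : forall i, 0 < rho i.
Hypothesis volE : forall i, v (E i) = (vol i)%:E.
Hypothesis kapE : forall i z w, E i z -> E i w -> c1 * (2 * rho i) `^ (- alpha) <= complex.Re (kap (1 - hdot z w)).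

Let ind (i : I) (w : Cd) : R[i] := ((\1_(E i) w)%:C)%C.

Lemma vol_ge0 i : 0 <= vol i.
Proof. by rewrite -lee_fin -volE. Qed.

Let int_ind i : integrable_c (ind i).
Proof.
split.
  by apply/measurable_complexP; split => //=; exact: measurable_indic.
apply: (@le_lt_trans _ _ (\int[v]_w (cst 1%E w))%E).
  apply: ge0_le_integral => //.
  - by move=> w _; rewrite lee_fin normc_ge0.
  - apply/measurable_EFinP; apply: measurable_normc_comp.
    by apply/measurable_complexP; split => //=; exact: measurable_indic.
  by move=> w _; rewrite normc_real indicE lee_fin; case: (_ \in _); rewrite ?normr1 ?normr0.
rewrite integral_cst// mul1e; apply: le_lt_trans (probability_le1 _ _) _ => //.
exact: ltry.
Qed.

(** For z in E i the kernel has a real part bounded below on all of E i, so nothing cancels inside a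
    single box. *)
Let kernel_op_ind_ge i z : E i z -> c1 * (2 * rho i) `^ (- alpha) * vol i <= normc (kernel_op kap (ind i) z).
Proof.
move=> Ez; have Bz := EB Ez; have mB := @measurable_unit_ball R d.
have [iR _] := integrable_integrand mkap kap_le Bz (int_ind i).
rewrite (le_trans _ (Re_le_normc _))// (le_trans _ (ler_norm _))//.
rewrite /kernel_op mem_set// /cintegral/= -lee_fin /Rintegral fineK; last exact: integrable_fin_num.
set k0 := c1 * _; have k00 : 0 < k0 by rewrite mulr_gt0// powR_gt0// mulr_gt0.
have -> : (k0 * vol i)%:E = (\int[v]_(w in B) (k0%:E * (\1_(E i) w)%:E))%E.
  rewrite ge0_integralZl//; last 2 first.
  - by apply: measurable_funTS; apply/measurable_EFinP; exact: measurable_indic.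
  - by rewrite lee_fin ltW.
  by rewrite integral_indic// setIidl; [rewrite EFinM; congr (_ * _)%E; exact/esym/volE|exact: EB].
have mi := measurable_integrand_l mkap z (int_ind i).1.
apply: ge0_le_integral => //.
- by move=> w _; rewrite -EFinM lee_fin mulr_ge0// ltW.
- by apply: measurable_funTS; apply: measurable_funeM; apply/measurable_EFinP; exact: measurable_indic.
- by apply: measurable_funTS; apply/measurable_EFinP; exact: measurable_Re.
move=> w Bw; rewrite -EFinM lee_fin /ind ReM/= mul0r subr0 indicE.
have [Ew|nEw] := pselect (E i w); last by rewrite memNset// mulr0 mul0r.
by rewrite mem_set// mulr1 mul1r; exact: kapE.
Qed.

Let fs (e : {ffun I -> bool}) (w : Cd) : R[i] := \sum_i ((bool_sign R (e i) * c i)%:C)%C * ind i w.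

Lemma kernel_op_sign_fun e z :
  kernel_op kap (fs e) z = \sum_i ((bool_sign R (e i))%:C)%C * (((c i)%:C)%C * kernel_op kap (ind i) z).
Proof.
have [_ ->] := kernel_op_sum (index_enum I) (fun i => bool_sign R (e i) * c i) int_ind.
by apply: eq_bigr => i _; rewrite rmorphM mulrA.
Qed.

Lemma measurable_sign_fun e : measurable_fun setT (fs e).
Proof.
by have [[]] := kernel_op_sum (index_enum I) (fun i => bool_sign R (e i) * c i) int_ind.
Qed.

(** The sets E i being disjoint, the modulus does not depend on the signs: all the test functions
    have the same norm. *)
Lemma normc_sign_fun e w : normc (fs e w) = \sum_i c i * \1_(E i) w.
Proof.
have [[k Ek]|n] := pselect (exists k, E k w); last first.
  rewrite /fs !big1 ?normc0// => i _; rewrite /ind indicE memNset ?mulr0//;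
    by move=> Ei; apply: n; exists i.
have z i : i != k -> \1_(E i) w = 0 :> R.
  move=> ik; rewrite indicE memNset// => Ei; move: ik.
  by rewrite (dE Ei Ek) eqxx.
have -> : fs e w = ((bool_sign R (e k) * c k)%:C)%C * ind k w.
  by rewrite /fs (bigD1 k)//= big1 ?addr0// => i ik; rewrite /ind z// mulr0.
have -> : \sum_i c i * \1_(E i) w = c k * \1_(E k) w.
  by rewrite (bigD1 k)//= big1 ?addr0// => i ik; rewrite z// mulr0.
rewrite normcM /ind !normc_real normrM normr_bool_sign mul1r gtr0_norm// indicE mem_set//.
by rewrite normr1.
Qed.

(** A bound valid for every choice of signs holds for the average. At a point of E k the average of
    the q-th powers is at least half of that of the k-th term alone, whatever the other boxes
    contribute. *)
Lemma sign_lower_bound (Y : R) :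
  (forall e : {ffun I -> bool}, (\int[v]_z (normc (kernel_op kap (fs e) z) `^ q)%:E <= Y%:E)%E) ->
  2^-1 * \sum_i vol i * (c i * (c1 * (2 * rho i) `^ (- alpha) * vol i)) `^ q <= Y.
Proof.
move=> hY; pose m i := (c i * (c1 * (2 * rho i) `^ (- alpha) * vol i)) `^ q.
pose n : R := #|{ffun I -> bool}|%:R.
have n0 : 0 < n by rewrite ltr0n; apply/card_gt0P; exists [ffun => true].
have m0 i : 0 <= m i by exact: powR_ge0.
have mf e : measurable_fun setT (fun z => (normc (kernel_op kap (fs e) z) `^ q)%:E).
  by apply: measurable_normc_powR; apply: (measurable_kernel_op mkap); exact: measurable_sign_fun.
have H : ((n / 2 * \sum_i m i * vol i)%:E <= \sum_(e : {ffun I -> bool}) Y%:E)%E.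
  apply: (@le_trans _ _ (\sum_(e : {ffun I -> bool}) \int[v]_z (normc (kernel_op kap (fs e) z) `^ q)%:E)%E);
    last by apply: lee_sum => e _; exact: hY.
  rewrite -ge0_integral_sum//; last by move=> e z _; rewrite lee_fin powR_ge0.
  have -> : (n / 2 * \sum_i m i * vol i)%:E = (\int[v]_z (\sum_i ((n / 2 * m i)%:E * (\1_(E i) z)%:E)))%E.
    rewrite ge0_integral_sum//; last 2 first.
    - by move=> i; apply: measurable_funeM; apply/measurable_EFinP; exact: measurable_indic.
    - by move=> i z _; rewrite -EFinM lee_fin !mulr_ge0// ltW.
    rewrite mulr_sumr -sumEFin; apply: eq_bigr => i _.
    rewrite ge0_integralZl//; last 2 first.
    - by apply/measurable_EFinP; exact: measurable_indic.
    - by rewrite lee_fin mulr_ge0// mulr_ge0// ltW.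
    by rewrite integral_indic// setIT mulrA EFinM; congr (_ * _)%E; exact/esym/volE.
  apply: ge0_le_integral => //.
  - by move=> z _; apply: sume_ge0 => i _; rewrite -EFinM lee_fin !mulr_ge0// ltW.
  - by apply: emeasurable_sum => i; apply: measurable_funeM; apply/measurable_EFinP; exact: measurable_indic.
  - exact: emeasurable_sum.
  move=> z _; rewrite !sumEFin lee_fin.
  have [[k Ek]|nk] := pselect (exists k, E k z); last first.
    rewrite big1 ?sumr_ge0// => [e _|i _]; first exact: powR_ge0.
    by rewrite indicE memNset ?mulr0// => Ei; apply: nk; exists i.
  rewrite (bigD1 k)//= big1 ?addr0; last first.
    move=> i ik; rewrite indicE memNset ?mulr0// => Ei; move: ik.
    by rewrite (dE Ei Ek) eqxx.
  rewrite indicE mem_set// mulr1.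
  under eq_bigr do rewrite kernel_op_sign_fun.
  apply: le_trans (sum_signs_ge (fun i => ((c i)%:C)%C * kernel_op kap (ind i) z) k (ltW q0)).
  apply: ler_wpM2l; first by rewrite divr_ge0// ltW.
  rewrite normcM normc_real gtr0_norm//; apply: ge0_ler_powR.
  - exact: ltW.
  - by rewrite nnegrE !mulr_ge0 ?powR_ge0 ?vol_ge0// ltW.
  - by rewrite nnegrE mulr_ge0 ?normc_ge0// ltW.
  - by rewrite ler_wpM2l ?(ltW (c0 k))//; exact: kernel_op_ind_ge.
move: H; rewrite sumEFin lee_fin sumr_const -[X in _ <= X]mulr_natl -/n -mulrA ler_pM2l//.
by under eq_bigr do rewrite mulrC.
Qed.

End sign_lower_bound.

(** * Anisotropic boxes *)

Section anisotropic_boxes.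
Variables (R : realType) (d : nat).
Local Notation Cd := (d.-tuple R[i]).
Implicit Types a z w : Cd.

(* At a point a with 1 - |a|^2 = 4^-k, the box has size 2^-k in the complex
   tangential directions and 4^-k in the complex normal one. *)
Definition abox (eps : R) (k : nat) a : set Cd :=
  polydisc a (eps * 2^-1 ^+ k) `&`
  [set w | normc (\sum_(i < d) tnth w i * ((tnth a i)^*)%C - hdot a a) <= eps * 4^-1 ^+ k].

Lemma measurable_abox eps k a : measurable (abox eps k a).
Proof. exact: measurable_slab. Qed.

Lemma aboxP eps k a w : abox eps k a w <->
  (forall i, normc (tnth w i - tnth a i) <= eps * 2^-1 ^+ k) /\
  normc (hdot w a - hdot a a) <= eps * 4^-1 ^+ k.
Proof. by []. Qed.

Lemma hdot_self a : hdot a a = ((1 - bdist a)%:C)%C.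
Proof.
apply: complex_eq => /=.
  rewrite /bdist opprB addrC subrK Re_sum; apply: eq_bigr => j _.
  by rewrite ReM ReJ ImJ sqr_normc_ReIm; ring.
by rewrite Im_sum big1// => j _; rewrite ImM ReJ ImJ; ring.
Qed.

Lemma bdistE z : bdist z = complex.Re (1 - hdot z z).
Proof. by rewrite hdot_self ReD ReN/=; ring. Qed.

Lemma sqr_halfX k : (2^-1 ^+ k) ^+ 2 = 4^-1 ^+ k :> R.
Proof. by rewrite -exprM mulnC exprM; congr (_ ^+ _); field. Qed.

Variable eps : R.
Hypothesis eps0 : 0 < eps.
Hypothesis eps9 : 9 * eps <= 1.
Hypothesis epsd : d%:R * eps <= 1.

(** Expansion around a: 1 - <z,w> - rho = -(<z - a,a> + conj <w - a,a> + <z - a,w - a>). The normal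
    size bounds each of the first two terms by eps rho; the last is quadratic in the tangential size
    and at most d eps^2 rho <= eps rho. This is why the tangential size may be the square root of
    the normal one. *)
Lemma abox_sector k a z w : bdist a = 4^-1 ^+ k -> abox eps k a z -> abox eps k a w ->
  normc (1 - hdot z w - ((4^-1 ^+ k)%:C)%C) <= 3 * eps * 4^-1 ^+ k.
Proof.
move=> ak /aboxP[z1 z2] /aboxP[w1 w2]; set rho := 4^-1 ^+ k in ak z2 w2 *.
have rho0 : 0 < rho by rewrite exprn_gt0.
pose S := \sum_(j < d) (tnth z j - tnth a j) * ((tnth w j - tnth a j)^*)%C.
have -> : 1 - hdot z w - (rho%:C)%C = - ((hdot z a - hdot a a) + ((hdot w a - hdot a a)^*)%C + S).
  have eS : S = hdot z w - hdot z a - hdot a w + hdot a a.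
    rewrite /S /hdot -!sumrB -big_split/=; apply: eq_bigr => j _.
    by rewrite rmorphB/=; ring.
  have -> : ((hdot w a - hdot a a)^*)%C = hdot a w - hdot a a by rewrite rmorphB/= -!hdotC.
  have eR : ((rho)%:C)%C = 1 - hdot a a.
    by rewrite hdot_self -ak; apply: complex_eq; rewrite ?ReD ?ImD ?ReN ?ImN/=; ring.
  by rewrite eS eR; ring.
rewrite normcN (le_trans (le_normcD _ _))// (_ : 3 * eps * rho = (eps * rho + eps * rho) + eps * rho); last by ring.
apply: lerD.
  by rewrite (le_trans (le_normcD _ _))// normc_conj lerD.
rewrite (le_trans (le_normc_sum _ _ _))//.
apply: (@le_trans _ _ (\sum_(j < d) (eps * 2^-1 ^+ k) * (eps * 2^-1 ^+ k))).
  by apply: ler_sum => j _; rewrite normcM normc_conj ler_pM ?normc_ge0.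
rewrite sumr_const card_ord -[X in X <= _]mulr_natl mulrACA -!expr2 sqr_halfX -/rho.
rewrite (_ : d%:R * (eps ^+ 2 * rho) = d%:R * eps * (eps * rho)); last by ring.
by rewrite ler_piMl// mulr_ge0// ltW.
Qed.

Lemma abox_Re_Im k a z w : bdist a = 4^-1 ^+ k -> abox eps k a z -> abox eps k a w ->
  [/\ (1 - 3 * eps) * 4^-1 ^+ k <= complex.Re (1 - hdot z w),
      complex.Re (1 - hdot z w) <= (1 + 3 * eps) * 4^-1 ^+ k,
      `|complex.Im (1 - hdot z w)| <= 3 * eps * 4^-1 ^+ k &
      normc (1 - hdot z w) <= 2 * 4^-1 ^+ k].
Proof.
move=> ak az aw; have h := abox_sector ak az aw.
have rho0 : 0 < 4^-1 ^+ k :> R by rewrite exprn_gt0.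
have hR := le_trans (Re_le_normc _) h; have hI := le_trans (Im_le_normc _) h.
rewrite ReD ReN/= ler_norml in hR; have /andP[r1 r2] := hR.
rewrite ImD ImN/= oppr0 addr0 in hI.
have hN := le_normcD (1 - hdot z w - ((4^-1 ^+ k)%:C)%C) ((4^-1 ^+ k)%:C)%C.
rewrite subrK normc_real gtr0_norm// in hN.
have e9 : 9 * eps <= 1 := eps9; have e0 : 0 < eps := eps0.
have e3 : 3 * eps * 4^-1 ^+ k <= 4^-1 ^+ k by rewrite ler_piMl ?(ltW rho0)//; lra.
move: rho0 h r1 r2 hI hN e3; set rho := 4^-1 ^+ k => rho0 h r1 r2 hI hN e3.
by split=> //; rewrite ?mulrBl ?mulrDl ?mul1r; lra.
Qed.

Lemma abox_bdist k a z : bdist a = 4^-1 ^+ k -> abox eps k a z ->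
  2 / 3 * 4^-1 ^+ k <= bdist z <= 4 / 3 * 4^-1 ^+ k.
Proof.
move=> ak az; have [h1 h2 _ _] := abox_Re_Im ak az az; rewrite -bdistE in h1 h2.
have rho0 : 0 < 4^-1 ^+ k :> R by rewrite exprn_gt0.
have e9 : 9 * eps <= 1 := eps9.
have e3 : 3 * eps * 4^-1 ^+ k <= 3^-1 * 4^-1 ^+ k by rewrite ler_wpM2r ?(ltW rho0)//; lra.
move: h1 h2 e3 rho0; rewrite mulrBl mulrDl mul1r; set rho := 4^-1 ^+ k => h1 h2 e3 rho0.
by apply/andP; split; lra.
Qed.

Lemma abox_ball k a : bdist a = 4^-1 ^+ k -> abox eps k a `<=` unit_ball.
Proof.
move=> ak z /(abox_bdist ak)/andP[h _]; apply/unit_ballP; apply: lt_le_trans h.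
by rewrite mulr_gt0 ?exprn_gt0// divr_gt0.
Qed.

(** On a box bdist stays in [2 rho / 3, 4 rho / 3], while rho changes by a factor of at least 4
    between scales. *)
Lemma abox_scale k k' a b z : bdist a = 4^-1 ^+ k -> bdist b = 4^-1 ^+ k' ->
  abox eps k a z -> abox eps k' b z -> k = k'.
Proof.
have H j j' (x y : Cd) : bdist x = 4^-1 ^+ j -> bdist y = 4^-1 ^+ j' ->
    abox eps j x z -> abox eps j' y z -> (j < j')%N -> False.
  move=> xj yj /(abox_bdist xj)/andP[h1 _] /(abox_bdist yj)/andP[_ h2] jj.
  have le_p : 4^-1 ^+ j' <= 4^-1 ^+ j.+1 :> R.
    by apply: ler_wiXn2l jj; rewrite ?invr_ge0 ?invf_le1 ?ler1n.
  have rho0 : 0 < 4^-1 ^+ j :> R by apply: exprn_gt0; rewrite invr_gt0.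
  rewrite exprS in le_p.
  by move: le_p h1 h2 rho0; set u := _ ^+ j; set u' := _ ^+ j'; lra.
move=> ak bk az bz; have [kk|kk|//] := ltngtP k k'.
  by have := H _ _ _ _ ak bk az bz kk.
by have := H _ _ _ _ bk ak bz az kk.
Qed.

End anisotropic_boxes.

Section box_volume.
Variables (R : realType) (n : nat).
Local Notation d := n.+1.
Local Notation Cd := (d.-tuple R[i]).
Local Notation v := (ball_measure R d).

(** The last n coordinates are taken in a small polydisc around those of a; for each choice the
    normal condition still leaves a disc of radius eps rho / 2 to the first coordinate, which is
    bounded below at a. *)
Lemma volume_abox_ge (eps : R) : 0 < eps -> 9 * eps <= 1 -> d%:R * eps <= 1 ->
  exists2 c : R, 0 < c & forall k (a : Cd), bdist a = 4^-1 ^+ k -> 2^-1 <= normc (tnth a ord0) ->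
    ((c * (4^-1 ^+ k) ^+ d.+1)%:E <= v (abox eps k a))%E.
Proof.
move=> e0 e9 ed; have /andP[v0 voo] := lebesgueC_unit_ball R d.
set V := fine (lebesgueC R d unit_ball).
have V0 : 0 < V by rewrite fine_gt0// v0 voo.
pose c1 := (eps / 2) ^+ 2 * ((eps / (4 * d%:R)) ^+ 2) ^+ n.
have dR : 0 < d%:R :> R by rewrite ltr0n.
have c10 : 0 < c1 by rewrite mulr_gt0 ?exprn_gt0 ?divr_gt0 ?mulr_gt0.
exists (c1 / V); first by rewrite divr_gt0.
move=> k a ak a0; set rho := 4^-1 ^+ k in ak *.
have rho0 : 0 < rho by rewrite exprn_gt0.
pose h : R := 2^-1 ^+ k; have h0 : 0 < h by rewrite exprn_gt0.
have h1 : h <= 1 by rewrite /h exprn_ile1//; lra.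
have hh : h ^+ 2 = rho by rewrite /h sqr_halfX.
have Ba : @unit_ball R d a by apply/unit_ballP; rewrite ak.
have [x [t aE]] := tuple_consE a.
have xE : x = tnth a ord0 by rewrite aE tnth0.
have tE i : tnth t i = tnth a (lift ord0 i) by rewrite aE tnthS.
have x0 : x != 0 by apply/eqP => x0; move: a0; rewrite -xE x0 normc0; lra.
have nx0 : 0 < normc x by rewrite xE; lra.
have nx1 : normc x <= 1 by rewrite xE; exact: coord_le1.
(* With this radius |T| <= eps h / 4, and |x| >= 1/2 then puts y0 within eps h / 2 of x. *)
pose r := eps / (4 * d%:R) * h.
have r0 : 0 <= r by rewrite /r mulr_ge0 ?(ltW h0)// divr_ge0 ?(ltW e0)// mulr_ge0.
rewrite ball_measureE (setIidl (abox_ball e0 e9 ed ak)).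
rewrite mulrAC EFinM; apply: lee_wpmul2r; first by rewrite lee_fin invr_ge0 ltW.
have -> : c1 * rho ^+ d.+1 = (eps / 2 * rho) ^+ 2 * (r ^+ 2) ^+ n.
  have -> : r ^+ 2 = (eps / (4 * d%:R)) ^+ 2 * rho by rewrite -hh -exprMn.
  have eM (x' y' : R) m : (x' * y') ^+ m = x' ^+ m * y' ^+ m by rewrite exprMn.
  rewrite /c1 (eM (eps / 2) rho) (eM ((eps / (4 * d%:R)) ^+ 2) rho) !(exprS rho n.+1) (exprS rho n).
  by move: (rho ^+ n) (_ ^+ n) (eps / 2) => u1 u2 u3; rewrite expr2; ring.
have er0 : 0 <= eps / 2 * rho by rewrite mulr_ge0 ?(ltW rho0)// divr_ge0 ?(ltW e0).
rewrite EFinM; apply: (@le_trans _ _ (((eps / 2 * rho) ^+ 2)%:E * lebesgueC R n (polydisc t r))%E).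
  by apply: lee_wpmul2l; [rewrite lee_fin sqr_ge0|exact: volume_polydisc_ge].
apply: lebesgueC_ge_tail.
- exact: measurable_abox.
- exact: measurable_polydisc.
- by rewrite lee_fin sqr_ge0.
move=> s Ds.
pose T := \sum_(j < n) (tnth s j - tnth t j) * ((tnth t j)^*)%C.
(* The first coordinate for which <w - a,a> vanishes exactly, given the others. *)
pose y0 := x - T / (x^*)%C.
have cx0 : (x^*)%C != 0 by rewrite conjc_eq0.
have T_le : normc T <= eps / 4 * h.
  apply: (le_trans (le_normc_sum _ _ _)).
  apply: (@le_trans _ _ (\sum_(j < n) r)).
    apply: ler_sum => j _; rewrite normcM normc_conj -[leRHS]mulr1 ler_pM ?normc_ge0//.
    by rewrite tE; exact: coord_le1.
  rewrite sumr_const card_ord -[X in X <= _]mulr_natl /r.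
  have -> : n%:R * (eps / (4 * d%:R) * h) = eps / 4 * h * (n%:R / d%:R) by field; rewrite gt_eqF.
  rewrite ler_piMr//; last by rewrite ler_pdivrMr// mul1r ler_nat.
  by rewrite mulr_ge0 ?(ltW h0)// divr_ge0 ?(ltW e0).
apply: (le_trans (area_disc_ge y0 er0)); apply: le_measure; rewrite ?inE.
- exact: measurable_disc.
- have mc : measurable_fun setT (fun y : R[i] => [tuple of y :: s]).
    exact: (measurable_cons (@measurable_id _ _ _) (measurable_cst s)).
  rewrite -[X in measurable X]setTI; apply: mc => //; exact: measurable_abox.
move=> y /= hy; apply/aboxP.
have yx : normc (y - x) <= eps * h.
  have -> : y - x = (y - y0) - T / (x^*)%C by rewrite /y0; ring.
  apply: (le_trans (le_normcD _ _)); rewrite normcN.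
  have hT : normc (T / (x^*)%C) <= eps / 2 * h.
    rewrite normcM normcV normc_conj ler_pdivrMr//; apply: (le_trans T_le).
    have : 2^-1 <= normc x by rewrite xE.
    have : 0 < eps * h by exact: mulr_gt0.
    by nra.
  have : eps / 2 * rho <= eps / 2 * h.
    by rewrite ler_wpM2l ?divr_ge0 ?(ltW e0)// -hh expr2 ler_piMl// ltW.
  by lra.
have rh : r <= eps * h.
  rewrite /r ler_wpM2r ?(ltW h0)// ler_piMr ?(ltW e0)// invf_le1 ?mulr_gt0//.
  have : 1 <= d%:R :> R by rewrite ler1n.
  by lra.
split.
  move=> i; rewrite aE; case: (unliftP ord0 i) => [j ->|->]; rewrite ?tnthS ?tnth0//.
  exact: le_trans (Ds j) rh.
rewrite hdotBl aE big_ord_recl !tnth0.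
have -> : \sum_(j < n) (tnth [tuple of y :: s] (lift ord0 j) - tnth [tuple of x :: t] (lift ord0 j)) *
   ((tnth [tuple of x :: t] (lift ord0 j))^*)%C = T.
  by apply: eq_bigr => j _; rewrite !tnthS.
have -> : (y - x) * (x^*)%C + T = (y - y0) * (x^*)%C by rewrite /y0; field.
rewrite normcM normc_conj (le_trans (ler_wpM2l (normc_ge0 _) nx1))// mulr1.
apply: (le_trans hy); rewrite ler_wpM2r ?(ltW rho0)//; lra.
Qed.

End box_volume.

(** * Disjoint families of boxes *)

Section lattice.
Variables (R : realType) (n : nat).
Local Notation d := n.+1.
Local Notation Cd := (d.-tuple R[i]).
Local Notation v := (ball_measure R d).

(** From <b - a,a> = <z - a,a> - <z - b,b> + <z - b,b - a>, whose last term is at most d eps (2 eps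
    rho) <= 2 eps rho. Disjointness at a given scale is thereby reduced to the separation of the
    centres. *)
Lemma abox_meet (eps : R) k (a b z : Cd) : 0 < eps -> d%:R * eps <= 1 ->
  abox eps k a z -> abox eps k b z ->
  (forall j, normc (tnth b j - tnth a j) <= 2 * eps * 2^-1 ^+ k) /\
  normc (hdot b a - hdot a a) <= 4 * eps * 4^-1 ^+ k.
Proof.
move=> e0 ed /aboxP[az1 az2] /aboxP[bz1 bz2].
have ab j : normc (tnth b j - tnth a j) <= 2 * eps * 2^-1 ^+ k.
  have -> : tnth b j - tnth a j = (tnth z j - tnth a j) - (tnth z j - tnth b j) by ring.
  rewrite (le_trans (le_normcD _ _))// normcN.
  have := az1 j; have := bz1 j; set h := 2^-1 ^+ k => h1 h2; lra.
split=> //; pose S := \sum_(j < d) (tnth z j - tnth b j) * ((tnth b j - tnth a j)^*)%C.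
have eS : S = hdot z b - hdot z a - hdot b b + hdot b a.
  rewrite /S /hdot -!sumrB -big_split/=; apply: eq_bigr => j _.
  by rewrite rmorphB/=; ring.
have -> : hdot b a - hdot a a = (hdot z a - hdot a a) - (hdot z b - hdot b b) + S.
  by rewrite eS; ring.
have S_le : normc S <= 2 * eps * 4^-1 ^+ k.
  rewrite (le_trans (le_normc_sum _ _ _))//.
  apply: (@le_trans _ _ (\sum_(j < d) (eps * 2^-1 ^+ k) * (2 * eps * 2^-1 ^+ k))).
    by apply: ler_sum => j _; rewrite normcM normc_conj ler_pM ?normc_ge0.
  rewrite sumr_const card_ord -[X in X <= _]mulr_natl -(sqr_halfX R k).
  set h := 2^-1 ^+ k.
  rewrite (_ : d%:R * _ = d%:R * eps * (2 * eps * h ^+ 2)); last by ring.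
  by rewrite ler_piMl// mulr_ge0 ?sqr_ge0// mulr_ge0// ltW.
rewrite (le_trans (le_normcD _ _))//.
have := le_normcD (hdot z a - hdot a a) (- (hdot z b - hdot b b)).
rewrite normcN; move: az2 bz2 S_le; set rho := 4^-1 ^+ k => h1 h2 h3 h4; lra.
Qed.

(** Positions on 2^i steps in each of the 2 n real directions of the last coordinates and on 4^i
    steps for the imaginary part of the first one. Its real part is determined by the distance to
    the sphere. *)
Definition lattice_index (i : nat) : finType :=
  ({ffun 'I_n -> 'I_(2 ^ i) * 'I_(2 ^ i)} * 'I_(4 ^ i))%type.

(* With the shift n + 2, all the lattice points have a real part of the first
   coordinate bounded below (lattice_Re_sqr_ge). *)
Definition lattice_exp (i : nat) : nat := (n.+2 + i)%N.

Section lattice_point.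
Variable i : nat.
Implicit Types m : lattice_index i.
Local Notation h := (2^-1 ^+ lattice_exp i : R).
Local Notation rho := (4^-1 ^+ lattice_exp i : R).

Definition lattice_tail m : n.-tuple R[i] :=
  [tuple (Complex (h * (m.1 j).1%:R) (h * (m.1 j).2%:R)) | j < n].

(** The square of the real part of the first coordinate that puts the point at bdist = rho. *)
Definition lattice_Re_sqr m : R :=
  1 - \sum_(j < n) normc (tnth (lattice_tail m) j) ^+ 2 - (rho * m.2%:R) ^+ 2 - rho.

Definition lattice_point m : Cd :=
  [tuple of Complex (Num.sqrt (lattice_Re_sqr m)) (rho * m.2%:R) :: lattice_tail m].

Lemma lattice_Re_sqr_ge m : 2^-1 <= lattice_Re_sqr m.
Proof.
(* g = 4^-(n + 2) is the gain of the shift: the last coordinates contribute at most 2 n g and the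
   other two terms at most g each, in total 2 (n + 1) g <= 1/2. *)
have [g [g0 gn rhoE hE]] : exists g : R, [/\ 0 < g, (4 * n.+1%:R) * g <= 1,
    rho = g * 4^-1 ^+ i & h ^+ 2 = g * (2^-1 ^+ i) ^+ 2].
  exists (4^-1 ^+ n.+2); split.
  - by apply: exprn_gt0; rewrite invr_gt0.
  - rewrite exprVn ler_pdivrMr ?exprn_gt0// mul1r exprS ler_pM2l//.
    by rewrite -natrX ler_nat ltnW// ltn_expl.
  - by rewrite exprD.
  - by rewrite !sqr_halfX exprD.
have i4 : 4^-1 ^+ i * (4 ^ i)%:R = 1 :> R.
  by rewrite natrX -exprMn mulVf ?expr1n.
have i2 : 2^-1 ^+ i * (2 ^ i)%:R = 1 :> R.
  by rewrite natrX -exprMn mulVf ?expr1n.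
have g1 : g <= 1.
  apply: le_trans gn; rewrite ler_peMl ?(ltW g0)//.
  have : 1 <= n.+1%:R :> R by rewrite ler1n.
  by lra.
have rg : rho <= g by rewrite rhoE ler_piMr ?(ltW g0)// exprn_ile1// ?invr_ge0 ?invf_le1 ?ler1n.
have yg : (rho * m.2%:R) ^+ 2 <= g.
  have y1 : rho * m.2%:R <= g.
    rewrite rhoE -mulrA ler_piMr ?(ltW g0)// -[leRHS]i4; apply: ler_wpM2l.
      by apply: exprn_ge0; rewrite invr_ge0.
    by rewrite ler_nat; exact: ltnW (ltn_ord _).
  have y0 : 0 <= rho * m.2%:R by rewrite mulr_ge0// exprn_ge0// invr_ge0.
  by rewrite expr2 (le_trans (ler_pM y0 y0 y1 y1))// ler_piMr// ltW.
have tg : \sum_(j < n) normc (tnth (lattice_tail m) j) ^+ 2 <= n%:R * (2 * g).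
  apply: (@le_trans _ _ (\sum_(j < n) 2 * g)); last first.
    by rewrite sumr_const card_ord -[X in X <= _]mulr_natl.
  apply: ler_sum => j _; rewrite sqr_normc_ReIm tnth_mktuple.
  rewrite -[complex.Re _]/(h * _) -[complex.Im _]/(h * _).
  rewrite [(h * (m.1 j).1%:R) ^+ 2]exprMn [(h * (m.1 j).2%:R) ^+ 2]exprMn hE.
  have sq (x : 'I_(2 ^ i)) : (2^-1 ^+ i) ^+ 2 * x%:R ^+ 2 <= 1 :> R.
    rewrite -exprMn exprn_ile1// ?mulr_ge0 ?exprn_ge0 ?invr_ge0//.
    rewrite -[leRHS]i2; apply: ler_wpM2l; first by apply: exprn_ge0; rewrite invr_ge0.
    by rewrite ler_nat; exact: ltnW (ltn_ord _).
  have E (u x y : R) : g * u * x + g * u * y = (u * x + u * y) * g by ring.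
  rewrite E ler_wpM2r ?(ltW g0)//.
  by have := lerD (sq (m.1 j).1) (sq (m.1 j).2).
move: gn; rewrite -natr1 /lattice_Re_sqr => gn; move: tg yg rg g0 gn.
move: (\sum_(j < n) _) (rho * _) => X Y; lra.
Qed.

Lemma bdist_lattice_point m : bdist (lattice_point m) = rho.
Proof.
rewrite /bdist big_ord_recl tnth0 sqr_normc_ReIm/= sqr_sqrtr; last first.
  by rewrite (le_trans _ (lattice_Re_sqr_ge m))// invr_ge0.
under eq_bigr do rewrite tnthS.
by rewrite /lattice_Re_sqr; ring.
Qed.

Lemma lattice_point_head m : 2^-1 <= normc (tnth (lattice_point m) ord0).
Proof.
rewrite tnth0 -(@ler_pXn2r _ 2) ?nnegrE ?normc_ge0 ?invr_ge0// sqr_normc_ReIm/= sqr_sqrtr; last first.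
  by rewrite (le_trans _ (lattice_Re_sqr_ge m))// invr_ge0.
have := lattice_Re_sqr_ge m; have := sqr_ge0 (rho * m.2%:R); rewrite !expr2; lra.
Qed.

Lemma ler1_dist_nat (x y : nat) : x <> y -> 1 <= `|x%:R - y%:R| :> R.
Proof.
have H (u w : nat) : (u < w)%N -> 1 <= `|u%:R - w%:R| :> R.
  move=> uw; rewrite distrC ger0_norm ?subr_ge0 ?ler_nat ?(ltnW uw)//.
  by rewrite lerBrDr addrC natr1 ler_nat.
move=> xy; have [/H//|/H|//] := ltngtP x y.
by rewrite distrC.
Qed.

(** The last coordinates are compared first: they differ by multiples of h, and 2 eps < 1. Once
    these agree, <b - a,a> only involves the first coordinate, whose imaginary parts differ by
    multiples of rho; as its modulus at a is at least 1/2, 4 eps < 1/2 suffices. *)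
Lemma lattice_point_disjoint (eps : R) m m' z : 0 < eps -> 9 * eps <= 1 -> d%:R * eps <= 1 ->
  abox eps (lattice_exp i) (lattice_point m) z ->
  abox eps (lattice_exp i) (lattice_point m') z -> m = m'.
Proof.
move=> e0 e9 ed mz m'z; have [H1 H2] := abox_meet e0 ed mz m'z.
have h0 : 0 < h by apply: exprn_gt0; rewrite invr_gt0.
have r0 : 0 < rho by apply: exprn_gt0; rewrite invr_gt0.
have small (x y : nat) : `|h * x%:R - h * y%:R| <= 2 * eps * h -> x = y.
  move=> hxy; have [//|xy] := pselect (x = y); exfalso.
  move: hxy; rewrite -mulrBr normrM gtr0_norm// mulrC ler_pM2r//.
  by have := ler1_dist_nat xy; lra.
have tE : m.1 = m'.1.
  apply/ffunP => j; have := H1 (lift ord0 j); rewrite !tnthS !tnth_mktuple => H.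
  have hR := le_trans (Re_le_normc _) H; have hI := le_trans (Im_le_normc _) H.
  rewrite ReD ReN/= in hR; rewrite ImD ImN/= in hI.
  have e1 := small _ _ hR; have e2 := small _ _ hI.
  rewrite [LHS]surjective_pairing [RHS]surjective_pairing.
  by congr pair; apply/val_inj; rewrite /= ?e1 ?e2.
have sE : lattice_tail m = lattice_tail m'.
  by apply: eq_from_tnth => j; rewrite !tnth_mktuple tE.
have lE : m.2 = m'.2.
  apply/val_inj/eqP; have [//|lm] := eqVneq (val m.2) (val m'.2); exfalso.
  move: H2; rewrite hdotBl big_ord_recl big1; last first.
    by move=> j _; rewrite !tnthS sE subrr mul0r.
  rewrite addr0 normcM normc_conj => H2.
  have h1 := lattice_point_head m.
  have h2 : rho <= normc (tnth (lattice_point m') ord0 - tnth (lattice_point m) ord0).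
    rewrite (le_trans _ (Im_le_normc _))// !tnth0 ImD ImN/= -mulrBr normrM gtr0_norm//.
    by rewrite ler_peMr ?(ltW r0)//; apply: ler1_dist_nat => /esym/eqP; apply/negP.
  have : rho * 2^-1 <= 4 * eps * rho.
    by apply: le_trans H2; apply: ler_pM => //; rewrite ?(ltW r0) ?invr_ge0.
  by rewrite mulrC ler_pM2r//; lra.
by rewrite [LHS]surjective_pairing [RHS]surjective_pairing tE lE.
Qed.

End lattice_point.

Lemma card_lattice_index i : #|lattice_index i| = ((4 ^ i) ^ n.+1)%N.
Proof.
rewrite card_prod card_ffun card_prod !card_ord -expnMn.
by rewrite (_ : (2 * 2)%N = 4%N)// expnSr.
Qed.

(* There are about 4^(k d) boxes of scale k, each of volume about 4^(-k (d + 1)):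
   every scale contributes a constant to the last sum. *)
Lemma box_family (eps : R) : 0 < eps -> 9 * eps <= 1 -> d%:R * eps <= 1 ->
  exists2 c : R, 0 < c & forall N : nat,
  exists (I : finType) (E : I -> set Cd) (k : I -> nat),
  [/\ forall i, measurable (E i) /\ E i `<=` unit_ball,
      forall i j z, E i z -> E j z -> i = j,
      forall i z w, E i z -> E i w ->
        [/\ (1 - 3 * eps) * 4^-1 ^+ k i <= complex.Re (1 - hdot z w),
            `|complex.Im (1 - hdot z w)| <= 3 * eps * 4^-1 ^+ k i &
            normc (1 - hdot z w) <= 2 * 4^-1 ^+ k i],
      forall i, c * (4^-1 ^+ k i) ^+ d.+1 <= fine (v (E i))
    & c * N%:R <= \sum_i fine (v (E i)) / 4^-1 ^+ k i].
Proof.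
move=> e0 e9 ed; have [c c0 Hc] := volume_abox_ge e0 e9 ed.
(* The number 4^(i d) of boxes of index i times rho^d, where rho = 4^-(n + 2 + i): this product is
   the same for all i. *)
pose g : R := (4^-1 ^+ n.+2) ^+ n.+1.
have g0 : 0 < g by apply: exprn_gt0; apply: exprn_gt0; rewrite invr_gt0.
have g1 : g <= 1.
  by rewrite !exprn_ile1// ?exprn_ge0 ?invr_ge0// invf_le1 ?ler1n.
exists (c * g); first exact: mulr_gt0.
move=> N; pose I : finType := {i : 'I_N & lattice_index i}.
pose a (s : I) : Cd := lattice_point (tagged s).
pose k (s : I) := lattice_exp (tag s).
have ba s : bdist (a s) = 4^-1 ^+ k s by exact: bdist_lattice_point.
have volE s : c * (4^-1 ^+ k s) ^+ d.+1 <= fine (v (abox eps (k s) (a s))).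
  rewrite -lee_fin fineK; last exact: fin_num_measure (measurable_abox _ _ _).
  by apply: Hc; [exact: ba|exact: lattice_point_head].
exists I, (fun s => abox eps (k s) (a s)), k; split.
- by move=> s; split; [exact: measurable_abox|exact: (abox_ball e0 e9 ed (ba s))].
- move=> s s' z sz s'z; have kk := abox_scale e0 e9 ed (ba s) (ba s') sz s'z.
  case: s s' sz s'z kk => [i m] [i' m'] sz s'z kk.
  have ii : i = i' by apply/val_inj; apply: (@addnI n.+2); exact: kk.
  subst i'; have mm : m = m' := lattice_point_disjoint e0 e9 ed sz s'z.
  by rewrite mm.
- move=> s z w sz sw; have [h1 _ h2 h3] := abox_Re_Im e0 e9 ed (ba s) sz sw.
  by split.
- move=> s; apply: le_trans (volE s); apply: ler_wpM2r; last by rewrite ler_piMr// ltW.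
  by apply: exprn_ge0; apply: exprn_ge0; rewrite invr_ge0.
apply: (@le_trans _ _ (\sum_(s : I) c * (4^-1 ^+ k s) ^+ n.+1)); last first.
  apply: ler_sum => s _.
  have r0 : 0 < 4^-1 ^+ k s :> R by apply: exprn_gt0; rewrite invr_gt0.
  by rewrite ler_pdivlMr// -mulrA -exprSr; exact: volE.
rewrite (_ : \sum_(s : I) _ = \sum_(i < N) \sum_(m : lattice_index i) c * (4^-1 ^+ lattice_exp i) ^+ n.+1); last first.
  by rewrite sig_big_dep.
have E (i : 'I_N) : \sum_(m : lattice_index i) c * (4^-1 ^+ lattice_exp i) ^+ n.+1 = c * g.
  rewrite sumr_const card_lattice_index -[LHS]mulr_natl mulrCA; congr (_ * _).
  have e : (4 ^ i)%:R * 4^-1 ^+ lattice_exp i = 4^-1 ^+ n.+2 :> R.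
    by rewrite (exprD 4^-1 n.+2 i) mulrCA natrX -(exprMn i) mulfV ?expr1n ?mulr1.
  by rewrite natrX -(exprMn n.+1) e.
rewrite (eq_bigr _ (fun i _ => E i)).
by rewrite sumr_const card_ord -[X in _ <= X]mulr_natr.
Qed.

End lattice.

(** * Necessity *)

Section necessity.
Variables (R : realType) (n : nat).
Local Notation d := n.+1.
Local Notation Cd := (d.-tuple R[i]).
Local Notation v := (ball_measure R d).
Variables (kap : R[i] -> R[i]) (alpha : R).
Hypothesis mkap : measurable_fun setT kap.
Hypothesis kap_le : forall u, 0 < complex.Re u -> normc (kap u) <= normc u `^ (- alpha).
Hypothesis halpha : d%:R + 1 < alpha < d%:R + 2.
Hypothesis kap_sector : forall u, 0 < complex.Re u -> alpha * `|complex.Im u| <= complex.Re u ->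
  cos 1 * normc u `^ (- alpha) <= complex.Re (kap u).
Local Notation t := (alpha - (d%:R + 1)).

(** Here s stands for 1/p, with s = 0 for p infinite. Only the common modulus g of the test
    functions is exposed: the choice of signs is hidden in the quantification over all f with |f| =
    g. *)
Lemma sign_test (s q : R) : 0 < q -> (s + t) * q = 1 ->
  exists c c' : R, [/\ 0 < c, 0 < c' & forall N : nat, exists (g : Cd -> R) (S : R),
  [/\ c * N%:R <= S,
      forall w, 0 <= g w,
      s = 0 -> forall w, g w <= 1,
      forall p, s * p = 1 -> p != 0 -> (\int[v]_w (g w `^ p)%:E <= S%:E)%E &
      forall Y : R, (forall f, measurable_fun setT f -> (forall w, normc (f w) = g w) ->
         (\int[v]_z (normc (kernel_op kap f z) `^ q)%:E <= Y%:E)%E) -> c' * S <= Y]].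
Proof.
move=> q0 sq; have /andP[a1 _] := halpha.
have dR : 1 <= d%:R :> R by rewrite ler1n.
(* One choice meets three demands: 9 eps <= 1 separates the boxes, d eps <= 1 controls the quadratic
   term of [abox_sector], and 3 eps alpha <= 1 - 3 eps puts 1 - <z,w> in the sector where
   [kap_sector] applies. *)
pose eps := (3 * alpha + 3 + d%:R)^-1.
have D0 : 0 < 3 * alpha + 3 + d%:R by lra.
have e0 : 0 < eps by rewrite invr_gt0.
have e9 : 9 * eps <= 1 by rewrite ler_pdivrMr// mul1r; lra.
have ed : d%:R * eps <= 1 by rewrite ler_pdivrMr// mul1r; lra.
have ea : alpha * (3 * eps) <= 1 - 3 * eps.
  have : (3 * alpha + 3 + d%:R) * eps = 1 by rewrite mulfV// gt_eqF.
  have : 0 <= d%:R * eps by rewrite mulr_ge0// ltW.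
  by lra.
have a0 : 0 < alpha by lra.
have [c c0 H] := box_family e0 e9 ed.
pose c3 := cos 1 * 2 `^ (- alpha) * c.
have c1 : 0 < cos 1 :> R := cos1_gt0 R.
have c30 : 0 < c3 by rewrite !mulr_gt0// powR_gt0.
exists c, (2^-1 * c3 `^ q); split=> //; first by rewrite mulr_gt0 ?invr_gt0// powR_gt0.
move=> N; have [I [E [k [mEB dE sE vE cN]]]] := H N.
pose rho i : R := 4^-1 ^+ k i; pose vol i := fine (v (E i)).
have mE i := (mEB i).1; have EB i := (mEB i).2.
have r0 i : 0 < rho i by apply: exprn_gt0; rewrite invr_gt0.
have rN i : rho i != 0 by rewrite gt_eqF.
have volE i : v (E i) = (vol i)%:E by rewrite fineK// fin_num_measure.
pose ci i := rho i `^ (- s).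
have ci0 i : 0 < ci i by exact: powR_gt0.
have kE i z w : E i z -> E i w ->
    cos 1 * (2 * rho i) `^ (- alpha) <= complex.Re (kap (1 - hdot z w)).
  move=> Ez Ew; have [h1 h2 h3] := sE i z w Ez Ew.
  have u0 := Re_1hdot_gt0 (EB i z Ez) (EB i w Ew).
  apply: le_trans (kap_sector u0 _); last first.
    apply: le_trans h1; apply: le_trans (ler_wpM2l (ltW a0) h2) _.
    by rewrite mulrA ler_wpM2r// ltW// r0.
  rewrite ler_wpM2l ?(ltW c1)// !powRN lef_pV2 ?posrE ?powR_gt0 ?mulr_gt0//.
  - apply: ge0_ler_powR => //; rewrite ?nnegrE ?normc_ge0 ?(ltW a0)//.
    by rewrite mulr_ge0// ltW// r0.
  - exact: normc_1hdot_gt0 (EB i z Ez) (EB i w Ew).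
exists (fun w => \sum_i ci i * \1_(E i) w), (\sum_i vol i / rho i).
have sum_at (F : I -> R) k0 w : E k0 w -> \sum_i F i * \1_(E i) w = F k0.
  move=> Ek; rewrite (bigD1 k0)//= indicE mem_set// mulr1 big1 ?addr0// => i ik.
  rewrite indicE memNset ?mulr0// => Ei; move: ik.
  by rewrite (dE _ _ _ Ei Ek) eqxx.
have sum_out (F : I -> R) w : ~ (exists k0, E k0 w) -> \sum_i F i * \1_(E i) w = 0.
  move=> nk; rewrite big1// => i _; rewrite indicE memNset ?mulr0// => Ei.
  by apply: nk; exists i.
split => //.
- by move=> w; apply: sumr_ge0 => i _; rewrite mulr_ge0// ltW.
- move=> s0 w; have [[k0 Ek]|nk] := pselect (exists k0, E k0 w); last by rewrite sum_out.
  by rewrite (sum_at _ _ _ Ek) /ci s0 oppr0 powRr0.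
- move=> p sp pN; rewrite le_eqVlt; apply/orP; left; apply/eqP.
  transitivity (\int[v]_w (\sum_i ((rho i)^-1%:E * (\1_(E i) w)%:E)))%E.
    apply: eq_integral => w _; rewrite sumEFin; congr (_%:E).
    have [[k0 Ek]|nk] := pselect (exists k0, E k0 w); last by rewrite !sum_out// powR0.
    rewrite (sum_at _ _ _ Ek) (sum_at (fun i => (rho i)^-1) _ _ Ek) /ci -powRrM mulNr sp.
    by rewrite powR_inv1// ltW.
  rewrite ge0_integral_sum//; last 2 first.
  - by move=> i; apply: measurable_funeM; apply/measurable_EFinP; exact: measurable_indic.
  - by move=> i w _; rewrite -EFinM lee_fin mulr_ge0// invr_ge0 ltW.
  rewrite -sumEFin; apply: eq_bigr => i _.
  rewrite ge0_integralZl//; last 2 first.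
  - by apply/measurable_EFinP; exact: measurable_indic.
  - by rewrite lee_fin invr_ge0 ltW.
  by rewrite integral_indic// setIT [RHS]EFinM [RHS]muleC; congr (_ * _)%E; exact: volE.
move=> Y HY.
apply: le_trans (sign_lower_bound mkap kap_le q0 c1 mE EB dE ci0 r0 volE kE _); last first.
  move=> e; apply: HY.
    exact: (measurable_sign_fun mkap kap_le ci mE e).
  by move=> w; rewrite (normc_sign_fun dE ci0).
rewrite -mulrA ler_wpM2l// mulr_sumr; apply: ler_sum => i _.
have vol0 : 0 <= vol i by rewrite fine_ge0.
rewrite mulrCA; apply: ler_wpM2l => //.
have -> : c3 `^ q * (rho i)^-1 = (c3 * rho i `^ (- (s + t))) `^ q.
  by rewrite powRM ?(ltW c30) ?powR_ge0// -powRrM mulNr sq powR_inv1// ltW.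
apply: ge0_ler_powR; rewrite ?(ltW q0)// ?nnegrE.
- by rewrite mulr_ge0 ?(ltW c30)// powR_ge0.
- by rewrite !mulr_ge0 ?powR_ge0 ?(ltW c1).
have -> : c3 * rho i `^ (- (s + t)) =
    ci i * (cos 1 * (2 * rho i) `^ (- alpha) * (c * rho i ^+ d.+1)).
  rewrite powRM ?(ltW (r0 i))// /c3 /ci -powR_mulrn ?(ltW (r0 i))//.
  have -> : - (s + t) = - s + (- alpha + d.+1%:R) by rewrite -[d.+1%:R]natr1; ring.
  rewrite !powRD ?rN ?implybT//; ring.
apply: ler_wpM2l; first exact: ltW.
by apply: ler_wpM2l; [rewrite mulr_ge0 ?powR_ge0// ltW|exact: vE].
Qed.


Lemma critical_unbounded (P : \bar R) (s q : R) : 0 < q -> 0 <= s -> (s + t) * q = 1 ->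
  (P = +oo%E /\ s = 0) \/ (exists p : R, [/\ P = p%:E, 0 < p & s * p = 1]) ->
  ~ bounded_op v P q%:E (kernel_op kap).
Proof.
move=> q0 s0 sq HP [C0 bC]; have /andP[a1 _] := halpha.
have t0 : 0 < t by lra.
have [c [c' [cp c'p H]]] := sign_test q0 sq.
pose C := `|C0| + 1; have C_gt0 : 0 < C by rewrite ltr_wpDl.
(* Boundedness would give c' S <= C^q S^(s q), that is S <= X because 1 - s q = t q; N is taken so
   large that S >= c N > X. *)
pose X := (C `^ q / c') `^ (t * q)^-1.
pose N := Num.bound (X / c).
have [g [S [cN g0 g1 gp HY]]] := H N.
have XS : X < S.
  apply: lt_le_trans cN; rewrite mulrC -ltr_pdivrMr//.
  by apply: archi_boundP; rewrite divr_ge0 ?powR_ge0// ltW.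
have S0 : 0 < S by apply: le_lt_trans XS; exact: powR_ge0.
have tq0 : 0 < t * q by rewrite mulr_gt0.
have gL f : (forall w, normc (f w) = g w) -> (cLnorm v P f <= (S `^ s)%:E)%E.
  move=> fg; case: HP => [[-> s_0]|[p [-> p0 sp]]].
    by rewrite s_0 powRr0; apply: cLnorm_oo_le => w; rewrite fg; exact: g1.
  apply/cLnorm_leP; rewrite ?powR_ge0// -powRrM sp powRr1 ?(ltW S0)//.
  by under eq_integral do rewrite fg; apply: gp => //; rewrite gt_eqF.
have : c' * S <= (C * S `^ s) `^ q.
  apply: HY => f mf fg; have fL := gL f fg.
  have Lf : cLfun v P f by split=> //; apply: le_lt_trans fL _; exact: ltry.
  have [_ h] := bC f Lf.
  apply/cLnorm_leP; rewrite ?mulr_ge0 ?powR_ge0 ?(ltW C_gt0)//.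
  apply: (le_trans h); rewrite EFinM.
  apply: (@le_trans _ _ (C%:E * cLnorm v P f)%E).
    apply: lee_wpmul2r; first exact: cLnorm_ge0.
    by rewrite lee_fin /C; have := ler_norm C0; lra.
  by apply: lee_wpmul2l => //; rewrite lee_fin ltW.
rewrite powRM ?powR_ge0 ?(ltW C_gt0)// -powRrM.
have SE : S = S `^ (t * q) * S `^ (s * q).
  have e : t * q + s * q = 1 by rewrite -[RHS]sq; ring.
  by rewrite -powRD e ?powRr1 ?(ltW S0)// oner_eq0.
rewrite [X in _ * X <= _]SE mulrA ler_pM2r ?powR_gt0// mulrC -ler_pdivlMr//.
apply/negP; rewrite -ltNge.
have -> : C `^ q / c' = X `^ (t * q).
  rewrite /X -powRrM mulVf ?gt_eqF// powRr1// divr_ge0 ?powR_ge0//.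
  exact: ltW.
by apply: gt0_ltr_powR; rewrite // nnegrE ?powR_ge0// ltW.
Qed.

(** Two critical pairs are used: (oo, 1/t), which forces q < 1/t for every p, and then (1/s, q) with
    s = 1/q - t, which is positive by the first step. *)
Lemma kernel_op_necessary (p q : \bar R) : (1 <= p)%E -> (1 <= q)%E ->
  bounded_op v p q (kernel_op kap) ->
  [/\ (((d%:R + 2 - alpha)^-1)%:E < p)%E, (p < +oo)%E
         & (q^-1 > p^-1 + t%:E)%E]
       \/ (p = +oo%E /\ (q < (t^-1)%:E)%E).
Proof.
move=> p1 q1 bpq; have /andP[a1 a2] := halpha.
have t0 : 0 < t by lra.
have tN : t != 0 by rewrite gt_eqF.
have t1 : 1 <= t^-1 by rewrite invf_ge1//; lra.
have qt : (q < (t^-1)%:E)%E.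
  rewrite ltNge; apply/negP => tq.
  have : bounded_op v +oo%E (t^-1)%:E (kernel_op kap).
    by apply: bounded_op_exponent bpq => //; rewrite ?leey// lee_fin.
  by apply: (@critical_unbounded _ 0); rewrite ?invr_gt0// ?add0r ?mulfV//; left.
case: q q1 qt bpq => [q| |]// q1 qt bpq.
rewrite lee_fin in q1; rewrite lte_fin in qt.
have q0 : 0 < q by lra.
have qt' : t < q^-1 by rewrite -[t]invrK ltf_pV2 ?posrE ?invr_gt0.
case: p p1 bpq => [p| |]// p1 bpq; last by right.
left; rewrite lee_fin in p1; have p0 : 0 < p by lra.
have q1' : q^-1 <= 1 by rewrite invf_le1.
have pq : p^-1 + t < q^-1.
  rewrite ltNge; apply/negP => h.
  pose s := q^-1 - t; have s0 : 0 < s by rewrite subr_gt0.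
  have sN : s != 0 by rewrite gt_eqF.
  have : bounded_op v (s^-1)%:E q%:E (kernel_op kap).
    apply: bounded_op_exponent bpq; rewrite ?lee_fin//.
    by rewrite -[p]invrK lef_pV2 ?posrE ?invr_gt0// /s; lra.
  apply: (@critical_unbounded _ s) => //; first exact: ltW.
    by rewrite /s subrK mulVf// gt_eqF.
  by right; exists s^-1; split; rewrite ?invr_gt0// mulfV.
split; rewrite ?ltry//.
  (* The lower bound on p follows from 1/p < 1/q - t <= 1 - t = d + 2 - alpha. *)
  have D0 : 0 < d%:R + 2 - alpha by lra.
  by rewrite lte_fin -[p]invrK ltf_pV2 ?posrE ?invr_gt0//; lra.
by rewrite !inver !gt_eqF// -EFinD lte_fin.
Qed.

End necessity.

(** * Compact operators are bounded *)

Section compact_bounded.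
Context d0 (T : measurableType d0) (R : realType).
Variables (mu : {measure set T -> \bar R}) (p q : \bar R).
Hypothesis p1 : (1 <= p)%E.
Variable hq : (1 <= q)%E.

(** The norm is at most r + 1 on the unit ball around a point of norm r; compactness of the closure
    turns this local bound into a global one. *)
Lemma precompact_cLnorm_bounded (X : set (cLfunType mu hq)) : precompact X ->
  exists N : R, forall g, X g -> (cLnorm mu q g <= N%:E)%E.
Proof.
rewrite precompactE compact_near_coveringP => cX.
have : \forall n \near \oo, closure X `<=` [set g : cLfunType mu hq | (cLnorm mu q g <= n%:R%:E)%E].
  apply: (cX nat _ (fun (n : nat) (g : cLfunType mu hq) => (cLnorm mu q g <= n%:R%:E)%E)) => g _.
  have [mg gq] := clfunP g.
  have g_fin : cLnorm mu q g \is a fin_num by rewrite ge0_fin_numE ?cLnorm_ge0.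
  pose r := fine (cLnorm mu q g).
  exists (ball g 1, [set n : nat | r + 1 <= n%:R]).
    split => /=; first exact: nbhsx_ballx.
    exists (Num.bound (r + 1)) => // n /= nB.
    apply: ltW; apply: lt_le_trans (archi_boundP _) _; last by rewrite ler_nat.
    by rewrite addr_ge0// fine_ge0// cLnorm_ge0.
  move=> [g' n] /= [gg' rn].
  have mg' := (clfunP g').1.
  have gE : (g' : T -> R[i]) = (g' \- g) \+ g by apply/funext => x /=; rewrite subrK.
  rewrite [in leLHS]gE.
  have hg : (cLnorm mu q (g' \- g)%R <= 1%:E)%E by rewrite cLnormN; exact: ltW gg'.
  apply: (le_trans (cLnorm_triangle _ hq (measurable_csub mg' mg) mg)).
  apply: (@le_trans _ _ (1%:E + r%:E)%E); first by apply: leeD => //; rewrite /r fineK.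
  by rewrite -EFinD lee_fin addrC.
move=> [N _ HN]; exists N%:R => g Xg; apply: (HN N) => /=; first exact: leqnn.
exact: subset_closure.
Qed.

(** The image of the closed unit ball is bounded, and homogeneity extends the bound. Dividing by r +
    e instead of the norm r includes functions of norm 0. *)
Lemma compact_op_bounded (S : (T -> R[i]) -> (T -> R[i])) :
  (forall (c : R) f, cLfun mu p f -> S (fun x => (c%:C)%C * f x) = fun x => (c%:C)%C * S f x) ->
  compact_op mu p hq S -> bounded_op mu p q S.
Proof.
move=> SZ [Spq Scomp].
pose A := [set f | cLfun mu p f /\ (cLnorm mu p f <= 1%:E)%E].
have [N HN] : exists N : R, forall f, A f -> (cLnorm mu q (S f) <= N%:E)%E.
  have [||N HN] := precompact_cLnorm_bounded (Scomp A _ _).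
  - by move=> f [].
  - by exists 1 => f [].
  by exists N => f Af; apply: (HN (CLfun hq (Spq f Af.1))); exists f.
have N0 : 0 <= N.
  have A0 : A (cst 0).
    by split; first (split; first exact: measurable_cst); rewrite cLnorm0 ?lee_fin.
  by rewrite -lee_fin; exact: le_trans (cLnorm_ge0 mu q _) (HN _ A0).
exists N => f fp; split; first exact: Spq.
have [mf fpoo] := fp.
have f_fin : cLnorm mu p f \is a fin_num by rewrite ge0_fin_numE ?cLnorm_ge0.
have r0 : 0 <= fine (cLnorm mu p f) by rewrite fine_ge0// cLnorm_ge0.
rewrite -(fineK f_fin); move: (fine _) (fineK f_fin) r0 => r fr r0.
suff H (e : R) : 0 < e -> (cLnorm mu q (S f) <= (N * (r + e))%:E)%E.
  apply/lee_addgt0Pr => e e0; have N1 : 0 < N + 1 by lra.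
  apply: le_trans (H (e / (N + 1)) _) _; first by rewrite divr_gt0.
  rewrite -EFinM -EFinD lee_fin mulrDr lerD2l mulrCA ler_piMr ?(ltW e0)//.
  by rewrite ler_pdivrMr// mul1r; lra.
move=> e0; pose c := (r + e)^-1; have c0 : 0 < c by rewrite invr_gt0 ltr_wpDl.
have cf : cLnorm mu p (fun x => (c%:C)%C * f x) = (c * r)%:E by rewrite cLnormZ// -fr.
have mcf : measurable_fun setT (fun x => (c%:C)%C * f x).
  by apply: measurable_cmul => //; exact: measurable_cst.
have /HN : A (fun x => (c%:C)%C * f x).
  split; first by split=> //; rewrite cf ltry.
  by rewrite cf lee_fin /c mulrC ler_pdivrMr ?mul1r ?lerDl ?(ltW e0)// ltr_wpDl.
rewrite SZ// cLnormZ//; last exact: (Spq f fp).1.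
by rewrite -lee_pdivlMl// /c invrK [(r + e)%:E]/= -EFinM mulrC.
Qed.

End compact_bounded.

(** * Identification of the two operators and the equivalence *)

Section bergman_kernels.
Variables (R : realType) (d : nat) (alpha : R).
Local Notation Cd := (d.-tuple R[i]).
Local Notation v := (ball_measure R d).

Let op_eq (S : (Cd -> R[i]) -> Cd -> R[i]) (k kap : R[i] -> R[i]) :
  (forall f z, S f z = kernel_op k f z) -> (forall u, 0 < complex.Re u -> k u = kap u) ->
  S = kernel_op kap.
Proof.
move=> Sk kk; apply/funext => f; rewrite -(kernel_op_eq f kk).
by apply/funext => z; exact: Sk.
Qed.

Lemma K_opE : @K_op R d alpha = kernel_op (K_kernel alpha).
Proof.
apply: (op_eq (k := fun u => (cpow u alpha)^-1)) => // u; exact: cpowV.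
Qed.

Lemma Kplus_opE : @Kplus_op R d alpha = kernel_op (Kplus_kernel alpha).
Proof.
apply: (op_eq (k := fun u => ((normc u `^ alpha)%:C)%C^-1)) => // u u0.
by rewrite /Kplus_kernel powRN fmorphV.
Qed.

End bergman_kernels.

Theorem theorem1 (R : realType) (d : nat) (alpha : R) (p q : \bar R)
  (hd : (1 <= d)%N)
  (halpha : d%:R + 1 < alpha < d%:R + 2)
  (hp : (1 <= p)%E) (hq : (1 <= q)%E) :
  [<-> bounded_op (ball_measure R d) p q (K_op alpha);
       bounded_op (ball_measure R d) p q (Kplus_op alpha);
       compact_op (ball_measure R d) p hq (K_op alpha);
       [/\ (((d%:R + 2 - alpha)^-1)%:E < p)%E, (p < +oo)%E
         & (q^-1 > p^-1 + (alpha - (d%:R + 1))%:E)%E]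
       \/ (p = +oo%E /\ (q < ((alpha - (d%:R + 1))^-1)%:E)%E)].
Proof.
have /andP[a1 _] := halpha.
have a0 : 0 < alpha by have : 0 <= d%:R :> R := ler0n _ _; lra.
rewrite K_opE Kplus_opE.
case: d hd halpha a1 => [//|n] hd' ha a1.
have mK := @measurable_K_kernel R alpha; have mP := @measurable_Kplus_kernel R alpha.
have K_le u : 0 < complex.Re u -> normc (K_kernel alpha u) <= normc u `^ (- alpha) by rewrite normc_K_kernel.
have P_le u : 0 < complex.Re u -> normc (Kplus_kernel alpha u) <= normc u `^ (- alpha) by rewrite normc_Kplus_kernel.
have necK := kernel_op_necessary mK K_le ha (fun u => @Re_K_kernel_ge R alpha u a0) hp hq.
have necP := kernel_op_necessary mP P_le ha (fun u _ _ => @Re_Kplus_kernel_ge R alpha u) hp hq.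
(* The two operators are never compared directly: the implications from (1) to (2) and from (2) to
   (3) also pass through condition (4). *)
tfae.
- by move=> /necK; exact: (kernel_op_sufficient hd' mP P_le ha hp hq).
- move=> /necP; apply: (kernel_op_compact hd' mK K_le ha _ hp).
  by move=> c; exact: K_kernel_lipschitz (ltW a0).
- move=> cK; apply: necK; apply: (compact_op_bounded hp _ cK) => c f fp.
  by apply: (kernel_opZ mK K_le); exact: cLfun_integrable_c fp.
- exact: (kernel_op_sufficient hd' mK K_le ha hp hq).
Qed.
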